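(* Let $\Omega\subset\mathbb{R}^2$ be a smooth bounded domain, $0<\mu<1$, $0<\beta<1$, and suppose $f$ satisfies $(f_1)$–$(f_6)$ listed in the context. Let $\epsilon_0>0$, $\delta_0>0$ be constants such that $-\log\left(t+\frac{\epsilon}{t+\epsilon}\right)\ge t$ for all $0\le t<\delta_0$ and $0<\epsilon<\epsilon_0$, and define $\epsilon^\ast=\min\{\epsilon_0,1/2\}$. Let $\psi$ be such that $$\psi\in C^2(\overline\Omega),\quad \psi>0\text{ in }\Omega,\quad \psi=0\text{ on }\partial\Omega,\quad \frac{|\nabla\psi|^2}{\psi}\text{ is bounded in }\Omega.$$ For each $0<\epsilon<\epsilon^\ast$ let $u_\epsilon$ be the nonnegative solution of $(\mathcal P_{\epsilon,\lambda})$ described in the context, and let $M_1>0$ be a constant independent of $\epsilon$ with $|u_\epsilon|_\infty<M_1$. Then there is a constant $K>0$ such that $$\psi(x)|\nabla u_\epsilon(x)|^2\le K\,Z(u_\epsilon(x))\quad\text{for every }x\in\Omega,$$ where $$Z(t)=\begin{cases}\dfrac{t^2}{2}+\dfrac{t^{1-\beta}}{(1-\beta)^2}-\dfrac{t^{1-\beta}\log t}{1-\beta},&0\le t\le1,\\[2mm] t-\dfrac12+\dfrac{1}{(1-\beta)^2},&t\ge1\end{cases}$$ (with $Z(0)=0$). The constant $K$ is independent of $0<\epsilon<\epsilon^\ast$ and depends only on $\Omega$, $\psi$ and $M_1$ (the data $f,\beta,\mu,q,\lambda$ being fixed).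
   Context: Hypotheses on $f:[0,\infty)\to\mathbb{R}$: $(f_1)$ $f\in C^{1,\beta}(0,\infty)\cap C[0,\infty)$, where $C^{1,\beta}(0,\infty)$ means $C^1$ with locally $\beta$-Hölder continuous derivative. $(f_2)$ For all $\alpha>0$, $\lim_{t\to\infty}|f(t)|/\exp(\alpha t^2)=0$. $(f_3)$ There is a constant $1<r_0<2$ such that $\limsup_{t\to0^+}|f(t)|/t^{r_0}<\infty$. $(f_4)$ There is $l>0$ such that $t\mapsto f(t)/t^l$ is increasing on $(0,\infty)$. $(f_5)$ There are $T,T_0>0$ and $\gamma_0>0$ such that $0<t^{\gamma_0}F(t)\le T_0f(t)$ for all $t>T$. $(f_6)$ $\limsup_{t\to0^+}|f'(t)|<\infty$. $f$ is extended by $0$ to $(-\infty,0)$, and $F(t)=\int_0^tf(s)\,ds$. Fix $q$ with $0<q<1$ and $q<r_0-1$. For $0<\epsilon<1$, $$l_\epsilon(t)=-\frac{t^q}{(t+\epsilon)^{\beta+q}}\log\left(t+\frac{\epsilon}{t+\epsilon}\right)\ (t\ge0),\quad l_\epsilon(t)=0\ (t<0),\quad L_\epsilon(t)=\int_0^tl_\epsilon(s)\,ds.$$ Problem $(\mathcal P_{\epsilon,\lambda})$ is $$-\Delta u+l_\epsilon(u)=\lambda\left(\int_\Omega\frac{F(u(y))}{|x-y|^\mu}\,dy\right)f(u(x))\text{ in }\Omega,\quad u\ge0\text{ in }\Omega,\quad u=0\text{ on }\partial\Omega,$$ and a weak solution is $u\in H_0^1(\Omega)$, $u\ge0$, with $$\int_\Omega\nabla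 u\cdot\nabla\varphi+\int_\Omega l_\epsilon(u)\varphi=\lambda\int_\Omega\left(\int_\Omega\frac{F(u(y))}{|x-y|^\mu}dy\right)f(u(x))\varphi(x)\,dx\quad\text{for all }\varphi\in H_0^1(\Omega).$$ Its energy is $$J_{\epsilon,\lambda}(u)=\frac{\|u\|^2}{2}+\int_\Omega L_\epsilon(u)\,dx-\frac\lambda2\int_\Omega\int_\Omega\frac{F(u(y))F(u(x))}{|x-y|^\mu}\,dy\,dx,\qquad \|u\|=\left(\int_\Omega|\nabla u|^2\right)^{1/2}.$$ The paper shows that there are $\bar\lambda,m_1>0$ such that, for each fixed $\lambda\in(0,\bar\lambda)$, there are constants $m_2,M,M_1>0$ independent of $\epsilon$ for which $(\mathcal P_{\epsilon,\lambda})$ has a nonnegative weak solution $u_\epsilon$ with $m_1<J_{\epsilon,\lambda}(u_\epsilon)<m_2$, $\|u_\epsilon\|\le M$ and $|u_\epsilon|_\infty<M_1$ (for all $0<\epsilon<\epsilon^\ast$). Here $\lambda\in(0,\bar\lambda)$ is fixed and $u_\epsilon$ denotes such a solution; it is identified with its $C^1(\overline\Omega)$ representative, which exists by elliptic regularity. $|\cdot|_\infty$ is the norm of $L^\infty(\Omega)$. *)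

(* Defs.v *)
From HB Require Import structures.
From mathcomp Require Import all_boot all_order all_algebra.
From mathcomp Require Import all_classical all_reals all_analysis.
Set Implicit Arguments.
Unset Strict Implicit.
Unset Printing Implicit Defensive.
Import Order.TTheory GRing.Theory Num.Theory.
Import numFieldNormedType.Exports.
Local Open Scope classical_set_scope.
Local Open Scope ring_scope.

Section Plane.
Context {R : realType}.
Implicit Types (Omega : set (R * R)) (u phi : R * R -> R) (du : R * R -> R * R).

(* The plane is [R * R]; the norm that the library puts on a product is the
   maximum norm, so the Euclidean quantities are written out. *)
Definition dot (v w : R * R) : R := v.1 * w.1 + v.2 * w.2.
Definition enorm (v : R * R) : R := Num.sqrt (dot v v).

Definition grad u (x : R * R) : R * R :=
  ('D_((1, 0) : R * R) u x, 'D_((0, 1) : R * R) u x).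

Definition leb2 := (@lebesgue_measure R \x @lebesgue_measure R)%E.

Definition boundary Omega := closure Omega `\` interior Omega.

(* Up to exchanging and reversing the coordinate axes, Omega is near each of its
   boundary points the open region above the graph of a C^oo function. *)
Definition smooth_boundary Omega := forall x0, boundary Omega x0 ->
  exists (r : R) (g : R -> R) (swap down : bool),
    [/\ 0 < r,
        forall n t, derivable (derive1n n g) t 1 &
        forall x, enorm (x - x0) < r ->
          let y := if swap then (x.2, x.1) else x in
          Omega x <-> g y.1 < (-1) ^+ down * y.2].

Definition smooth_bounded_domain Omega :=
  [/\ Omega !=set0, open Omega, connected Omega,
      bounded_set Omega & smooth_boundary Omega].

(* C^k of the closure of the open set Omega: the partial derivatives of order at
   most k exist in Omega and extend continuously to the closure.  The values of
   u outside the closure play no role. *)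
Fixpoint Ck_closure (k : nat) Omega u : Prop :=
  {within closure Omega, continuous u} /\
  match k with
  | 0 => True
  | k'.+1 => exists g1 g2 : R * R -> R,
      [/\ Ck_closure k' Omega g1, Ck_closure k' Omega g2 &
          forall x, Omega x -> is_derive x ((1, 0) : R * R) u (g1 x) /\
                               is_derive x ((0, 1) : R * R) u (g2 x)]
  end.

(* C_c^oo(Omega), each function being extended by zero to the plane *)
Definition test_function Omega phi :=
  [/\ forall k, Ck_closure k setT phi,
      compact (closure [set x | phi x != 0]) &
      closure [set x | phi x != 0] `<=` Omega].

Definition L2 Omega u := u \_ Omega \in Lfun leb2 2%:E.

Definition L2_cvg Omega (v : nat -> R * R -> R) u :=
  ('N[leb2]_2%:E[EFin \o ((v n \- u)%R \_ Omega)] @[n --> \oo] --> 0)%E.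

Definition Linfty_norm Omega u : \bar R :=
  ('N[leb2]_+oo[EFin \o (u \_ Omega)])%E.

Definition weak_gradient Omega u du := forall phi, test_function Omega phi ->
  \int[leb2]_(x in Omega) (u x * (grad phi x).1)
    = - (\int[leb2]_(x in Omega) ((du x).1 * phi x)) /\
  \int[leb2]_(x in Omega) (u x * (grad phi x).2)
    = - (\int[leb2]_(x in Omega) ((du x).2 * phi x)).

(* u belongs to H^1(Omega) and du is (a representative of) its weak gradient *)
Definition H1 Omega u du :=
  [/\ L2 Omega u, L2 Omega (fst \o du), L2 Omega (snd \o du)
    & weak_gradient Omega u du].

(* H_0^1(Omega): the closure of C_c^oo(Omega) in H^1(Omega) *)
Definition H10 Omega u du := H1 Omega u du /\
  exists phi : nat -> R * R -> R,
    [/\ forall n, test_function Omega (phi n),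
        L2_cvg Omega phi u,
        L2_cvg Omega (fun n x => (grad (phi n) x).1) (fst \o du) &
        L2_cvg Omega (fun n x => (grad (phi n) x).2) (snd \o du)].

(* the norm |u| = (int |grad u|^2)^(1/2) of H_0^1(Omega) *)
Definition H10_norm Omega du : R :=
  Num.sqrt (\int[leb2]_(x in Omega) (dot (du x) (du x))).

End Plane.

Section Nonlinearity.
Context {R : realType}.
Implicit Types (f g : R -> R) (beta q eps t : R).

(* int_0^t g; it vanishes for t < 0, where the interval is empty, in accordance
   with the extension by zero of the functions it is applied to. *)
Definition prim g t : R := \int[lebesgue_measure]_(s in `[0, t]) g s.

Definition hyp_f1 beta f :=
  [/\ forall t, 0 < t -> derivable f t 1,
      forall a b : R, 0 < a -> a < b -> exists C : R, forall s t : R,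
        s \in `[a, b] -> t \in `[a, b] ->
        `|derive1 f s - derive1 f t| <= C * `|s - t| `^ beta &
      {within `[0, +oo[, continuous f}].

Definition hyp_f2 f := forall alpha, 0 < alpha ->
  `|f t| / expR (alpha * t ^+ 2) @[t --> +oo] --> 0.

Definition hyp_f3 (r0 : R) f :=
  (limf_esup (fun t => (`|f t| / t `^ r0)%:E) 0^'+ < +oo)%E.

(* "increasing" in the wide sense, so that the strict reading is covered *)
Definition hyp_f4 f := exists2 l, 0 < l &
  forall s t, 0 < s -> s <= t -> f s / s `^ l <= f t / t `^ l.

Definition hyp_f5 f := exists T T0 gamma0,
  [/\ 0 < T, 0 < T0, 0 < gamma0 &
      forall t, T < t -> 0 < t `^ gamma0 * prim f t <= T0 * f t].

Definition hyp_f6 f := (limf_esup (fun t => `|derive1 f t|%:E) 0^'+ < +oo)%E.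

Definition l_eps beta q eps t : R :=
  if t < 0 then 0
  else - (t `^ q / (t + eps) `^ (beta + q)) * ln (t + eps / (t + eps)).

Definition L_eps beta q eps : R -> R := prim (l_eps beta q eps).

(* Z 0 = 0, since 0 `^ (1 - beta) = 0 for beta < 1 and ln 0 = 0 *)
Definition Z beta t : R :=
  if t <= 1 then
    t ^+ 2 / 2 + t `^ (1 - beta) / (1 - beta) ^+ 2
      - t `^ (1 - beta) * ln t / (1 - beta)
  else t - 1 / 2 + 1 / (1 - beta) ^+ 2.

End Nonlinearity.

Section Problem.
Context {R : realType}.
Variables (Omega : set (R * R)) (mu beta q lambda : R) (f : R -> R).
Implicit Types (eps : R) (u phi : R * R -> R) (du dphi : R * R -> R * R).

Definition choquard u (x : R * R) : R :=
  \int[leb2]_(y in Omega) (prim f (u y) / enorm (x - y) `^ mu).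

Definition weak_solution eps u du :=
  [/\ H10 Omega u du,
      {ae leb2, forall x, Omega x -> 0 <= u x} &
      forall phi dphi, H10 Omega phi dphi ->
        \int[leb2]_(x in Omega) (dot (du x) (dphi x))
          + \int[leb2]_(x in Omega) (l_eps beta q eps (u x) * phi x)
        = lambda *
          \int[leb2]_(x in Omega) (choquard u x * f (u x) * phi x)].

Definition energy eps u du : R :=
  H10_norm Omega du ^+ 2 / 2
  + \int[leb2]_(x in Omega) (L_eps beta q eps (u x))
  - lambda / 2 * \int[leb2]_(x in Omega)
      (\int[leb2]_(y in Omega)
        (prim f (u y) * prim f (u x) / enorm (x - y) `^ mu)).

(* a nonnegative weak solution, given by its representative in C^1 of the
   closure, subject to the bounds on the energy and on the norms *)
Definition bounded_solution (m1 m2 M M1 : R) eps u :=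
  Ck_closure 1 Omega u /\
  exists du, [/\ weak_solution eps u du,
                 m1 < energy eps u du < m2,
                 H10_norm Omega du <= M &
                 (Linfty_norm Omega u < M1%:E)%E].

End Problem.

(* Main.v *)
Require Import Defs.
From mathcomp Require Import all_boot all_order all_algebra.
From mathcomp Require Import all_classical all_reals all_analysis.
From mathcomp Require Import ring lra.
Set Implicit Arguments.
Unset Strict Implicit.
Unset Printing Implicit Defensive.
Import Order.TTheory GRing.Theory Num.Theory.
Import numFieldNormedType.Exports.
Local Open Scope classical_set_scope.
Local Open Scope ring_scope.

(* A Bernstein estimate that uses only C^1 regularity of the weak solution.  The
   function Z is concave, with Z' = dZ >= 1 and c0 Z <= t dZ <= Z, and the equation
   bounds the weak Laplacian of u by a multiple of dZ(u + d) for every d in (0, eps]: the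
   term l_eps(u) by comparison of the logarithms, the nonlocal term because it is bounded.

   Where d(x)^2 |grad u|^2 / Z(u) is maximal on a ball, d being the distance to its
   boundary, put s = u(x), g = |grad u(x)|, and average against a smooth kernel on the
   ball of radius s / (8 g) about x.  Mean value identities, obtained by testing the
   equation with radial potentials, show that the averages of u and of its gradient are
   close to s and to grad u(x).  On the other hand |grad u| is at most about
   g sqrt(Z(u) / Z(s)), and since u must vary on this ball, strict concavity of the square
   root makes the average of the gradient smaller than g by a fixed factor, unless g^2 is
   at most a multiple of Z(s).  Hence r^2 |grad u(x)|^2 <= K Z(u(x)) on every ball of
   radius r about x contained in Omega.

   As |grad psi|^2 <= C psi, the square root of psi is Lipschitz, so the ball about x whose
   radius is a small multiple of sqrt(psi(x)) lies in Omega, and r^2 is then a multiple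
   of psi(x). *)

(** Only C^1 regularity is available, so second-order information enters solely as the
    distributional bound [weakLap]. Testing it with a radial potential controls the average of [u];
    testing it with first derivatives of the potential controls the averages of the gradient.

    The radius [s / (8 * g)] is the natural scale. Write [g^2 = Q * Z(s)]. The Laplacian is at most
    of order [C1 * Z(s) / s] on the ball, and multiplied by the squared radius this is of order
    [C1 * s / Q]. All errors are thus relative errors of order [C1 / Q], small for large [Q],
    whereas the gain from strict concavity depends only on [c0] and the kernel. The bound
    [c0 * Z <= t * dZ] is what produces this gain: a nearly flat [Z] would not transmit the
    variation of [u] to the square root.

    The weight [d(x)^2] keeps the small ball inside the large one and lets [|grad u|^2 / Z(u)]
    exceed its value at the maximum point only by a factor close to 1.

    [dZ] blows up at 0, where [u] may vanish. Hence [u + d] replaces [u]: constants do not affect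
    the Laplacian, the estimate is uniform in [d], and [d] tends to 0 with [eps] fixed. *)

Section SmoothReal.

(** * Smooth functions of one variable: flat functions and a bump *)

Context {R : realType}.
Implicit Types (f g : R -> R) (k : nat) (t x : R) (p : {poly R}).

(** Derivatives are witnessed one order at a time, in the shape of [Ck_closure], so that
    [CkT_radial] carries smoothness to the plane by a single induction. *)
Fixpoint Ck1 (k : nat) f : Prop :=
  match k with
  | 0 => continuous f
  | k'.+1 => exists g, Ck1 k' g /\ forall x, is_derive x 1 f (g x)
  end.

Lemma is_derive_continuous1 f x d : is_derive x 1 f d -> {for x, continuous f}.
Proof.
by move=> fd; apply: differentiable_continuous; apply/derivable1_diffP.
Qed.

Lemma Ck1_continuous k f : Ck1 k f -> continuous f.
Proof. by case: k => //= k [g [_ fg]] x; exact: is_derive_continuous1 (fg x). Qed.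

Lemma Ck1W k f : Ck1 k.+1 f -> Ck1 k f.
Proof.
elim: k f => [|k IH] f; first by move=> /Ck1_continuous.
by move=> [g [/IH gk fg]]; exists g.
Qed.

Lemma Ck1_cst k (a : R) : Ck1 k (cst a).
Proof.
elim: k a => [|k IH] a /=; first exact: cst_continuous.
by exists (cst 0); split=> // x; exact: is_derive_cst.
Qed.

Lemma Ck1D k f g : Ck1 k f -> Ck1 k g -> Ck1 k (f \+ g).
Proof.
elim: k f g => [|k IH] f g /=.
  by move=> cf cg x; apply: continuousD; [exact: cf|exact: cg].
move=> [f' [kf ff]] [g' [kg gg]]; exists (f' \+ g'); split; first exact: IH.
by move=> x; exact: is_deriveD.
Qed.

Lemma Ck1M k f g : Ck1 k f -> Ck1 k g -> Ck1 k (f \* g).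
Proof.
elim: k f g => [|k IH] f g.
  by move=> cf cg x; apply: continuousM; [exact: cf|exact: cg].
move=> fk gk; move: (fk) (gk) => [f' [kf ff]] [g' [kg gg]].
exists ((f \* g') \+ (g \* f')); split.
  by apply: Ck1D; apply: IH => //; exact: Ck1W.
by move=> x; exact: is_deriveM.
Qed.

Lemma Ck1_ext k f g : f =1 g -> Ck1 k f -> Ck1 k g.
Proof. by move=> /funext ->. Qed.

Lemma Ck1Zl k (a : R) f : Ck1 k f -> Ck1 k (fun x => a * f x).
Proof. by move=> kf; exact: (Ck1M (Ck1_cst k a) kf). Qed.

Lemma Ck1_affine k (a b : R) f : Ck1 k f -> Ck1 k (fun x => f (a * x + b)).
Proof.
have da x : is_derive x 1 (fun x => a * x + b) a.
  have h : is_derive x 1 ((cst a \* id) \+ cst b) (a *: 1 + x *: 0 + 0).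
    exact: is_deriveD.
  by apply: (is_derive_eq h); rewrite scaler0 !addr0 [LHS]mulr1.
elim: k f => [|k IH] f.
  move=> cf x; apply: (@continuous_comp _ _ _ (fun x => a * x + b) f).
    exact: is_derive_continuous1 (da x).
  exact: cf.
move=> [g [kg fg]]; exists (fun x => a * g (a * x + b)); split.
  exact/Ck1Zl/IH.
move=> x; rewrite mulrC.
exact: (@is_derive1_comp _ f (fun x => a * x + b) x _ _ (fg _) (da x)).
Qed.

Lemma near_is_derive f g x d : (\near x, f x = g x) -> is_derive x 1 f d ->
  is_derive x 1 g d.
Proof. by move=> fg; apply: near_eq_is_derive => //; rewrite oner_neq0. Qed.

(** The support of [f] stays away from 0, and the derivative [g x / x - f x / x / x] is made of
    quotients of the same kind, to which the induction applies again. *)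
Lemma Ck1_div_id k f (a : R) : 0 < a ->
  (forall x, x < a -> f x = 0) -> Ck1 k f -> Ck1 k (fun x => f x / x).
Proof.
move=> a0; elim: k f => [|k IH] f f0.
  move=> cf x; have [xa|ax] := ltP x a.
    rewrite /continuous_at f0// mul0r.
    have h : (cst 0 : R -> R) @ x --> (0 : R) by exact: cvg_cst.
    apply: cvg_trans h; apply: near_eq_cvg; near=> y; rewrite f0 ?mul0r//.
    by near: y; exact: lt_nbhsl.
  by apply: cvgM; [exact: cf|apply: cvgV => //; rewrite gt_eqF// (lt_le_trans a0)].
move=> fk; move: (fk) => [g [kg fg]].
have IH' := IH f f0.
have g0 x : x < a -> g x = 0.
  move=> xa; have h : is_derive x 1 f 0.
    have hc (y : R) : is_derive y 1 (cst 0 : R -> R) 0 by exact: is_derive_cst.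
    apply: near_is_derive (hc _).
    by near=> y; rewrite f0//; near: y; exact: lt_nbhsl.
  by have [_ <-] := fg x; have [_ ->] := h.
exists ((fun x => g x / x) \+ (cst (-1) \* (fun x => (f x / x) / x))); split.
  apply: Ck1D; first exact: IH.
  apply: Ck1M; first exact: Ck1_cst.
  apply: IH; first by move=> x xa; rewrite f0// mul0r.
  exact/IH'/Ck1W.
move=> x; have [xa|ax] := ltP x a.
  rewrite /= f0// g0// !mul0r mulr0 addr0.
  have hc (y : R) : is_derive y 1 (cst 0 : R -> R) 0 by exact: is_derive_cst.
  apply: near_is_derive (hc _).
  by near=> y; rewrite f0 ?mul0r//; near: y; exact: lt_nbhsl.
have x0 : x != 0 by rewrite gt_eqF// (lt_le_trans a0).
have h : is_derive x 1 (f \* (fun y => y^-1)) (f x *: (- x ^- 2 *: 1) + x^-1 *: g x).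
  by apply: is_deriveM; apply: is_deriveV.
apply: (is_derive_eq h); rewrite /= /GRing.scale /=; field.
exact: x0.
Unshelve. all: by end_near. Qed.

(** The polynomial factor makes this family closed under differentiation; [p = 1] is the usual
    function [exp(-1/t)] extended by zero. *)
Definition flat p t : R := if 0 < t then p.[t^-1] * expR (- t^-1) else 0.

Lemma poly_le_expR p : exists2 C, 0 <= C &
  forall y, 0 <= y -> `|p.[y]| <= C * expR y.
Proof.
exists (\sum_(i < size p) `|p`_i| * i`!%:R).
  by apply: sumr_ge0 => i _; rewrite mulr_ge0.
move=> y y0; rewrite horner_coef mulr_suml (le_trans (ler_norm_sum _ _ _))//.
apply: ler_sum => i _; rewrite normrM -mulrA ler_wpM2l//.
rewrite ger0_norm ?exprn_ge0// -ler_pdivrMl ?ltr0n ?fact_gt0//.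
case: i => -[|i] hi /=; first by rewrite fact0 invr1 mul1r expr0 (le_trans _ (expR_ge1Dx _))// lerDl.
by rewrite mulrC (le_trans _ (expR_ge1Dxn i y0))// lerDr.
Qed.

(** Bounding ['X^2 * p] rather than [p] at [t^-1] gains the factor [t ^+ 2], which forces the
    derivative at 0 to vanish. *)
Lemma flat_bound p : exists2 C, 0 <= C & forall t, `|flat p t| <= C * t ^+ 2.
Proof.
have [C C0 hC] := poly_le_expR ('X^2 * p); exists C => // t; rewrite /flat.
case: ltP => t0; last by rewrite normr0 mulr_ge0// sqr_ge0.
have ti0 : 0 <= t^-1 by rewrite invr_ge0 ltW.
have := hC _ ti0; rewrite hornerM hornerXn normrM => h.
rewrite normrM (ger0_norm (expR_ge0 _)) expRN ler_pdivrMr ?expR_gt0//.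
rewrite -mulrA (mulrC (t ^+ 2)) mulrA -ler_pdivrMr ?exprn_gt0//.
apply: le_trans h; rewrite [`|_ ^+ 2|]ger0_norm ?exprn_ge0// mulrC exprVn.
by rewrite le_eqVlt eqxx.
Qed.

Lemma is_derive_quadratic0 f C x : (forall y, `|f y| <= C * (y - x) ^+ 2) ->
  is_derive x 1 f 0.
Proof.
move=> hf.
have C0 : 0 <= C by have := hf (x + 1); rewrite addrAC subrr add0r expr1n mulr1; apply: le_trans.
have fx0 : f x = 0 by apply/eqP; rewrite -normr_le0; have := hf x; rewrite subrr expr0n/= mulr0.
have cv : h^-1 *: (f (h *: 1 + x) - f x) @[h --> 0^'] --> 0.
  apply/cvgrPdist_le => e e0.
  near=> h; rewrite sub0r normrN fx0 subr0 normrZ.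
  have h0 : h != 0 by near: h; exact: nbhs_dnbhs_neq.
  rewrite normfV ler_pdivrMl ?normr_gt0//.
  apply: (le_trans (hf _)); rewrite addrK [_ *: 1]mulr1 -(ger0_norm (sqr_ge0 h)).
  rewrite normrX expr2 mulrA mulrC ler_wpM2l//.
  have : `|h| <= e / (C + 1).
    near: h; apply: dnbhs0_le; rewrite divr_gt0//; lra.
  rewrite ler_pdivlMr; last lra.
  by apply: le_trans; rewrite mulrC ler_wpM2l//; lra.
by split; [apply/cvg_ex; exists 0|apply: cvg_lim].
Unshelve. all: by end_near. Qed.

(** With [y = 1 / t] one has [dy/dt = - y^2], and [p(y) exp(-y)] has derivative
    [(p' - p)(y) exp(-y)] in [y]. *)
Lemma is_derive_flat p t : is_derive t 1 (flat p) (flat ('X^2 * (p - p^`())) t).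
Proof.
have [t0|t0|t0] := ltgtP t 0.
- rewrite {2}/flat ltNge (ltW t0)/=.
  have hc (y : R) : is_derive y 1 (cst 0 : R -> R) 0 by exact: is_derive_cst.
  apply: near_is_derive (hc _).
  near=> y; rewrite /flat ltNge; suff -> : y <= 0 by [].
  by apply/ltW; near: y; exact: lt_nbhsl.
- have tn : t != 0 by rewrite gt_eqF.
  apply: (@near_is_derive ((fun t => p.[t^-1]) \* (fun t => expR (- t^-1)))).
    near=> y; rewrite /flat; suff -> : 0 < y by [].
    by near: y; exact: lt_nbhsr.
  have hV : is_derive t 1 (fun y => y^-1) (- t ^- 2 *: 1) by exact: is_deriveV.
  have h1 : is_derive t 1 ((fun x => p.[x]) \o (fun t => t^-1)) (p^`().[t^-1] * (- t ^- 2 *: 1)).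
    exact: (@is_derive1_comp _ (horner p) _ _ _ _ (is_derive_poly p _) hV).
  have h2 : is_derive t 1 (expR \o (fun t => - t^-1)) (expR (- t^-1) * - (- t ^- 2 *: 1)).
    by apply: is_derive1_comp; exact: is_deriveN.
  apply: (is_derive_eq (is_deriveM h1 h2)).
  rewrite /flat t0 !hornerE /= /GRing.scale /=; field.
  exact: tn.
- rewrite t0 {2}/flat ltxx; have [C _ hC] := flat_bound p.
  by apply: (@is_derive_quadratic0 _ C) => y; rewrite subr0.
Unshelve. all: by end_near. Qed.

Lemma Ck1_flat k p : Ck1 k (flat p).
Proof.
elim: k p => [|k IH] p /=.
  by move=> x; exact: is_derive_continuous1 (is_derive_flat p x).
by exists (flat ('X^2 * (p - p^`()))); split=> // x; exact: is_derive_flat.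
Qed.

(** A bump on [[1/4, 1]]. It vanishes near 0 because the radial profile built from it is divided by
    its variable. *)
Definition cutoff t : R := flat 1 (t - 1/4) * flat 1 (1 - t).

Lemma Ck1_cutoff k : Ck1 k cutoff.
Proof.
apply: Ck1M.
  apply: (@Ck1_ext k (fun t => flat 1 (1 * t + (- (1 / 4))))); last exact/Ck1_affine/Ck1_flat.
  by move=> t; rewrite mul1r.
apply: (@Ck1_ext k (fun t => flat 1 (-1 * t + 1))); last exact/Ck1_affine/Ck1_flat.
by move=> t; rewrite mulN1r addrC.
Qed.

Lemma flat1_bounds t : 0 <= flat 1 t <= 1.
Proof.
rewrite /flat; case: ltP => t0; last by rewrite lexx ler01.
by rewrite hornerE mul1r expR_ge0 expR_le1 oppr_le0 invr_ge0 ltW.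
Qed.

Lemma cutoff_bounds t : 0 <= cutoff t <= 1.
Proof.
have /andP[a b] := flat1_bounds (t - 1/4); have /andP[c d] := flat1_bounds (1 - t).
by rewrite mulr_ge0//= mulr_ile1.
Qed.

Lemma cutoff0l t : t <= 1/4 -> cutoff t = 0.
Proof. by move=> h; rewrite /cutoff /flat ltNge subr_le0 h mul0r. Qed.

Lemma cutoff0r t : 1 <= t -> cutoff t = 0.
Proof. by move=> h; rewrite /cutoff /flat [X in _ * X]ifF ?mulr0// ltNge subr_le0 h. Qed.

Lemma cutoff_lower t : 1/2 <= t <= 3/4 -> expR (-8) <= cutoff t.
Proof.
move=> /andP[a b]; rewrite /cutoff /flat !ifT; [|lra|lra].
have e1 y : (1 : {poly R}).[y] = 1 by rewrite hornerE.
rewrite !e1 ![1 * expR _]mul1r -expRD ler_expR.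
have h1 : (t - 1/4)^-1 <= 4 by rewrite invf_ple ?posrE; lra.
have h2 : (1 - t)^-1 <= 4 by rewrite invf_ple ?posrE; lra.
lra.
Qed.

End SmoothReal.

(** * Partial and directional derivatives in the plane *)

Section PartialDerivatives.
Context {R : realType}.
Implicit Types (f g : R -> R) (u v : R * R -> R) (x z : R * R) (t d : R) (k : nat).

Lemma antiderivative g (a : R) : continuous g -> (forall t, t < a -> g t = 0) ->
  exists G : R -> R, (forall t, is_derive t 1 G (g t)) /\
    forall t, t < a -> G t = 0.
Proof.
move=> cg g0.
pose G t : R := \int[@lebesgue_measure R]_(s in `[a - 1, t]) g s.
have G0 t : t < a -> G t = 0.
  move=> ta; rewrite /G; under eq_Rintegral => s.
    rewrite inE/= in_itv/= => /andP[_ st]; rewrite g0; last exact: le_lt_trans ta.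
    over.
  by rewrite Rintegral_cst//= mul0r.
(* The fundamental theorem applies to the right of the base point [a - 1] only; below [a - 1/2] the
   function [G] is locally zero. *)
exists G; split=> // t; have [ta|at_] := ltP t (a - 1/2).
  rewrite g0; last lra.
  have hc (y : R) : is_derive y 1 (cst 0 : R -> R) 0 by exact: is_derive_cst.
  apply: near_is_derive (hc _); near=> y; rewrite G0//.
  by apply: (@lt_trans _ _ (a - 1/2)); [near: y; exact: lt_nbhsl|lra].
have [] := @continuous_FTC1_closed R g (a - 1) t (t + 1).
- lra.
- apply: continuous_compact_integrable; first exact: segment_compact.
  exact: continuous_subspaceT.
- lra.
- exact: cg.
by rewrite derive1E => dG <-; exact: derivableP.
Unshelve. all: by end_near. Qed.

Lemma is_derive_line u x z t d :
  is_derive (x + t *: z) z u d <-> is_derive t 1 (fun s => u (x + s *: z)) d.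
Proof.
have e : (fun h => h^-1 *: (u (h *: z + (x + t *: z)) - u (x + t *: z))) =
         (fun h => h^-1 *: (u (x + (h *: (1:R) + t) *: z) - u (x + t *: z))).
  apply/funext => h; congr (_ *: (u _ - _)).
  by rewrite [_ *: 1]mulr1 scalerDl addrCA.
by split=> -[]; rewrite /derivable/derive ?e => ? ?; split; rewrite /derivable/derive ?e.
Qed.

Lemma is_derive_fst u x d : is_derive x ((1, 0) : R * R) u d <->
  is_derive x.1 1 (fun s => u (s, x.2)) d.
Proof.
have e : (fun h => h^-1 *: (u (h *: ((1, 0) : R * R) + x) - u x)) =
         (fun h => h^-1 *: (u (h *: (1:R) + x.1, x.2) - u (x.1, x.2))).
  apply/funext => h; rewrite -surjective_pairing; congr (_ *: (u _ - _)).
  by rewrite {1}[x]surjective_pairing -[LHS]/(_, _)/= scaler0 add0r.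
by split=> -[]; rewrite /derivable/derive ?e => ? ?; split; rewrite /derivable/derive ?e.
Qed.

Lemma is_derive_snd u x d : is_derive x ((0, 1) : R * R) u d <->
  is_derive x.2 1 (fun s => u (x.1, s)) d.
Proof.
have e : (fun h => h^-1 *: (u (h *: ((0, 1) : R * R) + x) - u x)) =
         (fun h => h^-1 *: (u (x.1, h *: (1:R) + x.2) - u (x.1, x.2))).
  apply/funext => h; rewrite -surjective_pairing; congr (_ *: (u _ - _)).
  by rewrite {1}[x]surjective_pairing -[LHS]/(_, _)/= scaler0 add0r.
by split=> -[]; rewrite /derivable/derive ?e => ? ?; split; rewrite /derivable/derive ?e.
Qed.

Lemma MVT_ineq f (df : R -> R) (a b m M : R) : a <= b ->
  (forall t, a <= t <= b -> is_derive t 1 f (df t)) ->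
  (forall t, a < t < b -> m <= df t <= M) ->
  m * (b - a) <= f b - f a <= M * (b - a).
Proof.
rewrite le_eqVlt => /predU1P[->|ab] fd bd; first by rewrite !subrr !mulr0 lexx.
have cf : {within `[a, b], continuous f}.
  apply: derivable_within_continuous => t; rewrite in_itv/= => tab.
  by have [] := fd t tab.
have [t|c /[!in_itv]/= cab ->] := @MVT _ f df a b ab _ cf.
  by rewrite in_itv/= => /andP[/ltW h1 /ltW h2]; apply: fd; rewrite h1 h2.
by have /andP[h1 h2] := bd c cab; rewrite !ler_wpM2r// subr_ge0 ltW.
Qed.

Lemma MVT_norm f (df : R -> R) (a b M : R) :
  (forall t, Num.min a b <= t <= Num.max a b -> is_derive t 1 f (df t)) ->
  (forall t, Num.min a b <= t <= Num.max a b -> `|df t| <= M) ->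
  `|f b - f a| <= M * `|b - a|.
Proof.
wlog ab : a b / a <= b.
  move=> H; have /orP[ab|ba] := le_total a b; first exact: H.
  move=> h1 h2; rewrite distrC (distrC b); apply: H => // t.
    by rewrite minC maxC; exact: h1.
  by rewrite minC maxC; exact: h2.
rewrite (min_idPl ab) (max_idPr ab) => h1 h2.
rewrite [X in _ * X]ger0_norm ?subr_ge0//.
have := @MVT_ineq f df a b (-M) M ab h1; rewrite mulNr -ler_norml; apply.
by move=> t /andP[/ltW h3 /ltW h4]; rewrite -ler_norml h2// h3 h4.
Qed.

Lemma min_max_dist (a b s : R) :
  Num.min a b <= s <= Num.max a b -> `|a - s| <= `|b - a|.
Proof.
case: (leP a b) => ab /andP[h1 h2].
  by rewrite distrC !ger0_norm ?subr_ge0// lerB.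
by rewrite [leRHS]distrC !ger0_norm ?subr_ge0 ?(ltW ab)// lerB.
Qed.

(** The increment is split at the corner [(x.1, p2)]. On each of the two sides the mean value
    inequality compares one partial derivative with its value at [x]. *)
Lemma is_derive_partials u (g1 g2 : R * R -> R) x z :
  (\near x, is_derive x ((1, 0) : R * R) u (g1 x)) ->
  (\near x, is_derive x ((0, 1) : R * R) u (g2 x)) ->
  {for x, continuous g1} -> {for x, continuous g2} ->
  is_derive x z u (g1 x * z.1 + g2 x * z.2).
Proof.
move=> d1 d2 c1 c2.
suff cv : h^-1 *: (u (h *: z + x) - u x) @[h --> 0^'] --> g1 x * z.1 + g2 x * z.2.
  by split; [apply/cvg_ex; eexists; exact: cv|apply: cvg_lim].
apply/cvgrPdist_le => e e0.
pose e' := e / (`|z.1| + `|z.2| + 1).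
have e'0 : 0 < e' by rewrite divr_gt0// ltr_wpDl// addr_ge0.
have [r /= r0 H] : exists2 r : R, 0 < r & forall y, `|x.1 - y.1| < r -> `|x.2 - y.2| < r ->
    [/\ is_derive y ((1, 0) : R * R) u (g1 y), is_derive y ((0, 1) : R * R) u (g2 y),
       `|g1 x - g1 y| <= e' & `|g2 x - g2 y| <= e'].
  have /cvgrPdist_le/(_ _ e'0) n1 := c1; have /cvgrPdist_le/(_ _ e'0) n2 := c2.
  have [r r0 H] := (nbhs_ballP _ _).1 (filterI (filterI d1 d2) (filterI n1 n2)).
  by exists r => // y h1 h2; have [] := H y (conj h1 h2) => -[? ?] [? ?]; split.
near=> h; have h0 : h != 0 by near: h; exact: nbhs_dnbhs_neq.
have hz1 : `|h * z.1| < r.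
  rewrite normrM; apply: le_lt_trans (_ : `|h| * (`|z.1| + 1) < r).
    by rewrite ler_wpM2l// lerDl.
  rewrite -ltr_pdivlMr ?ltr_wpDl//; near: h; apply: dnbhs0_lt.
  by rewrite divr_gt0// ltr_wpDl.
have hz2 : `|h * z.2| < r.
  rewrite normrM; apply: le_lt_trans (_ : `|h| * (`|z.2| + 1) < r).
    by rewrite ler_wpM2l// lerDl.
  rewrite -ltr_pdivlMr ?ltr_wpDl//; near: h; apply: dnbhs0_lt.
  by rewrite divr_gt0// ltr_wpDl.
pose p1 := h * z.1 + x.1; pose p2 := h * z.2 + x.2.
have E1 : `|u (p1, p2) - u (x.1, p2) - h * z.1 * g1 x| <= e' * `|h * z.1|.
  have := @MVT_norm (fun s => u (s, p2) - g1 x * s) (fun s => g1 (s, p2) - g1 x) x.1 p1 e'.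
  rewrite [p1 - x.1]addrK.
  have -> : u (p1, p2) - g1 x * p1 - (u (x.1, p2) - g1 x * x.1) =
    u (p1, p2) - u (x.1, p2) - h * z.1 * g1 x by rewrite /p1; ring.
  have near_x s : Num.min x.1 p1 <= s <= Num.max x.1 p1 -> `|x.1 - s| < r.
    move=> /min_max_dist hs; apply: le_lt_trans hz1.
    by rewrite -(addrK x.1 (h * z.1)).
  have y2 : `|x.2 - p2| < r by rewrite distrC [p2 - _]addrK.
  apply=> s /near_x hs; have [] := H (s, p2) hs y2.
    move=> /is_derive_fst/= ds _ _ _; apply: (is_deriveB ds).
    have hid : is_derive s 1 (g1 x *: (id : R -> R)) (g1 x *: 1) by exact: is_deriveZ.
    by apply: (is_derive_eq hid); rewrite [LHS]mulr1.
  by move=> _ _ + _; rewrite distrC.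
have E2 : `|u (x.1, p2) - u (x.1, x.2) - h * z.2 * g2 x| <= e' * `|h * z.2|.
  have := @MVT_norm (fun s => u (x.1, s) - g2 x * s) (fun s => g2 (x.1, s) - g2 x) x.2 p2 e'.
  rewrite [p2 - x.2]addrK.
  have -> : u (x.1, p2) - g2 x * p2 - (u (x.1, x.2) - g2 x * x.2) =
    u (x.1, p2) - u (x.1, x.2) - h * z.2 * g2 x by rewrite /p2; ring.
  have near_x s : Num.min x.2 p2 <= s <= Num.max x.2 p2 -> `|x.2 - s| < r.
    move=> /min_max_dist hs; apply: le_lt_trans hz2.
    by rewrite -(addrK x.2 (h * z.2)).
  have y1 : `|x.1 - x.1| < r by rewrite subrr normr0.
  apply=> s /near_x hs; have [] := H (x.1, s) y1 hs.
    move=> _ /is_derive_snd/= ds _ _; apply: (is_deriveB ds).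
    have hid : is_derive s 1 (g2 x *: (id : R -> R)) (g2 x *: 1) by exact: is_deriveZ.
    by apply: (is_derive_eq hid); rewrite [LHS]mulr1.
  by move=> _ _ _; rewrite distrC.
have -> : h *: z + x = (p1, p2) by [].
rewrite -[u x](_ : u (x.1, x.2) = u x); last by rewrite -surjective_pairing.
have -> : g1 x * z.1 + g2 x * z.2 - h^-1 *: (u (p1, p2) - u (x.1, x.2)) =
  - (h^-1 * ((u (p1, p2) - u (x.1, p2) - h * z.1 * g1 x) +
             (u (x.1, p2) - u (x.1, x.2) - h * z.2 * g2 x))).
  by rewrite /GRing.scale/=; field.
rewrite normrN normrM normfV ler_pdivrMl ?normr_gt0//.
apply: le_trans (ler_normD _ _) _; apply: le_trans (lerD E1 E2) _.
rewrite !normrM -mulrDr -mulrDr mulrCA ler_wpM2l// mulrC -ler_pdivlMr//.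
rewrite /e' invf_div mulrCA divff ?gt_eqF// mulr1 lerDl ler01//.
Unshelve. all: by end_near. Qed.

End PartialDerivatives.

(** * Smooth functions on the plane, radial functions and Euclidean balls *)

Section SmoothPlane.
Context {R : realType}.
Implicit Types (f g Q : R -> R) (u v : R * R -> R) (x y z c : R * R) (t d s : R) (k : nat).

Lemma within_closureT u : {within closure setT, continuous u} <-> continuous u.
Proof. by rewrite closureT; exact: iff_sym (continuous_subspace_setT _). Qed.

Lemma CkT_continuous k u : Ck_closure k setT u -> continuous u.
Proof. by case: k => [|k] [/within_closureT]. Qed.

Lemma CkTW k u : Ck_closure k.+1 setT u -> Ck_closure k setT u.
Proof.
elim: k u => [|k IH] u; first by case.
by move=> [cu [g1 [g2 [/IH k1 /IH k2 du]]]]; split=> //; exists g1, g2.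
Qed.

Lemma CkT_cst k (a : R) : Ck_closure k setT (cst a : R * R -> R).
Proof.
elim: k a => [|k IH] a; split=> //.
- by apply/within_closureT; exact: cst_continuous.
- by apply/within_closureT; exact: cst_continuous.
by exists (cst 0), (cst 0); split=> // x _; split; exact: is_derive_cst.
Qed.

Lemma CkTD k u v : Ck_closure k setT u -> Ck_closure k setT v ->
  Ck_closure k setT (u \+ v).
Proof.
elim: k u v => [|k IH] u v [cu du] [cv dv]; split=> //.
- move: cu cv => /within_closureT cu /within_closureT cv; apply/within_closureT => x.
  by apply: continuousD; [exact: cu|exact: cv].
- move: cu cv => /within_closureT cu /within_closureT cv; apply/within_closureT => x.
  by apply: continuousD; [exact: cu|exact: cv].
move: du dv => [g1 [g2 [k1 k2 du]]] [h1 [h2 [l1 l2 dv]]].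
exists (g1 \+ h1), (g2 \+ h2); split; [exact: IH|exact: IH|move=> x _].
by have [a1 a2] := du x I; have [b1 b2] := dv x I; split; exact: is_deriveD.
Qed.

Lemma CkTM k u v : Ck_closure k setT u -> Ck_closure k setT v ->
  Ck_closure k setT (u \* v).
Proof.
elim: k u v => [|k IH] u v.
  move=> [/within_closureT cu _] [/within_closureT cv _]; split=> //.
  by apply/within_closureT => x; apply: continuousM; [exact: cu|exact: cv].
move=> ku kv; move: (ku) (kv) => [/within_closureT cu du] [/within_closureT cv dv].
split; first by apply/within_closureT => x; apply: continuousM; [exact: cu|exact: cv].
move: du dv => [g1 [g2 [k1 k2 du]]] [h1 [h2 [l1 l2 dv]]].
have {}ku := CkTW ku; have {}kv := CkTW kv.
exists ((u \* h1) \+ (v \* g1)), ((u \* h2) \+ (v \* g2)).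
split; [by apply: CkTD; exact: IH|by apply: CkTD; exact: IH|move=> x _].
by have [a1 a2] := du x I; have [b1 b2] := dv x I; split; exact: is_deriveM.
Qed.

Lemma is_derive_sub_cst (a t : R) : is_derive t 1 (fun s => s - a) 1.
Proof.
have h : is_derive t 1 ((id : R -> R) \- cst a) (1 - 0) by exact: is_deriveB.
by apply: (is_derive_eq h); rewrite subr0.
Qed.

Lemma CkT_fst k (a : R) : Ck_closure k setT (fun x : R * R => x.1 - a).
Proof.
have cu : continuous (fun x : R * R => x.1 - a).
  by move=> x; apply: continuousB; [exact: cvg_fst|exact: cst_continuous].
case: k => [|k]; split=> //; try exact/within_closureT.
exists (cst 1), (cst 0); split; [exact: CkT_cst|exact: CkT_cst|move=> x _; split].
  by apply/is_derive_fst; exact: is_derive_sub_cst.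
by apply/is_derive_snd => /=; exact: is_derive_cst.
Qed.

Lemma CkT_snd k (a : R) : Ck_closure k setT (fun x : R * R => x.2 - a).
Proof.
have cu : continuous (fun x : R * R => x.2 - a).
  by move=> x; apply: continuousB; [exact: cvg_snd|exact: cst_continuous].
case: k => [|k]; split=> //; try exact/within_closureT.
exists (cst 0), (cst 1); split; [exact: CkT_cst|exact: CkT_cst|move=> x _; split].
  by apply/is_derive_fst => /=; exact: is_derive_cst.
by apply/is_derive_snd; exact: is_derive_sub_cst.
Qed.

Definition sqdist c x : R := (x.1 - c.1) ^+ 2 + (x.2 - c.2) ^+ 2.

Lemma sqdist_ge0 c x : 0 <= sqdist c x.
Proof. by rewrite addr_ge0// sqr_ge0. Qed.

Lemma sqdist_continuous c : continuous (sqdist c).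
Proof.
have -> : sqdist c = ((fun x => x.1 - c.1) \* (fun x => x.1 - c.1)) \+
                     ((fun x => x.2 - c.2) \* (fun x => x.2 - c.2)).
  by apply/funext => x; rewrite /sqdist !expr2.
by apply: (@CkT_continuous 0); apply: CkTD; apply: CkTM; first [exact: CkT_fst|exact: CkT_snd].
Qed.

Lemma is_derive_sqr_add (a b t : R) :
  is_derive t 1 (fun s => (s - a) ^+ 2 + b) (2 * (t - a)).
Proof.
have h1 := is_derive_sub_cst a t.
have h : is_derive t 1 (((fun s => s - a) \* (fun s => s - a)) \+ cst b)
   ((t - a) *: 1 + (t - a) *: 1 + 0) by exact: (is_deriveD (is_deriveM h1 h1) (is_derive_cst _ _ _)).
apply: (is_derive_eq h); rewrite addr0 /GRing.scale/=; ring.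
Qed.

Lemma is_derive_radial_at Q (d : R) c x :
  is_derive (sqdist c x) 1 Q d ->
  is_derive x ((1, 0) : R * R) (Q \o sqdist c) (d * (2 * (x.1 - c.1))) /\
  is_derive x ((0, 1) : R * R) (Q \o sqdist c) (d * (2 * (x.2 - c.2))).
Proof.
move=> dQ; split.
  apply/is_derive_fst.
  exact: (@is_derive1_comp _ Q (fun s => (s - c.1) ^+ 2 + (x.2 - c.2) ^+ 2) _ _ _
    dQ (is_derive_sqr_add _ _ _)).
apply/is_derive_snd.
have h := is_derive_sqr_add c.2 ((x.1 - c.1) ^+ 2) x.2.
have -> : (fun s => (Q \o sqdist c) (x.1, s)) =
    Q \o (fun s => (s - c.2) ^+ 2 + (x.1 - c.1) ^+ 2).
  by apply/funext => s; rewrite /= /sqdist/= addrC.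
by apply: is_derive1_comp h; rewrite addrC.
Qed.

Lemma is_derive_radial Q (q : R -> R) c x :
  (forall t, is_derive t 1 Q (q t)) ->
  is_derive x ((1, 0) : R * R) (Q \o sqdist c) (q (sqdist c x) * (2 * (x.1 - c.1))) /\
  is_derive x ((0, 1) : R * R) (Q \o sqdist c) (q (sqdist c x) * (2 * (x.2 - c.2))).
Proof. by move=> dQ; exact: is_derive_radial_at. Qed.

Lemma CkT_radial k Q c : Ck1 k Q -> Ck_closure k setT (Q \o sqdist c).
Proof.
elim: k Q => [|k IH] Q kQ.
  split=> //; apply/within_closureT => x; apply: continuous_comp.
    exact: sqdist_continuous.
  exact: kQ.
split.
  apply/within_closureT => x; apply: continuous_comp.
    exact: sqdist_continuous.
  exact: (Ck1_continuous kQ).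
move: kQ => [q [kq dQ]].
exists ((q \o sqdist c) \* (cst 2 \* (fun x => x.1 - c.1))),
       ((q \o sqdist c) \* (cst 2 \* (fun x => x.2 - c.2))).
split; last by move=> x _; exact: is_derive_radial.
  by apply: CkTM; [exact: IH|apply: CkTM; [exact: CkT_cst|exact: CkT_fst]].
by apply: CkTM; [exact: IH|apply: CkTM; [exact: CkT_cst|exact: CkT_snd]].
Qed.

Definition cball2 c s : set (R * R) := [set x | sqdist c x <= s ^+ 2].

Lemma closed_cball2 c s : closed (cball2 c s).
Proof.
rewrite (_ : cball2 c s = sqdist c @^-1` [set t | t <= s ^+ 2])//.
by apply: preimage_closed; [move=> x _; exact: sqdist_continuous|exact: closed_le].
Qed.

Lemma cball2_coord c s x : 0 <= s -> cball2 c s x ->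
  `|x.1 - c.1| <= s /\ `|x.2 - c.2| <= s.
Proof.
rewrite /cball2/= /sqdist => s0 h.
have h1 := sqr_ge0 (x.1 - c.1); have h2 := sqr_ge0 (x.2 - c.2).
by split; rewrite -(@ler_pXn2r _ 2%N) ?nnegrE// -normrX ger0_norm//; lra.
Qed.

Lemma compact_cball2 c s : 0 <= s -> compact (cball2 c s).
Proof.
move=> s0; apply: (@subclosed_compact _ _ (`[c.1 - s, c.1 + s] `*` `[c.2 - s, c.2 + s])).
- exact: closed_cball2.
- by apply: compact_setX; exact: segment_compact.
move=> x /(cball2_coord s0)[h1 h2]; split=> /=; rewrite in_itv/=.
  by move: h1; rewrite ler_norml => /andP[? ?]; apply/andP; split; lra.
by move: h2; rewrite ler_norml => /andP[? ?]; apply/andP; split; lra.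
Qed.

Lemma test_function_cball2 (Omega : set (R * R)) c s phi : 0 <= s ->
  cball2 c s `<=` Omega -> (forall k, Ck_closure k setT phi) ->
  (forall x, ~ cball2 c s x -> phi x = 0) -> test_function Omega phi.
Proof.
move=> s0 sO kp p0.
have sub : closure [set x | phi x != 0] `<=` cball2 c s.
  rewrite [X in _ `<=` X](closure_id _).1; last exact: closed_cball2.
  by apply: closure_subset => x /=; apply: contra_neqP => /p0.
split=> //; last exact: subset_trans sub sO.
exact: subclosed_compact (@closed_closure _ _) (compact_cball2 s0) sub.
Qed.

Lemma derive_outside c s u x z d : ~ cball2 c s x ->
  (forall x, ~ cball2 c s x -> u x = 0) -> is_derive x z u d -> d = 0.
Proof.
move=> xs u0 [_ <-].
rewrite (@near_eq_derive _ _ _ u (cst 0)) ?derive_cst//.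
have : nbhs x (~` cball2 c s).
  by apply: open_nbhs_nbhs; split=> //; apply/closed_openC/closed_cball2.
by apply: filterS => y; exact: u0.
Qed.

End SmoothPlane.

(** * Comparison of integrals without measurability *)

Section IntegralGeneral.
Context d (T : measurableType d) (R : realType) (mu : {measure set T -> \bar R}).

Local Open Scope ereal_scope.
Import HBNNSimple.

(** The integral of a nonnegative function is a supremum over the simple functions below it, and
    enlarging the function enlarges the set of competitors. *)
Lemma ge0_le_integral_nomeas (f g : T -> \bar R) :
  (forall x, 0 <= f x) -> (forall x, f x <= g x) ->
  \int[mu]_x f x <= \int[mu]_x g x.
Proof.
move=> f0 fg; rewrite !ge0_integralTE//; last by move=> x; exact: le_trans (fg x).
apply: le_ereal_sup => _ [h hf <-]; exists h => // x.
exact: le_trans (hf x) (fg x).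
Qed.

(** The integrals of the positive and of the negative part both lie between 0 and that of [g], hence
    so does the absolute value of their difference. The nonlinear terms of the equation are thus
    bounded without discussing their measurability. *)
Lemma norm_Rintegral_le (f g : T -> R) : (forall x, (`|f x| <= g x)%R) ->
  \int[mu]_x (g x)%:E < +oo ->
  (`|\int[mu]_x f x| <= \int[mu]_x g x)%R.
Proof.
move=> fg goo.
have g0 x : 0 <= (g x)%:E by rewrite lee_fin (le_trans _ (fg x)).
have gf : \int[mu]_x (g x)%:E \is a fin_num.
  by rewrite ge0_fin_numE//; exact: integral_ge0.
have Hp : \int[mu]_x ((EFin \o f)^\+ x) <= \int[mu]_x (g x)%:E.
  apply: ge0_le_integral_nomeas => // x; rewrite funeposE ge_max g0 lee_fin.
  by rewrite (le_trans (ler_norm _))//= fg.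
have Hn : \int[mu]_x ((EFin \o f)^\- x) <= \int[mu]_x (g x)%:E.
  apply: ge0_le_integral_nomeas => // x; rewrite funenegE ge_max g0 lee_fin.
  by rewrite (le_trans (ler_norm _))//= normrN fg.
have p0 : 0 <= \int[mu]_x ((EFin \o f)^\+ x) by apply: integral_ge0.
have n0 : 0 <= \int[mu]_x ((EFin \o f)^\- x) by apply: integral_ge0.
have pf : \int[mu]_x ((EFin \o f)^\+ x) \is a fin_num.
  by rewrite ge0_fin_numE// (le_lt_trans Hp).
have nf : \int[mu]_x ((EFin \o f)^\- x) \is a fin_num.
  by rewrite ge0_fin_numE// (le_lt_trans Hn).
have -> : (\int[mu]_x f x = fine (\int[mu]_x ((EFin \o f)^\+ x)) -
    fine (\int[mu]_x ((EFin \o f)^\- x)))%R.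
  by rewrite /Rintegral integralE fineB.
rewrite /Rintegral; move: p0 n0 Hp Hn; rewrite -(fineK pf) -(fineK nf) -(fineK gf) !lee_fin => *.
by rewrite ler_norml; apply/andP; split; lra.
Qed.

End IntegralGeneral.

(** * Integration of continuous functions with bounded support on the plane *)

Section Plane.
Context {R : realType}.
Implicit Types (F G : R * R -> R).

(** The product sigma-algebra is generated by rectangles, and an open set is a countable union of
    boxes with rational centres and sides [2 / n.+1]. *)
Lemma open_measurable2 (U : set (R * R)) : open U ->
  measurable (U : set (measurableTypeR R * measurableTypeR R)).
Proof.
move=> oU.
pose box (i : rat * rat * nat) : set (R * R) :=
  `]ratr i.1.1 - i.2.+1%:R^-1, ratr i.1.1 + i.2.+1%:R^-1[ `*`
  `]ratr i.1.2 - i.2.+1%:R^-1, ratr i.1.2 + i.2.+1%:R^-1[.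
pose B (i : rat * rat * nat) : set (measurableTypeR R * measurableTypeR R) :=
  [set x | box i x /\ box i `<=` U].
have -> : U = \bigcup_i B i.
  apply/seteqP; split=> [x Ux|x [i _ [bx]]]; last by apply.
  have /nbhs_ballP[e /= e0 eU] : nbhs x U by exact: open_nbhs_nbhs.
  have [n _ /(_ n (leqnn n)) hn] := near_infty_natSinv_lt (PosNum (divr_gt0 e0 (ltr0n _ 2))).
  move: hn => /=; set r := n.+1%:R^-1 => hn.
  have r0 : 0 < r by rewrite invr_gt0.
  have [p] := @rat_in_itvoo R (x.1 - r) (x.1 + r) ltac:(lra).
  have [q] := @rat_in_itvoo R (x.2 - r) (x.2 + r) ltac:(lra).
  rewrite !in_itv/= => /andP[q1 q2] /andP[p1 p2].
  exists (p, q, n) => //; split.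
    by split; rewrite /= in_itv/= -/r; apply/andP; split; lra.
  move=> y [] /=; rewrite !in_itv/= -/r => /andP[y1 y2] /andP[y3 y4].
  by apply: eU; split; rewrite /ball/= ltr_norml; apply/andP; split; lra.
apply: countable_bigcupT_measurable => // i.
have [iU|iU] := pselect (box i `<=` U).
  rewrite (_ : B i = box i); last by apply/seteqP; split=> x // [].
  by apply: measurableX; exact: measurable_itv.
by rewrite (_ : B i = set0)//; apply/seteqP; split=> x // [].
Qed.

Lemma continuous_measurable2 F : continuous F ->
  measurable_fun setT (F : measurableTypeR R * measurableTypeR R -> R).
Proof.
move=> /continuousP cF; apply: (measurability _ (measurable_realfun.RGenOpens.measurableE R)).
move=> _ [_ [a [b ->] <-]]; rewrite setTI; apply: open_measurable2.
exact/cF/interval_open.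
Qed.

Definition compact_supp F := continuous F /\
  exists m : R, forall x, F x != 0 -> `|x.1| <= m /\ `|x.2| <= m.

Lemma compact_suppW F : compact_supp F -> exists2 m, 0 < m &
  forall x, ~ (`[- m, m] `*` `[- m, m])%classic x -> F x = 0.
Proof.
move=> [_ [m hm]]; exists (`|m| + 1); first by rewrite ltr_wpDl.
move=> x /= hx; apply: contra_notP hx => /eqP/hm[h1 h2].
have hm' := ler_norm m.
by split=> /=; rewrite in_itv/= -ler_norml; lra.
Qed.

Definition boxm (m : R) : set (measurableTypeR R * measurableTypeR R) :=
  `[- m, m] `*` `[- m, m].

Lemma measurable_boxm m : measurable (boxm m).
Proof. by apply: measurableX; exact: measurable_itv. Qed.

Lemma leb2_itv (a b c d : R) : a < b -> c < d ->
  leb2 (`[a, b] `*` `[c, d] : set (R * R)) = ((b - a) * (d - c))%:E.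
Proof.
move=> ab cd; rewrite /leb2 product_measure1E; try exact: measurable_itv.
have E (x y : R) : x < y -> lebesgue_measure (`[x, y] : set R) = (y - x)%:E.
  by move=> xy; rewrite lebesgue_measure_itv/= lte_fin xy -EFinB.
by rewrite EFinM -(E _ _ ab) -(E _ _ cd).
Qed.

Lemma compact_supp_bounded F : compact_supp F -> exists2 M, 0 < M & forall x, `|F x| <= M.
Proof.
move=> cF; have [m m0 hm] := compact_suppW cF.
have cpt : compact (`[- m, m] `*` `[- m, m] : set (R * R)).
  by apply: compact_setX; exact: segment_compact.
have /compact_bounded [M [_ hM]] : compact (F @` (`[- m, m] `*` `[- m, m])).
  by apply: continuous_compact cpt; apply: continuous_subspaceT; exact: cF.1.
exists (`|M| + 1); first by rewrite ltr_wpDl.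
move=> x; have [bx|/hm ->] := pselect ((`[- m, m] `*` `[- m, m]) x); last first.
  by rewrite normr0 addr_ge0.
by apply: hM; [rewrite (le_lt_trans (ler_norm _))// ltrDl|exists x].
Qed.

Lemma compact_supp_integrable F : compact_supp F ->
  (leb2 : {measure set _ -> \bar R}).-integrable setT (EFin \o F).
Proof.
move=> cF; have [m m0 hm] := compact_suppW cF.
have -> : EFin \o F = (EFin \o F) \_ (boxm m).
  apply/funext => x; rewrite /patch; case: ifPn => // /negP.
  by rewrite inE /= => /hm ->.
apply/(@integrable_restrict _ _ _ (lebesgue_measure \x lebesgue_measure)%E
  _ (measurable_boxm m) setT measurableT); rewrite setTI.
apply: measurable_bounded_integrable => //.
- exact: measurable_boxm.
- by rewrite -[X in (X < _)%E]/(leb2 (boxm m)) /boxm leb2_itv ?ltry//; lra.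
- apply: (@measurable_funS _ _ _ _ setT) => //.
  by apply: continuous_measurable2; exact: cF.1.
- have [M M0 hM] := compact_supp_bounded cF.
  by exists M; split; [exact: num_real|move=> y My x _ /=; exact: le_trans (hM x) (ltW My)].
Qed.


Definition rint F : R := \int[leb2]_x F x.

Lemma compact_suppD F G : compact_supp F -> compact_supp G -> compact_supp (F \+ G).
Proof.
move=> [cF [m hm]] [cG [n hn]]; split.
  by move=> x; apply: continuousD; [exact: cF|exact: cG].
exists (Num.max m n) => x /=; have [F0|/hm[h1 h2] _] := eqVneq (F x) 0; last first.
  by rewrite !le_max h1 h2.
by rewrite F0 add0r => /hn[h1 h2]; rewrite !le_max h1 h2 !orbT.
Qed.

Lemma compact_suppMl F G : continuous F -> compact_supp G ->
  compact_supp (fun x => F x * G x).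
Proof.
move=> cF [cG [m hm]]; split.
  by move=> x; apply: continuousM; [exact: cF|exact: cG].
by exists m => x; rewrite mulf_eq0 negb_or => /andP[_]; exact: hm.
Qed.

Lemma compact_suppZ (a : R) F : compact_supp F -> compact_supp (fun x => a * F x).
Proof. by move=> cF; apply: (@compact_suppMl (cst a)) => //; exact: cst_continuous. Qed.

Lemma compact_supp_norm F : compact_supp F -> compact_supp (fun x => `|F x|).
Proof.
move=> [cF [m hm]]; split.
  by move=> x; apply: continuous_comp; [exact: cF|exact: norm_continuous].
by exists m => x; rewrite normr_eq0; exact: hm.
Qed.

Lemma rintD F G : compact_supp F -> compact_supp G ->
  rint (fun x => F x + G x) = rint F + rint G.
Proof. by move=> cF cG; apply: RintegralD => //; exact: compact_supp_integrable. Qed.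

Lemma rintZ (a : R) F : compact_supp F -> rint (fun x => a * F x) = a * rint F.
Proof. by move=> cF; apply: RintegralZl => //; exact: compact_supp_integrable. Qed.

Lemma rintB F G : compact_supp F -> compact_supp G ->
  rint (fun x => F x - G x) = rint F - rint G.
Proof. by move=> cF cG; apply: RintegralB => //; exact: compact_supp_integrable. Qed.

Lemma rint_le F G : compact_supp F -> compact_supp G -> (forall x, F x <= G x) ->
  rint F <= rint G.
Proof.
by move=> cF cG FG; apply: le_Rintegral => //; exact: compact_supp_integrable.
Qed.

Lemma rint_ge0 F : (forall x, 0 <= F x) -> 0 <= rint F.
Proof. by move=> F0; apply: Rintegral_ge0. Qed.

Lemma pair_continuousl (y : R) : continuous (fun t : R => (t, y)).
Proof.
move=> t; apply/cvg_ballP => e e0; have := nbhsx_ballx t e e0.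
by apply: filterS => s ts; split=> //=; exact: ballxx.
Qed.

Lemma pair_continuousr (y : R) : continuous (fun t : R => (y, t)).
Proof.
move=> t; apply/cvg_ballP => e e0; have := nbhsx_ballx t e e0.
by apply: filterS => s ts; split=> //=; exact: ballxx.
Qed.

Lemma integral_vanish (g G : R -> R) (m : R) : 0 < m -> continuous g ->
  (forall t : R, is_derive t 1 G (g t)) -> (forall t, m <= `|t| -> g t = 0) ->
  G m = 0 -> G (- m) = 0 -> (\int[lebesgue_measure]_x (g x)%:E = 0)%E.
Proof.
move=> m0 cg dG g0 G1 G2.
have -> : (\int[lebesgue_measure]_x (g x)%:E =
           \int[lebesgue_measure]_(x in `[(- m)%R, m]) (g x)%:E)%E.
  rewrite [RHS]integral_mkcond; apply: eq_integral => x _; rewrite /patch.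
  case: ifPn => // /negP; rewrite inE/= in_itv/= -ler_norml => /negP.
  by rewrite -ltNge => /ltW/g0 ->.
rewrite (@continuous_FTC2 _ g G); first by rewrite G1 G2 subee.
- by rewrite gt0_cp.
- exact: continuous_subspaceT.
- have cG : continuous G by move=> t; exact: is_derive_continuous1 (dG t).
  split=> [t _||]; first by have [] := dG t.
    exact/cvg_at_right_filter/cG.
  exact/cvg_at_left_filter/cG.
- by move=> t _; rewrite derive1E; have [_ ->] := dG t.
Qed.

(** By Fubini one integrates first along horizontal lines, on which [F] is an antiderivative
    vanishing at both ends. *)
Lemma rint_derive_fst F F1 : compact_supp F -> compact_supp F1 ->
  (forall x, is_derive x ((1, 0) : R * R) F (F1 x)) -> rint F1 = 0.
Proof.
move=> [cF [m hm]] cF1 dF; have [cF1' [n hn]] := cF1.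
pose M := `|m| + `|n| + 1.
have hM1 x : M <= `|x.1| -> F x = 0.
  move=> h; apply/eqP/negP => /negP/hm[h1 _]; have := ler_norm m; have := normr_ge0 n.
  by move: h; rewrite /M; lra.
have hM2 x : M <= `|x.1| -> F1 x = 0.
  move=> h; apply/eqP/negP => /negP/hn[h1 _]; have := ler_norm n; have := normr_ge0 m.
  by move: h; rewrite /M; lra.
have M0 : 0 < M by rewrite /M ltr_wpDl// addr_ge0.
rewrite /rint /Rintegral.
rewrite -(integral21_prod_meas1 (compact_supp_integrable cF1)).
rewrite integral0_eq// => y _.
apply: (@integral_vanish (fun x => F1 (x, y)) (fun x => F (x, y)) M) => //.
- by move=> t; apply: (@continuous_comp _ _ _ (fun t => (t, y)) F1); [exact: pair_continuousl|exact: cF1'].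
- by move=> t; have /is_derive_fst := dF (t, y).
- by move=> t ht; exact: hM2.
- by apply: hM1; rewrite /= ger0_norm// ltW.
- by apply: hM1; rewrite /= normrN ger0_norm// ltW.
Qed.

Lemma rint_derive_snd F F2 : compact_supp F -> compact_supp F2 ->
  (forall x, is_derive x ((0, 1) : R * R) F (F2 x)) -> rint F2 = 0.
Proof.
move=> [cF [m hm]] cF1 dF; have [cF1' [n hn]] := cF1.
pose M := `|m| + `|n| + 1.
have hM1 x : M <= `|x.2| -> F x = 0.
  move=> h; apply/eqP/negP => /negP/hm[_ h1]; have := ler_norm m; have := normr_ge0 n.
  by move: h; rewrite /M; lra.
have hM2 x : M <= `|x.2| -> F2 x = 0.
  move=> h; apply/eqP/negP => /negP/hn[_ h1]; have := ler_norm n; have := normr_ge0 m.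
  by move: h; rewrite /M; lra.
have M0 : 0 < M by rewrite /M ltr_wpDl// addr_ge0.
rewrite /rint /Rintegral.
rewrite -(integral12_prod_meas1 (compact_supp_integrable cF1)).
rewrite integral0_eq// => y _.
apply: (@integral_vanish (fun x => F2 (y, x)) (fun x => F (y, x)) M) => //.
- by move=> t; apply: (@continuous_comp _ _ _ (fun t => (y, t)) F2); [exact: pair_continuousr|exact: cF1'].
- by move=> t; have /is_derive_snd := dF (y, t).
- by move=> t ht; exact: hM2.
- by apply: hM1; rewrite /= ger0_norm// ltW.
- by apply: hM1; rewrite /= normrN ger0_norm// ltW.
Qed.

End Plane.

(** * Testing the weak equation with functions supported in a ball *)

Section WeakForm.
Context {R : realType}.
Implicit Types (Omega : set (R * R)) (F G u v phi h : R * R -> R) (c x : R * R) (s : R).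

(** [h] is controlled inside [Omega] only. When [phi] is supported in a ball contained in [Omega],
    this product is continuous on the whole plane. *)
Definition ext Omega h phi : R * R -> R := (fun x => h x * phi x) \_ Omega.

Lemma extE Omega h phi x : Omega x -> ext Omega h phi x = h x * phi x.
Proof. by move=> Ox; rewrite /ext /patch mem_set. Qed.

Lemma ext_outside Omega c s h phi x : cball2 c s `<=` Omega ->
  (forall x, ~ cball2 c s x -> phi x = 0) -> ~ cball2 c s x -> ext Omega h phi x = 0.
Proof.
by move=> sO p0 xs; rewrite /ext /patch; case: ifPn => // _; rewrite p0// mulr0.
Qed.

Lemma nbhs_notin_cball2 c s x : ~ cball2 c s x -> nbhs x (~` cball2 c s).
Proof.
by move=> xs; apply: open_nbhs_nbhs; split=> //; exact/closed_openC/closed_cball2.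
Qed.

Lemma ext_compact_supp Omega c s h phi : open Omega -> 0 <= s ->
  cball2 c s `<=` Omega -> (forall x, Omega x -> {for x, continuous h}) ->
  continuous phi -> (forall x, ~ cball2 c s x -> phi x = 0) ->
  compact_supp (ext Omega h phi).
Proof.
move=> oO s0 sO ch cp p0; split.
  move=> x; have [Ox|Ox] := pselect (Omega x).
    have e : \forall y \near x, h y * phi y = ext Omega h phi y.
      have : nbhs x Omega by exact: open_nbhs_nbhs.
      by apply: filterS => y Oy; rewrite extE.
    rewrite /continuous_at extE//; apply: cvg_trans; first exact: near_eq_cvg e.
    exact: (continuousM (ch x Ox) (cp x)).
  have xs : ~ cball2 c s x by move=> /sO.
  have e : \forall y \near x, cst 0 y = ext Omega h phi y.
    have := nbhs_notin_cball2 xs; apply: filterS => y ys /=.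
    by rewrite (ext_outside _ sO).
  rewrite /continuous_at (ext_outside _ sO)//; apply: cvg_trans; first exact: near_eq_cvg e.
  exact: cvg_cst.
exists (`|c.1| + `|c.2| + s) => x; rewrite /ext /patch; case: ifPn => [_|_]; last by rewrite eqxx.
rewrite mulf_eq0 negb_or => /andP[_ px].
have /(cball2_coord s0)[h1 h2] : cball2 c s x.
  by apply: contrapT => /p0 e; rewrite e eqxx in px.
have := ler_normD (x.1 - c.1) c.1; have := ler_normD (x.2 - c.2) c.2.
by rewrite !subrK; have := normr_ge0 c.1; have := normr_ge0 c.2; lra.
Qed.

Lemma test_compact_supp c s phi : 0 <= s -> continuous phi ->
  (forall x, ~ cball2 c s x -> phi x = 0) -> compact_supp phi.
Proof.
move=> s0 cp p0.
have -> : phi = ext setT (cst 1) phi by apply/funext => x; rewrite extE// mul1r.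
by apply: (@ext_compact_supp _ c s) => //; [exact: openT|move=> x _; exact: cst_continuous].
Qed.

Lemma is_derive_ext Omega c s u g phi (phi' : R * R -> R) (z : R * R) : open Omega -> cball2 c s `<=` Omega ->
  (forall x, Omega x -> is_derive x z u (g x)) ->
  (forall x, is_derive x z phi (phi' x)) ->
  (forall x, ~ cball2 c s x -> phi x = 0) ->
  (forall x, ~ cball2 c s x -> phi' x = 0) ->
  forall x, is_derive x z (ext Omega u phi) (ext Omega u phi' x + ext Omega g phi x).
Proof.
move=> oO sO du dphi p0 p0' x; have [Ox|Ox] := pselect (Omega x).
  have e : \forall y \near x, (u \* phi) y = ext Omega u phi y.
    have : nbhs x Omega by exact: open_nbhs_nbhs.
    by apply: filterS => y Oy; rewrite extE.
  have d1 : is_derive x z (u \* phi) (u x *: phi' x + phi x *: g x).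
    by have := du x Ox; have := dphi x => ? ?; exact: is_deriveM.
  apply: (near_eq_is_derive e); apply: (is_derive_eq d1).
  by rewrite !extE// /GRing.scale/= (mulrC (phi x)).
have xs : ~ cball2 c s x by move=> /sO.
have e : \forall y \near x, (cst 0 : R * R -> R) y = ext Omega u phi y.
  have := nbhs_notin_cball2 xs; apply: filterS => y ys /=.
  by rewrite (ext_outside _ sO).
apply: (near_eq_is_derive e).
by rewrite !(ext_outside _ sO)// addr0; exact: is_derive_cst.
Qed.

(** The product [u * phi], extended by zero, is differentiable everywhere, and its partial
    derivatives integrate to zero. *)
Lemma rint_by_parts Omega c s u g1 g2 phi p1 p2 : open Omega -> 0 <= s ->
  cball2 c s `<=` Omega ->
  (forall x, Omega x -> {for x, continuous u}) ->
  (forall x, Omega x -> {for x, continuous g1}) ->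
  (forall x, Omega x -> {for x, continuous g2}) ->
  (forall x, Omega x -> is_derive x ((1, 0) : R * R) u (g1 x)) ->
  (forall x, Omega x -> is_derive x ((0, 1) : R * R) u (g2 x)) ->
  continuous phi -> continuous p1 -> continuous p2 ->
  (forall x, is_derive x ((1, 0) : R * R) phi (p1 x)) ->
  (forall x, is_derive x ((0, 1) : R * R) phi (p2 x)) ->
  (forall x, ~ cball2 c s x -> phi x = 0) ->
  rint (ext Omega u p1) = - rint (ext Omega g1 phi) /\
  rint (ext Omega u p2) = - rint (ext Omega g2 phi).
Proof.
move=> oO s0 sO cu c1 c2 d1 d2 cp cp1 cp2 dp1 dp2 p0.
have p10 x : ~ cball2 c s x -> p1 x = 0 by move=> xs; exact: (derive_outside xs p0 (dp1 x)).
have p20 x : ~ cball2 c s x -> p2 x = 0 by move=> xs; exact: (derive_outside xs p0 (dp2 x)).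
have k0 := ext_compact_supp oO s0 sO cu cp p0.
have k1 := ext_compact_supp oO s0 sO cu cp1 p10.
have k2 := ext_compact_supp oO s0 sO cu cp2 p20.
have k3 := ext_compact_supp oO s0 sO c1 cp p0.
have k4 := ext_compact_supp oO s0 sO c2 cp p0.
split; apply/eqP; rewrite -addr_eq0 -rintD//; apply/eqP.
  apply: (rint_derive_fst k0); first exact: compact_suppD.
  by apply: (is_derive_ext (c := c) (s := s)).
apply: (rint_derive_snd k0); first exact: compact_suppD.
by apply: (is_derive_ext (c := c) (s := s)).
Qed.

Lemma compact_supp_Lfun2 F : compact_supp F -> F \in Lfun leb2 2%:E.
Proof.
move=> cF; rewrite inE; apply/andP; split; rewrite inE/=.
  by apply: continuous_measurable2; exact: cF.1.
rewrite /finite_norm unlock /= poweR_lty//.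
under eq_integral do rewrite powR_mulrn// -normrX expr2.
by have /integrableP[_] := compact_supp_integrable (compact_suppMl cF.1 cF).
Qed.

(** The partial derivatives are named parameters, so that a derivative of a test function can itself
    be used as a test function. *)
Record ball_test (c : R * R) (s : R) (phi p1 p2 : R * R -> R) : Prop := BallTest {
  bt_smooth : forall k, Ck_closure k setT phi;
  bt_d1 : forall x, is_derive x ((1, 0) : R * R) phi (p1 x);
  bt_d2 : forall x, is_derive x ((0, 1) : R * R) phi (p2 x);
  bt_out : forall x, ~ cball2 c s x -> phi x = 0 }.

Lemma CkT_partials phi p1 p2 : (forall k, Ck_closure k setT phi) ->
  (forall x, is_derive x ((1, 0) : R * R) phi (p1 x)) ->
  (forall x, is_derive x ((0, 1) : R * R) phi (p2 x)) ->
  (forall k, Ck_closure k setT p1) /\ (forall k, Ck_closure k setT p2).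
Proof.
move=> kp d1 d2; split=> k; have [_ [g1 [g2 [k1 k2 dg]]]] := kp k.+1.
  rewrite (_ : p1 = g1)//; apply/funext => x.
  by have [[_ <-] _] := dg x I; have [_ <-] := d1 x.
rewrite (_ : p2 = g2)//; apply/funext => x.
by have [_ [_ <-]] := dg x I; have [_ <-] := d2 x.
Qed.

Lemma ball_test_grad c s phi p1 p2 : ball_test c s phi p1 p2 ->
  grad phi = fun x => (p1 x, p2 x).
Proof.
move=> bt; apply/funext => x; rewrite /grad.
by have [_ ->] := bt_d1 bt x; have [_ ->] := bt_d2 bt x.
Qed.

(** A constant sequence serves as the approximating one, and the weak gradient identity is
    integration by parts with the roles exchanged: [phi] provides the compact support. *)
Lemma ball_test_H10 Omega c s phi p1 p2 : open Omega -> 0 <= s ->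
  cball2 c s `<=` Omega -> ball_test c s phi p1 p2 -> H10 Omega phi (grad phi).
Proof.
move=> oO s0 sO bt; have [k1 k2] := CkT_partials (bt_smooth bt) (bt_d1 bt) (bt_d2 bt).
have tp : test_function Omega phi.
  by apply: (test_function_cball2 s0 sO); [exact: bt_smooth bt|exact: bt_out bt].
have p10 x : ~ cball2 c s x -> p1 x = 0 by move=> xs; exact: (derive_outside xs (bt_out bt) (bt_d1 bt x)).
have p20 x : ~ cball2 c s x -> p2 x = 0 by move=> xs; exact: (derive_outside xs (bt_out bt) (bt_d2 bt x)).
have pat h : (forall x, ~ cball2 c s x -> h x = 0) -> h \_ Omega = h.
  move=> h0; apply/funext => x; rewrite /patch; case: ifPn => // /negP.
  by rewrite inE => Ox; rewrite h0// => /sO.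
have cut h : (forall k, Ck_closure k setT h) -> (forall x, ~ cball2 c s x -> h x = 0) ->
    L2 Omega h.
  move=> kh h0; rewrite /L2 pat//; apply: compact_supp_Lfun2.
  by apply: (test_compact_supp s0 _ h0); exact: (CkT_continuous (kh 0%N)).
have L0 (h : R * R -> R) : L2_cvg Omega (fun=> h) h.
  rewrite /L2_cvg (_ : EFin \o (h \- h) \_ Omega = cst 0); last first.
    by apply/funext => x; rewrite /= /patch; case: ifP => // _; rewrite /= subrr.
  by rewrite Lnorm0 ?gt_eqF//; exact: cvg_cst.
split; last by exists (fun=> phi); split.
rewrite /H1 (ball_test_grad bt); split.
- exact: cut (bt_smooth bt) (bt_out bt).
- exact: cut k1 p10.
- exact: cut k2 p20.
move=> v [kv _ _]; have [cv [v1 [v2 [kv1 kv2 dv]]]] := kv 1%N.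
have gv x : (grad v x).1 = v1 x /\ (grad v x).2 = v2 x.
  by have [[_ ? ] [_ ?]] := dv x I.
have [] := @rint_by_parts Omega c s v v1 v2 phi p1 p2 oO s0 sO.
- by move=> x _; exact: (CkT_continuous (kv 0%N)).
- by move=> x _; exact: ((within_closureT _).1 kv1.1).
- by move=> x _; exact: ((within_closureT _).1 kv2.1).
- by move=> x _; have [] := dv x I.
- by move=> x _; have [] := dv x I.
- exact: (CkT_continuous (bt_smooth bt 0%N)).
- exact: (CkT_continuous (k1 0%N)).
- exact: (CkT_continuous (k2 0%N)).
- exact: bt_d1 bt.
- exact: bt_d2 bt.
- exact: bt_out bt.
have E h1 h2 g : (forall x, g x = h1 x * h2 x) ->
    \int[leb2]_(x in Omega) g x = rint (ext Omega h1 h2).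
  by move=> /funext ->; rewrite Rintegral_mkcond.
move=> E1 E2; split.
  have F : \int[leb2]_(x in Omega) (phi x * (grad v x).1) = rint (ext Omega v1 phi).
    by apply: E => x; rewrite (gv x).1 mulrC.
  have F' : \int[leb2]_(x in Omega) ((p1 x, p2 x).1 * v x) = rint (ext Omega v p1).
    by apply: E => x; rewrite mulrC.
  by rewrite F F' E1 opprK.
have F : \int[leb2]_(x in Omega) (phi x * (grad v x).2) = rint (ext Omega v2 phi).
  by apply: E => x; rewrite (gv x).2 mulrC.
have F' : \int[leb2]_(x in Omega) ((p1 x, p2 x).2 * v x) = rint (ext Omega v p2).
  by apply: E => x; rewrite mulrC.
by rewrite F F' E2 opprK.
Qed.

Lemma L2_mul_integrable Omega (h phi : R * R -> R) : open Omega ->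
  L2 Omega h -> compact_supp phi ->
  (leb2 : {measure set _ -> \bar R}).-integrable Omega (EFin \o (fun x => h x * phi x)).
Proof.
move=> oO Lh cp; have mO := open_measurable2 oO.
have /Lfun1_integrable := Lfun2_mul_Lfun1 Lh (compact_supp_Lfun2 cp) => I1.
rewrite -(setTI Omega); apply/(@integrable_restrict _ _ _ (lebesgue_measure \x lebesgue_measure)%E
  _ mO setT measurableT).
apply: eq_integrable I1 => // x _; rewrite /= /patch; case: ifP => // _.
by rewrite /= mul0r.
Qed.

Lemma Rintegral_ext_le Omega c s h phi (N : R) : 0 <= s -> 0 <= N ->
  cball2 c s `<=` Omega -> continuous phi ->
  (forall x, ~ cball2 c s x -> phi x = 0) ->
  (forall x, cball2 c s x -> `|h x| <= N) ->
  `|\int[leb2]_(x in Omega) (h x * phi x)| <= N * rint (fun x => `|phi x|).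
Proof.
move=> s0 N0 sO cp p0 hN.
have kp := compact_supp_norm (test_compact_supp s0 cp p0).
rewrite Rintegral_mkcond -rintZ//; apply: norm_Rintegral_le => [x|].
  have [xs|xs] := pselect (cball2 c s x).
    by rewrite -/(ext Omega h phi x) extE; [rewrite normrM ler_wpM2r// hN|exact: sO].
  by rewrite -/(ext Omega h phi x) (ext_outside _ sO)// p0// !normr0 mulr0.
have /integrableP[_] := compact_supp_integrable (compact_suppZ N kp).
apply: le_lt_trans; apply: ge0_le_integral_nomeas => x.
  by rewrite lee_fin mulr_ge0.
by rewrite lee_fin ler_norm.
Qed.

(** Testing the definition of the weak gradient with [p1] and [p2] turns the integral of [du]
    against the gradient of [phi] into that of [u] against the Laplacian of [phi]. The equation
    tested with [phi] then leaves the two lower-order terms. *)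
Lemma weak_laplacian_bound Omega mu beta q lambda f eps u du c s phi p1 p2 p11 p12 p21 p22 N1 N2 :
  open Omega -> 0 <= s -> cball2 c s `<=` Omega ->
  weak_solution Omega mu beta q lambda f eps u du ->
  (forall x, Omega x -> {for x, continuous u}) ->
  ball_test c s phi p1 p2 -> ball_test c s p1 p11 p12 -> ball_test c s p2 p21 p22 ->
  0 <= N1 -> 0 <= N2 ->
  (forall x, cball2 c s x -> `|l_eps beta q eps (u x)| <= N1) ->
  (forall x, cball2 c s x -> `|choquard Omega mu f u x * f (u x)| <= N2) ->
  `|rint (ext Omega u (fun x => p11 x + p22 x))| <= (N1 + `|lambda| * N2) * rint (fun x => `|phi x|).
Proof.
move=> oO s0 sO [[[Lu Lu1 Lu2 wu] _] _ weq] cu bt bt1 bt2 N10 N20 hN1 hN2.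
have [k1 k2] := CkT_partials (bt_smooth bt) (bt_d1 bt) (bt_d2 bt).
have [k11 k12] := CkT_partials (bt_smooth bt1) (bt_d1 bt1) (bt_d2 bt1).
have [k21 k22] := CkT_partials (bt_smooth bt2) (bt_d1 bt2) (bt_d2 bt2).
have {weq} := weq _ _ (ball_test_H10 oO s0 sO bt).
have tf c' s' h h1 h2 (bth : ball_test c s h h1 h2) : test_function Omega h.
  by apply: (test_function_cball2 s0 sO); [exact: bt_smooth bth|exact: bt_out bth].
have [w1 _] := wu _ (tf c s _ _ _ bt1); have [_ w2] := wu _ (tf c s _ _ _ bt2).
have mO := open_measurable2 oO.
have cp0 c' h (kh : forall k, Ck_closure k setT h) (h0 : forall x, ~ cball2 c s x -> h x = 0) :
    compact_supp h.
  by apply: (test_compact_supp s0 _ h0); exact: (CkT_continuous (kh 0%N)).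
have kp1 := cp0 c _ k1 (bt_out bt1); have kp2 := cp0 c _ k2 (bt_out bt2).
have o11 x : ~ cball2 c s x -> p11 x = 0.
  by move=> xs; exact: (derive_outside xs (bt_out bt1) (bt_d1 bt1 x)).
have o22 x : ~ cball2 c s x -> p22 x = 0.
  by move=> xs; exact: (derive_outside xs (bt_out bt2) (bt_d2 bt2 x)).
have ku11 := ext_compact_supp oO s0 sO cu (CkT_continuous (k11 0%N)) o11.
have ku22 := ext_compact_supp oO s0 sO cu (CkT_continuous (k22 0%N)) o22.
have -> : rint (ext Omega u (fun x => p11 x + p22 x)) =
    rint (ext Omega u p11) + rint (ext Omega u p22).
  rewrite -rintD//; congr rint; apply/funext => x.
  by rewrite /ext /patch; case: ifP => // _; [rewrite mulrDr|rewrite addr0].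
have e11 : rint (ext Omega u p11) = - \int[leb2]_(x in Omega) ((du x).1 * p1 x).
  rewrite -w1 [in RHS]Rintegral_mkcond; congr rint; apply/funext => x.
  by rewrite (ball_test_grad bt1).
have e22 : rint (ext Omega u p22) = - \int[leb2]_(x in Omega) ((du x).2 * p2 x).
  rewrite -w2 [in RHS]Rintegral_mkcond; congr rint; apply/funext => x.
  by rewrite (ball_test_grad bt2).
rewrite e11 e22 (ball_test_grad bt) /dot /=.
rewrite (RintegralD mO (L2_mul_integrable oO Lu1 kp1) (L2_mul_integrable oO Lu2 kp2)).
set A := (\int[leb2]_(x in Omega) ((du x).1 * p1 x)).
set B := (\int[leb2]_(x in Omega) ((du x).2 * p2 x)).
set C := (\int[leb2]_(x in Omega) (l_eps beta q eps (u x) * phi x)).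
set D := (\int[leb2]_(x in Omega) (choquard Omega mu f u x * f (u x) * phi x)).
move=> weq.
have cp := CkT_continuous (bt_smooth bt 0%N).
have bC : `|C| <= N1 * rint (fun x => `|phi x|).
  exact: Rintegral_ext_le s0 N10 sO cp (bt_out bt) hN1.
have bD : `|lambda * D| <= `|lambda| * N2 * rint (fun x => `|phi x|).
  rewrite normrM -mulrA ler_wpM2l//.
  exact: Rintegral_ext_le s0 N20 sO cp (bt_out bt) hN2.
move: weq bC bD; clearbody A B C D => weq bC bD.
rewrite mulrDl; have -> : - A - B = C - lambda * D by rewrite -weq; ring.
by rewrite (le_trans (ler_normB _ _))// lerD.
Qed.

End WeakForm.

(** * The radial potential of the difference of two kernels *)

Section RadialProfile.
Context {R : realType}.
Implicit Types (f g q Q : R -> R) (a b t : R) (k : nat).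

Lemma is_derive_scale f (d : R -> R) (a t : R) : (forall t, is_derive t 1 f (d t)) ->
  is_derive t 1 (fun t => f (t * a)) (d (t * a) * a).
Proof.
move=> fd; have h : is_derive t 1 (fun t => t * a) a.
  have h := is_deriveM (is_derive_id t (1 : R)) (is_derive_cst a t (1 : R)).
  by apply: (is_derive_eq h); rewrite scaler0 add0r [LHS]mulr1.
exact: (@is_derive1_comp _ f (fun t => t * a) t _ _ (fd _) h).
Qed.

Lemma Ck1_scale k f (a : R) : Ck1 k f -> Ck1 k (fun t => f (t * a)).
Proof.
move=> kf; apply: (@Ck1_ext _ k (fun t => f (a * t + 0))); last exact: Ck1_affine.
by move=> t; rewrite addr0 mulrC.
Qed.

Lemma Ck1_cutoff2 k : Ck1 k (fun t : R => cutoff t ^+ 2).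
Proof.
apply: (@Ck1_ext _ k (cutoff \* cutoff)); first by move=> t; rewrite expr2.
by apply: Ck1M; exact: Ck1_cutoff.
Qed.

Lemma derive_ge0_ndecr f (d : R -> R) : (forall t, is_derive t 1 f (d t)) ->
  (forall t, 0 <= d t) -> forall a b, a <= b -> f a <= f b.
Proof.
move=> fd d0 a b ab.
have cf : {within `[a, b], continuous f}.
  by apply: continuous_subspaceT => t; exact: is_derive_continuous1 (fd t).
have [c _ h] := @MVT_segment _ f d a b ab (fun t _ => fd t) cf.
by rewrite -subr_ge0 h mulr_ge0// subr_ge0.
Qed.

Lemma derive0_cst_from f (d : R -> R) (a : R) : (forall t, is_derive t 1 f (d t)) ->
  (forall t, a <= t -> d t = 0) -> forall t, a <= t -> f t = f a.
Proof.
move=> fd d0 t at_.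
have cf : {within `[a, t], continuous f}.
  by apply: continuous_subspaceT => s; exact: is_derive_continuous1 (fd s).
have [c] := @MVT_segment _ f d a t at_ (fun t _ => fd t) cf.
rewrite in_itv/= => /andP[ac _] h; apply/eqP; rewrite -subr_eq0 h d0//.
by rewrite mul0r.
Qed.

(** In the variable [t = |x - c|^2] the Laplacian of [Q(t)] is [4 (t Q')']. With
    [th' = cutoff ^+ 2], the equation integrates to [t * q t = th (t / b ^+ 2) - th (t / a ^+ 2)].
    As [th] is nondecreasing and constant from 1 on, [q] is nonpositive and vanishes beyond
    [b ^+ 2], so its antiderivative vanishing there is nonnegative. *)
Lemma radial_profile a b : 0 < a -> a < b -> exists Q q q1 q2 : R -> R,
  [/\ forall k, Ck1 k Q,
      [/\ forall t, is_derive t 1 Q (q t), forall t, is_derive t 1 q (q1 t) &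
          forall t, is_derive t 1 q1 (q2 t)],
      forall t, 0 <= Q t /\ (b ^+ 2 <= t -> Q t = 0),
      forall t, q t <= 0 /\ (t < a ^+ 2 / 4 -> q t = 0) &
      forall t, q t + t * q1 t = cutoff (t / b ^+ 2) ^+ 2 / b ^+ 2
                                 - cutoff (t / a ^+ 2) ^+ 2 / a ^+ 2].
Proof.
move=> a0 ab; have b0 := lt_trans a0 ab.
have a20 : 0 < a ^+ 2 by rewrite exprn_gt0.
have b20 : 0 < b ^+ 2 by rewrite exprn_gt0.
have ab2 : a ^+ 2 < b ^+ 2 by rewrite ltrXn2r ?nnegrE// ltW.
have cb : continuous (fun t : R => cutoff t ^+ 2) by exact: (Ck1_continuous (Ck1_cutoff2 0)).
have [th [dth th0]] : exists G : R -> R, (forall t, is_derive t 1 G (cutoff t ^+ 2)) /\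
    forall t, t < 1/4 -> G t = 0.
  by apply: antiderivative cb _ => t t4; rewrite cutoff0l ?expr0n// ltW.
have thk k : Ck1 k th by case: k => [|k] /=; [move=> x; exact: is_derive_continuous1 (dth x)|
  exists (fun t => cutoff t ^+ 2); split=> //; exact: Ck1_cutoff2].
have th_nd : forall s t, s <= t -> th s <= th t.
  by apply: derive_ge0_ndecr dth _ => t; exact: sqr_ge0.
have th1 : forall t, 1 <= t -> th t = th 1.
  by apply: derive0_cst_from dth _ => t t1; rewrite cutoff0r ?expr0n.
pose n t := th (t / b ^+ 2) - th (t / a ^+ 2).
have nk k : Ck1 k n.
  apply: (@Ck1_ext _ k ((fun t => th (t / b ^+ 2)) \+ (fun t => -1 * th (t / a ^+ 2)))).
    by move=> t; rewrite /n /= mulN1r.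
  by apply: Ck1D; [exact: Ck1_scale|apply: Ck1Zl; exact: Ck1_scale].
have n0 t : t < a ^+ 2 / 4 -> n t = 0.
  move=> ht; rewrite /n !th0 ?subrr//.
    by rewrite ltr_pdivrMr// mul1r; lra.
  by rewrite ltr_pdivrMr// mul1r; move: ab2 ht; set A := a ^+ 2; set B := b ^+ 2; lra.
have a24 : 0 < a ^+ 2 / 4 by rewrite divr_gt0.
pose q t := n t / t.
have qk k : Ck1 k q by exact: Ck1_div_id a24 n0 (nk k).
have q0 t : t < a ^+ 2 / 4 -> q t = 0 by move=> /n0; rewrite /q => ->; rewrite mul0r.
have [q1 [q1k dq]] := qk 2%N; have [q2 [_ dq1]] := q1k.
have [Q0 [dQ0 _]] := antiderivative (Ck1_continuous (qk 0%N)) q0.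
have qle t : q t <= 0.
  have [/q0 -> //|ht] := ltP t (a ^+ 2 / 4).
  rewrite /q pmulr_lle0 ?invr_gt0 ?(lt_le_trans a24)// subr_le0 th_nd//.
  rewrite ler_wpM2l ?(ltW (lt_le_trans a24 ht))// lef_pV2 ?posrE// ltW//.
have qb t : b ^+ 2 <= t -> q t = 0.
  move=> bt; rewrite /q /n (th1 (t / b ^+ 2)) ?(th1 (t / a ^+ 2)) ?subrr ?mul0r//.
    by rewrite ler_pdivlMr// mul1r (le_trans (ltW ab2)).
  by rewrite ler_pdivlMr// mul1r.
pose Q t := Q0 t - Q0 (b ^+ 2).
have dQ t : is_derive t 1 Q (q t).
  apply: (is_derive_eq (is_deriveB (dQ0 t) (is_derive_cst (Q0 (b ^+ 2)) t (1:R)))).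
  by rewrite subr0.
have Qb t : b ^+ 2 <= t -> Q t = 0.
  by move=> bt; rewrite /Q (derive0_cst_from dQ0 qb bt) subrr.
exists Q, q, q1, q2; split=> //.
- by case=> [|k] /=; [move=> x; exact: is_derive_continuous1 (dQ x)|exists q; split=> //].
- move=> t; split; last exact: Qb.
  have [bt|tb] := leP (b ^+ 2) t; first by rewrite Qb.
  rewrite -(Qb (b ^+ 2) (lexx _)) -lerN2.
  have dN (s : R) : is_derive s 1 (fun t => - Q t) (- q s) by exact: (is_deriveN (dQ s)).
  by apply: (derive_ge0_ndecr dN) (ltW tb) => s; rewrite oppr_ge0.
- by move=> t; split; [exact: qle|exact: q0].
move=> t.
have tq : (fun t => t * q t) = n.
  apply/funext => s; rewrite /q; have [->|s0] := eqVneq s 0; last by rewrite mulrCA divff// mulr1.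
  by rewrite mul0r n0.
have d1 : is_derive t 1 (fun t => t * q t) (t *: q1 t + q t *: 1).
  by have := is_deriveM (is_derive_id t (1:R)) (dq t).
have d2 : is_derive t 1 n (cutoff (t / b ^+ 2) ^+ 2 / b ^+ 2 - cutoff (t / a ^+ 2) ^+ 2 / a ^+ 2).
  by apply: is_deriveB; apply: is_derive_scale.
rewrite tq in d1; have [_ <-] := d2; have [_ ->] := d1.
by rewrite [q t *: 1]mulr1 addrC.
Qed.

End RadialProfile.

(** * Annular kernels, their potentials, and integral bounds for these *)

Section Kernel.
Context {R : realType}.
Implicit Types (c x : R * R) (a b s : R) (Omega : set (R * R)) (u phi : R * R -> R).

(** In the plane the factor [1 / s ^+ 2] makes the integral independent of [s]. The integral is not
    normalised to 1; it is called [mass] below. *)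
Definition kern c s x : R := cutoff (sqdist c x / s ^+ 2) ^+ 2 / s ^+ 2.

Lemma kern_ge0 c s x : 0 <= kern c s x.
Proof. by rewrite /kern divr_ge0// sqr_ge0. Qed.

Lemma kern_out c s x : 0 < s -> ~ cball2 c s x -> kern c s x = 0.
Proof.
move=> s0 /negP; rewrite -ltNge => h; rewrite /kern cutoff0r ?expr0n ?mul0r//.
by rewrite ler_pdivlMr ?exprn_gt0// mul1r ltW.
Qed.

Definition kern_profile s (t : R) : R := cutoff (t / s ^+ 2) ^+ 2 / s ^+ 2.

Lemma Ck1_kern_profile k s : Ck1 k (kern_profile s).
Proof.
apply: (@Ck1_ext _ k (fun t => (s ^+ 2)^-1 * (cutoff (t * (s ^+ 2)^-1) ^+ 2))).
  by move=> t; rewrite mulrC.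
by apply: Ck1Zl; apply: (@Ck1_scale _ k (fun t => cutoff t ^+ 2)); exact: Ck1_cutoff2.
Qed.

Lemma kern_smooth c s k : Ck_closure k setT (kern c s).
Proof. exact: (CkT_radial c (Ck1_kern_profile k s)). Qed.

Lemma kern_continuous c s : continuous (kern c s).
Proof. exact: (CkT_continuous (kern_smooth c s 0)). Qed.

Lemma kern_compact_supp c s : 0 < s -> compact_supp (kern c s).
Proof.
move=> s0; apply: (@test_compact_supp _ c s); [exact: ltW|exact: kern_continuous|].
by move=> x; exact: kern_out.
Qed.

Lemma is_derive_coord c x :
  [/\ is_derive x ((1, 0) : R * R) (fun x => 2 * (x.1 - c.1)) 2,
      is_derive x ((0, 1) : R * R) (fun x => 2 * (x.1 - c.1)) 0,
      is_derive x ((1, 0) : R * R) (fun x => 2 * (x.2 - c.2)) 0 &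
      is_derive x ((0, 1) : R * R) (fun x => 2 * (x.2 - c.2)) 2].
Proof.
have h (t d : R) : is_derive t 1 (fun s : R => 2 * (s - d)) 2.
  have h1 := is_deriveM (is_derive_cst (2 : R) t (1 : R)) (is_derive_sub_cst d t).
  by apply: (is_derive_eq h1); rewrite scaler0 addr0 [LHS]mulr1.
split.
- by apply/is_derive_fst; exact: h.
- by apply/is_derive_snd => /=; exact: is_derive_cst.
- by apply/is_derive_fst => /=; exact: is_derive_cst.
- by apply/is_derive_snd; exact: h.
Qed.

Lemma ball_testP c s phi p1 p2 p11 p12 : ball_test c s phi p1 p2 ->
  (forall x, is_derive x ((1, 0) : R * R) p1 (p11 x)) ->
  (forall x, is_derive x ((0, 1) : R * R) p1 (p12 x)) -> ball_test c s p1 p11 p12.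
Proof.
move=> bt d1 d2; have [k1 _] := CkT_partials (bt_smooth bt) (bt_d1 bt) (bt_d2 bt).
by split=> // x xs; exact: (derive_outside xs (bt_out bt) (bt_d1 bt x)).
Qed.

Lemma ball_testP2 c s phi p1 p2 p21 p22 : ball_test c s phi p1 p2 ->
  (forall x, is_derive x ((1, 0) : R * R) p2 (p21 x)) ->
  (forall x, is_derive x ((0, 1) : R * R) p2 (p22 x)) -> ball_test c s p2 p21 p22.
Proof.
move=> bt d1 d2; have [_ k1] := CkT_partials (bt_smooth bt) (bt_d1 bt) (bt_d2 bt).
by split=> // x xs; exact: (derive_outside xs (bt_out bt) (bt_d2 bt x)).
Qed.

Lemma derM (u v : R * R -> R) (x z : R * R) (du dv : R) :
  is_derive x z u du -> is_derive x z v dv ->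
  is_derive x z (fun x => u x * v x) (u x * dv + v x * du).
Proof. by move=> hu hv; exact: is_deriveM. Qed.

Lemma derD (u v : R * R -> R) (x z : R * R) (du dv : R) :
  is_derive x z u du -> is_derive x z v dv ->
  is_derive x z (fun x => u x + v x) (du + dv).
Proof. by move=> hu hv; exact: is_deriveD. Qed.

(* A potential whose Laplacian is the difference of two kernels; the third
   derivatives are named because its first derivatives serve as test functions. *)
Lemma kernel_potential c a b : 0 < a -> a < b ->
  exists phi p1 p2 p11 p12 p21 p22 p111 p112 p121 p122 p211 p212 p221 p222 : R * R -> R,
  exists q : R -> R,
  [/\ [/\ ball_test c b phi p1 p2, ball_test c b p1 p11 p12 & ball_test c b p2 p21 p22],
      [/\ ball_test c b p11 p111 p112, ball_test c b p12 p121 p122,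
          ball_test c b p21 p211 p212 & ball_test c b p22 p221 p222],
      [/\ forall x, p11 x + p22 x = 4 * (kern c b x - kern c a x),
          forall x, p111 x + p122 x = p111 x + p221 x &
          forall x, p211 x + p222 x = p112 x + p222 x],
      forall x, 0 <= phi x &
      [/\ forall x, p1 x = q (sqdist c x) * (2 * (x.1 - c.1)),
          forall x, p2 x = q (sqdist c x) * (2 * (x.2 - c.2)) &
          forall t, q t <= 0 /\ (t < a ^+ 2 / 4 -> q t = 0)]].
Proof.
move=> a0 ab.
have [Q [q [q1 [q2 [Qk [dQ dq dq1] Q0 q0 E]]]]] := radial_profile a0 ab.
(* These are the partial derivatives of [sqdist c], so differentiating [r f] in the i-th direction
   yields [r f'] times [zi]. Each [zi] has derivative 2 in its own direction, whence the
   coefficients 2 and 6 of the third derivatives. *)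
pose z1 x : R := 2 * (x.1 - c.1); pose z2 x : R := 2 * (x.2 - c.2).
pose r f x : R := f (sqdist c x) : R.
exists (r Q), (r q \* z1), (r q \* z2).
exists (fun x => r q x * 2 + z1 x * (r q1 x * z1 x)), (fun x => z1 x * (r q1 x * z2 x)).
exists (fun x => z2 x * (r q1 x * z1 x)), (fun x => r q x * 2 + z2 x * (r q1 x * z2 x)).
exists (fun x => 6 * (r q1 x * z1 x) + z1 x * z1 x * (r q2 x * z1 x)).
exists (fun x => 2 * (r q1 x * z2 x) + z1 x * z1 x * (r q2 x * z2 x)).
exists (fun x => 2 * (r q1 x * z2 x) + z1 x * z1 x * (r q2 x * z2 x)).
exists (fun x => 2 * (r q1 x * z1 x) + z2 x * z2 x * (r q2 x * z1 x)).
exists (fun x => 2 * (r q1 x * z2 x) + z1 x * z1 x * (r q2 x * z2 x)).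
exists (fun x => 2 * (r q1 x * z1 x) + z2 x * z2 x * (r q2 x * z1 x)).
exists (fun x => 2 * (r q1 x * z1 x) + z2 x * z2 x * (r q2 x * z1 x)).
exists (fun x => 6 * (r q1 x * z2 x) + z2 x * z2 x * (r q2 x * z2 x)).
exists q.
have b0 := lt_trans a0 ab.
have dz x := is_derive_coord c x.
have dr f d x : (forall t : R, is_derive t 1 f (d t)) ->
    is_derive x ((1, 0) : R * R) (r f) (r d x * z1 x) /\
    is_derive x ((0, 1) : R * R) (r f) (r d x * z2 x).
  by move=> fd; exact: (is_derive_radial c x fd).
have b1 : ball_test c b (r Q) (r q \* z1) (r q \* z2).
  split.
  - by move=> k; exact: CkT_radial.
  - by move=> x; have [] := dr Q q x dQ.
  - by move=> x; have [] := dr Q q x dQ.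
  move=> x /negP; rewrite -ltNge => h; exact: (Q0 _).2 (ltW h).
have b2 : ball_test c b (r q \* z1) (fun x => r q x * 2 + z1 x * (r q1 x * z1 x)) (fun x => z1 x * (r q1 x * z2 x)).
  apply: (ball_testP b1) => x; have [? ?] := dr q q1 x dq; have [? ? ? ?] := dz x.
    exact: is_deriveM.
  have h : is_derive x ((0, 1) : R * R) (r q \* z1) (r q x *: 0 + z1 x *: (r q1 x * z2 x)).
    exact: is_deriveM.
  by apply: (is_derive_eq h); rewrite scaler0 add0r.
have b3 : ball_test c b (r q \* z2) (fun x => z2 x * (r q1 x * z1 x)) (fun x => r q x * 2 + z2 x * (r q1 x * z2 x)).
  apply: (ball_testP2 b1) => x; have [? ?] := dr q q1 x dq; have [? ? ? ?] := dz x.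
    have h : is_derive x ((1, 0) : R * R) (r q \* z2) (r q x *: 0 + z2 x *: (r q1 x * z1 x)).
      exact: is_deriveM.
    by apply: (is_derive_eq h); rewrite scaler0 add0r.
  exact: is_deriveM.
have H11 x : is_derive x ((1, 0) : R * R) (fun x => r q x * 2 + z1 x * (r q1 x * z1 x))
    (6 * (r q1 x * z1 x) + z1 x * z1 x * (r q2 x * z1 x)) /\
  is_derive x ((0, 1) : R * R) (fun x => r q x * 2 + z1 x * (r q1 x * z1 x))
    (2 * (r q1 x * z2 x) + z1 x * z1 x * (r q2 x * z2 x)).
  have [a1 a2] := dr q q1 x dq; have [a3 a4] := dr q1 q2 x dq1; have [a5 a6 a7 a8] := dz x.
  split.
    have h := derD (derM a1 (is_derive_cst (2:R) x ((1,0):R*R))) (derM a5 (derM a3 a5)).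
    by apply: (is_derive_eq h); rewrite /z1; ring.
  have h := derD (derM a2 (is_derive_cst (2:R) x ((0,1):R*R))) (derM a6 (derM a4 a6)).
  by apply: (is_derive_eq h); rewrite /z1 /z2; ring.
have H22 x : is_derive x ((1, 0) : R * R) (fun x => r q x * 2 + z2 x * (r q1 x * z2 x))
    (2 * (r q1 x * z1 x) + z2 x * z2 x * (r q2 x * z1 x)) /\
  is_derive x ((0, 1) : R * R) (fun x => r q x * 2 + z2 x * (r q1 x * z2 x))
    (6 * (r q1 x * z2 x) + z2 x * z2 x * (r q2 x * z2 x)).
  have [a1 a2] := dr q q1 x dq; have [a3 a4] := dr q1 q2 x dq1; have [a5 a6 a7 a8] := dz x.
  split.
    have h := derD (derM a1 (is_derive_cst (2:R) x ((1,0):R*R))) (derM a7 (derM a3 a7)).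
    by apply: (is_derive_eq h); rewrite /z1 /z2; ring.
  have h := derD (derM a2 (is_derive_cst (2:R) x ((0,1):R*R))) (derM a8 (derM a4 a8)).
  by apply: (is_derive_eq h); rewrite /z1 /z2; ring.
have H12 x : is_derive x ((1, 0) : R * R) (fun x => z1 x * (r q1 x * z2 x))
    (2 * (r q1 x * z2 x) + z1 x * z1 x * (r q2 x * z2 x)) /\
  is_derive x ((0, 1) : R * R) (fun x => z1 x * (r q1 x * z2 x))
    (2 * (r q1 x * z1 x) + z2 x * z2 x * (r q2 x * z1 x)).
  have [a1 a2] := dr q q1 x dq; have [a3 a4] := dr q1 q2 x dq1; have [a5 a6 a7 a8] := dz x.
  split.
    have h := derM a5 (derM a3 a7).
    by apply: (is_derive_eq h); rewrite /z1 /z2; ring.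
  have h := derM a6 (derM a4 a8).
  by apply: (is_derive_eq h); rewrite /z1 /z2; ring.
have e21 : (fun x => z2 x * (r q1 x * z1 x)) = (fun x => z1 x * (r q1 x * z2 x)).
  by apply/funext => x; ring.
split.
- by split.
- rewrite e21; rewrite e21 in b3; split.
  + by apply: (ball_testP b2) => x; have [] := H11 x.
  + by apply: (ball_testP2 b2) => x; have [] := H12 x.
  + by apply: (ball_testP b3) => x; have [] := H12 x.
  + by apply: (ball_testP2 b3) => x; have [] := H22 x.
- split=> x //; last first.
  have := E (sqdist c x); rewrite -/(kern c b x) -/(kern c a x) => <-.
  rewrite /r /z1 /z2; set A := q1 _; set B := q _.
  by rewrite [X in B + X * A]/sqdist; ring.
- by move=> x; exact: (Q0 _).1.
- by split.
Qed.


Lemma ext_setT (h phi : R * R -> R) : ext setT h phi = (fun x => h x * phi x).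
Proof. by apply/funext => x; rewrite extE. Qed.

Lemma contM (u v : R * R -> R) : continuous u -> continuous v ->
  continuous (fun x => u x * v x).
Proof. by move=> cu cv x; exact: (continuousM (cu x) (cv x)). Qed.

Lemma contD (u v : R * R -> R) : continuous u -> continuous v ->
  continuous (fun x => u x + v x).
Proof. by move=> cu cv x; exact: (continuousD (cu x) (cv x)). Qed.

Lemma compact_suppB (F G : R * R -> R) : compact_supp F -> compact_supp G ->
  compact_supp (fun x => F x - G x).
Proof.
move=> kF kG; apply: (compact_suppD kF).
rewrite (_ : (fun x => - G x) = (fun x => -1 * G x)); first exact: compact_suppZ.
by apply/funext => x; rewrite mulN1r.
Qed.

Lemma ball_test_continuous c s phi p1 p2 : 0 < s -> ball_test c s phi p1 p2 ->
  [/\ continuous phi, continuous p1 & continuous p2] /\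
  [/\ compact_supp phi, compact_supp p1 & compact_supp p2].
Proof.
move=> s0 bt; have [k1 k2] := CkT_partials (bt_smooth bt) (bt_d1 bt) (bt_d2 bt).
have c0 := CkT_continuous (bt_smooth bt 0%N).
have c1 := CkT_continuous (k1 0%N); have c2 := CkT_continuous (k2 0%N).
split; split=> //.
- exact: test_compact_supp (ltW s0) c0 (bt_out bt).
- apply: (@test_compact_supp _ c s _ (ltW s0) c1) => x xs.
  exact: (derive_outside xs (bt_out bt) (bt_d1 bt x)).
apply: (@test_compact_supp _ c s _ (ltW s0) c2) => x xs.
exact: (derive_outside xs (bt_out bt) (bt_d2 bt x)).
Qed.

Lemma rint_by_parts_ball c s (u g1 g2 phi p1 p2 : R * R -> R) : 0 < s ->
  continuous u -> continuous g1 -> continuous g2 ->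
  (forall x, is_derive x ((1, 0) : R * R) u (g1 x)) ->
  (forall x, is_derive x ((0, 1) : R * R) u (g2 x)) ->
  ball_test c s phi p1 p2 ->
  rint (fun x => u x * p1 x) = - rint (fun x => g1 x * phi x) /\
  rint (fun x => u x * p2 x) = - rint (fun x => g2 x * phi x).
Proof.
move=> s0 cu c1 c2 d1 d2 bt; have [[a1 a2 a3] _] := ball_test_continuous s0 bt.
have := @rint_by_parts _ setT c s u g1 g2 phi p1 p2 openT (ltW s0) (@subsetT _ _)
  (fun x _ => cu x) (fun x _ => c1 x) (fun x _ => c2 x) (fun x _ => d1 x)
  (fun x _ => d2 x) a1 a2 a3 (bt_d1 bt) (bt_d2 bt) (bt_out bt).
by rewrite !ext_setT.
Qed.

Definition weakLap Omega u c s (N : R) := forall phi p1 p2 p11 p12 p21 p22,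
  ball_test c s phi p1 p2 -> ball_test c s p1 p11 p12 -> ball_test c s p2 p21 p22 ->
  `|rint (ext Omega u (fun x => p11 x + p22 x))| <= N * rint (fun x => `|phi x|).

Lemma rint_ext_eq (F G : R * R -> R) : F =1 G -> rint F = rint G.
Proof. by move=> /funext ->. Qed.

Definition mass c : R := rint (kern c 1).

(** The integral bounds must not depend on [a], which will tend to 0. They come from Green's
    identity for [phi] with explicit partners: the squared distance, of Laplacian 4, for [phi], and
    a smoothed distance for its gradient. *)
Lemma kernel_estimates c a b : 0 < a -> a < b ->
  exists phi p1 p2 p11 p12 p21 p22 p111 p112 p121 p122 p211 p212 p221 p222 : R * R -> R,
  [/\ [/\ ball_test c b phi p1 p2, ball_test c b p1 p11 p12 & ball_test c b p2 p21 p22],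
      [/\ ball_test c b p11 p111 p112, ball_test c b p12 p121 p122,
          ball_test c b p21 p211 p212 & ball_test c b p22 p221 p222],
      [/\ forall x, p11 x + p22 x = 4 * (kern c b x - kern c a x),
          forall x, p111 x + p122 x = p111 x + p221 x &
          forall x, p211 x + p222 x = p112 x + p222 x],
      rint (kern c b) = rint (kern c a) &
      [/\ 4 * rint (fun x => `|phi x|) <= 4 * (b ^+ 2 * rint (kern c b)),
          rint (fun x => `|p1 x|) <= 10 * b * rint (kern c b) &
          rint (fun x => `|p2 x|) <= 10 * b * rint (kern c b)]].
Proof.
move=> a0 ab; have b0 := lt_trans a0 ab.
have [phi [p1 [p2 [p11 [p12 [p21 [p22 [p111 [p112 [p121 [p122 [p211 [p212 [p221 [p222 [q
  [H1 H2 H3 phi0 [q1 q2 q0]]]]]]]]]]]]]]]]]] := kernel_potential c a0 ab.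
exists phi, p1, p2, p11, p12, p21, p22, p111, p112, p121, p122, p211, p212, p221, p222.
have [b1 b2 b3] := H1; have [E _ _] := H3.
have [[cphi cp1 cp2] [kphi kp1 kp2]] := ball_test_continuous b0 b1.
have [[_ cp11 _] [_ kp11 _]] := ball_test_continuous b0 b2.
have [[_ _ cp22] [_ _ kp22]] := ball_test_continuous b0 b3.
have kb := kern_compact_supp c b0; have ka := kern_compact_supp c a0.
have kE : (fun x => p11 x + p22 x) = (fun x => 4 * (kern c b x - kern c a x)).
  exact/funext.
(* The Laplacian of a compactly supported function has integral zero. *)
have mE : rint (kern c b) = rint (kern c a).
  have : rint (fun x => p11 x + p22 x) = 0.
    have z1 := rint_derive_fst kp1 kp11 (bt_d1 b2).
    have z2 := rint_derive_snd kp2 kp22 (bt_d2 b3).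
    by rewrite rintD// z1 z2 addr0.
  rewrite kE rintZ ?rintB//.
    by move=> /eqP; rewrite mulf_eq0 pnatr_eq0/= subr_eq0 => /eqP.
  exact: compact_suppB.
have kab : compact_supp (fun x => 4 * (kern c b x - kern c a x)).
  exact/compact_suppZ/compact_suppB.
have green (u g1 g2 : R * R -> R) : continuous u -> continuous g1 -> continuous g2 ->
    (forall x, is_derive x ((1, 0) : R * R) u (g1 x)) ->
    (forall x, is_derive x ((0, 1) : R * R) u (g2 x)) ->
    rint (fun x => u x * (4 * (kern c b x - kern c a x))) =
    - rint (fun x => g1 x * p1 x + g2 x * p2 x).
  move=> cu c1 c2 d1 d2.
  have [E1 _] := rint_by_parts_ball b0 cu c1 c2 d1 d2 b2.
  have [_ E2] := rint_by_parts_ball b0 cu c1 c2 d1 d2 b3.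
  rewrite (@rint_ext_eq _ (fun x => u x * p11 x + u x * p22 x)); last first.
    by move=> x; rewrite -E mulrDr.
  rewrite !rintD; try exact: compact_suppMl.
  by rewrite E1 E2 opprD.
have le_kb (u : R * R -> R) (M : R) : continuous u -> (forall x, 0 <= u x) ->
    (forall x, cball2 c b x -> u x <= M) ->
    rint (fun x => u x * (4 * (kern c b x - kern c a x))) <= 4 * (M * rint (kern c b)).
  move=> cu u0 uM; rewrite -!rintZ//; last exact: compact_suppZ.
  apply: rint_le => [||x]; [exact: compact_suppMl|by do 2 apply: compact_suppZ|].
  have [xb|xb] := pselect (cball2 c b x).
    rewrite mulrCA ler_pM2l// mulrBr lerBlDr (@le_trans _ _ (M * kern c b x))//.
      by rewrite ler_wpM2r ?kern_ge0// uM.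
    by rewrite lerDl mulr_ge0// kern_ge0.
  rewrite (kern_out b0 xb) !mulr0 sub0r mulrN mulrN oppr_le0.
  by apply: mulr_ge0 => //; apply: mulr_ge0 => //; exact: kern_ge0.
have csq := @sqdist_continuous R c.
have dsq x : is_derive x ((1, 0) : R * R) (sqdist c) (2 * (x.1 - c.1)) /\
             is_derive x ((0, 1) : R * R) (sqdist c) (2 * (x.2 - c.2)).
  have [h1 h2] := is_derive_radial_at (is_derive_id (sqdist c x) (1 : R)).
  by split; [apply: (is_derive_eq h1)|apply: (is_derive_eq h2)]; rewrite mul1r.
have cz1 : continuous (fun x : R * R => 2 * (x.1 - c.1)).
  by apply: contM; [exact: cst_continuous|exact: (CkT_continuous (CkT_fst 0 c.1))].
have cz2 : continuous (fun x : R * R => 2 * (x.2 - c.2)).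
  by apply: contM; [exact: cst_continuous|exact: (CkT_continuous (CkT_snd 0 c.2))].
have dz x := is_derive_coord c x.
have phiE : rint (fun x => `|phi x|) = rint phi.
  by apply: rint_ext_eq => x; rewrite ger0_norm.
(* [e2] is the threshold of [sqdist] below which [q] vanishes. The smoothed distance [W] is
   therefore comparable to the distance wherever the gradient of [phi] is nonzero, and
   [W <= 5 / 4 * b] on the ball. *)
pose e2 := a ^+ 2 / 4; have e20 : 0 < e2 by rewrite divr_gt0// exprn_gt0.
pose W x : R := Num.sqrt (sqdist c x + e2).
have W2 x : W x ^+ 2 = sqdist c x + e2.
  by rewrite sqr_sqrtr// addr_ge0 ?sqdist_ge0// ltW.
have W0 x : 0 < W x by rewrite sqrtr_gt0 ltr_wpDl// sqdist_ge0.
have cS : continuous (fun x => sqdist c x + e2).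
  by apply: contD => //; exact: cst_continuous.
have cW : continuous W.
  move=> x; apply: (@continuous_comp _ _ _ (fun x => sqdist c x + e2) Num.sqrt).
    exact: cS.
  exact: sqrt_continuous.
pose g1 x := (2 * W x)^-1 * (2 * (x.1 - c.1)).
pose g2 x := (2 * W x)^-1 * (2 * (x.2 - c.2)).
have dW x : is_derive x ((1, 0) : R * R) W (g1 x) /\ is_derive x ((0, 1) : R * R) W (g2 x).
  apply: (@is_derive_radial_at _ (fun t => Num.sqrt (t + e2))).
  have h1 : is_derive (sqdist c x) 1 (fun t : R => t + e2) 1.
    have h := is_deriveD (is_derive_id (sqdist c x) (1 : R)) (is_derive_cst e2 (sqdist c x) (1 : R)).
    by apply: (is_derive_eq h); rewrite addr0.
  have h2 : is_derive (sqdist c x + e2) 1 Num.sqrt (2 * W x)^-1.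
    have S0 : 0 < sqdist c x + e2 by rewrite ltr_wpDl// sqdist_ge0.
    by apply: (is_derive_eq (is_derive1_sqrt S0)); rewrite ?div1r.
  have h := @is_derive1_comp _ Num.sqrt (fun t : R => t + e2) _ _ _ h2 h1.
  by apply: (is_derive_eq h); rewrite mulr1.
have cg (f : R * R -> R) : continuous f -> continuous (fun x => (2 * W x)^-1 * f x).
  move=> cf; apply: contM => // x.
  have nz : 2 * W x != 0 by rewrite mulf_neq0// gt_eqF.
  have c2W : continuous (fun x => 2 * W x) by apply: contM => //; exact: cst_continuous.
  exact: (cvgV nz (c2W x)).
have cg1 : continuous g1 by exact: cg.
have cg2 : continuous g2 by exact: cg.
pose D x := - (g1 x * p1 x + g2 x * p2 x).
have kD : compact_supp D.
  rewrite (_ : D = fun x => -1 * (g1 x * p1 x + g2 x * p2 x)).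
    by apply: compact_suppZ; apply: compact_suppD; exact: compact_suppMl.
  by apply/funext => x; rewrite mulN1r.
have ID : rint D <= 5 * b * rint (kern c b).
  have := le_kb W (5 / 4 * b) cW (fun x => ltW (W0 x)).
  rewrite (green W g1 g2 cW cg1 cg2 (fun x => (dW x).1) (fun x => (dW x).2)).
  rewrite (@rint_ext_eq D (fun x => -1 * (g1 x * p1 x + g2 x * p2 x))); last first.
    by move=> x; rewrite mulN1r.
  rewrite rintZ; last by apply: compact_suppD; exact: compact_suppMl.
  rewrite mulN1r (_ : 4 * (5 / 4 * b * _) = 5 * b * rint (kern c b)); last by field.
  apply=> x; rewrite /cball2/= => xb.
  rewrite -(@ler_pXn2r _ 2%N) ?nnegrE ?(ltW (W0 x))//; last by rewrite mulr_ge0// ltW.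
  rewrite W2 /e2 exprMn; have : a ^+ 2 <= b ^+ 2 by rewrite ler_pXn2r ?nnegrE// ltW.
  move: xb; set A := a ^+ 2; set B := b ^+ 2; set S := sqdist c x => xb AB.
  have : 0 <= B by exact: sqr_ge0.
  by rewrite expr2; lra.
have DE x : D x = - q (sqdist c x) * (2 * sqdist c x / W x).
  rewrite /D /g1 /g2 q1 q2; set A := q _; rewrite /sqdist; field.
  by rewrite gt_eqF.
(* Since [q <= 0], the quantity [D], minus the scalar product of the gradients of [W] and [phi], is
   nonnegative. It dominates each partial derivative of [phi] up to the factor 2, because
   [sqdist >= e2] gives [W ^+ 2 <= 2 * sqdist]. *)
have key (z : R) x : z ^+ 2 <= sqdist c x -> `|q (sqdist c x) * (2 * z)| <= 2 * D x.
  move=> zx; have [qle qz] := q0 (sqdist c x).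
  have [/qz q00|ge] := ltP (sqdist c x) (a ^+ 2 / 4).
    by rewrite DE q00 oppr0 !mul0r mulr0 normr0.
  rewrite DE normrM (ler0_norm qle) mulrCA ler_wpM2l ?oppr_ge0//.
  rewrite normrM ger0_norm// ler_pM2l// ler_pdivlMr//.
  rewrite -(@ler_pXn2r _ 2%N) ?nnegrE ?mulr_ge0 ?sqdist_ge0// ?(ltW (W0 _))//.
  rewrite exprMn real_normK ?num_real// W2.
  have S0 := sqdist_ge0 c x; move: ge zx S0; rewrite -/e2; set S := sqdist c x => ge zx S0.
  have SS := mulr_ge0 S0 S0.
  have zS : z ^+ 2 * (S + e2) <= S * (S + S).
    by apply: ler_pM => //; [exact: sqr_ge0|lra|lra].
  by rewrite exprMn [S ^+ 2]expr2 [2 ^+ 2]expr2; lra.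
have bnd (p : R * R -> R) (z : R * R -> R) : compact_supp p -> (forall x, z x ^+ 2 <= sqdist c x) ->
    (forall x, p x = q (sqdist c x) * (2 * z x)) ->
    rint (fun x => `|p x|) <= 10 * b * rint (kern c b).
  move=> kp hz pE; apply: (@le_trans _ _ (rint (fun x => 2 * D x))).
    apply: rint_le => [||x]; [exact: compact_supp_norm|exact: compact_suppZ|].
    by rewrite pE key.
  by rewrite rintZ//; lra.
split=> //; split.
- have G1 := green (sqdist c) _ _ csq cz1 cz2 (fun x => (dsq x).1) (fun x => (dsq x).2).
  have E1 : rint (fun x => 2 * (x.1 - c.1) * p1 x) = - rint (fun x => 2 * phi x).
    have c0 (k : R) : continuous (cst k : R * R -> R) by exact: cst_continuous.
    by case: (rint_by_parts_ball b0 cz1 (c0 2) (c0 0) _ _ b1) => // x; have [] := dz x.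
  have E2 : rint (fun x => 2 * (x.2 - c.2) * p2 x) = - rint (fun x => 2 * phi x).
    have c0 (k : R) : continuous (cst k : R * R -> R) by exact: cst_continuous.
    by case: (rint_by_parts_ball b0 cz2 (c0 0) (c0 2) _ _ b1) => // x; have [] := dz x.
  have := le_kb (sqdist c) (b ^+ 2) csq (@sqdist_ge0 R c) (fun x h => h).
  rewrite G1 rintD; try exact: compact_suppMl.
  rewrite E1 E2 opprD !opprK -rintD; try exact: compact_suppZ.
  rewrite (@rint_ext_eq _ (fun x => 4 * phi x)); first by rewrite rintZ// phiE.
  by move=> x; rewrite /=; ring.
- by apply: (bnd p1 (fun x => x.1 - c.1)) => // x; rewrite lerDl sqr_ge0.
- by apply: (bnd p2 (fun x => x.2 - c.2)) => // x; rewrite lerDr sqr_ge0.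
Qed.

End Kernel.

(** * Mean value identities, and the lower bound for the variance *)

Section MeanValue.
Context {R : realType}.
Implicit Types (c x : R * R) (a b s : R) (Omega : set (R * R)) (u h phi : R * R -> R).

Lemma rint_kern c s : 0 < s -> rint (kern c s) = mass c.
Proof.
have H a b : 0 < a -> a < b -> rint (kern c b) = rint (kern c a).
  move=> a0 ab.
  by have [? [? [? [? [? [? [? [? [? [? [? [? [? [? [? [_ _ _ ? _]]]]]]]]]]]]]]]] := kernel_estimates c a0 ab.
move=> s0; rewrite /mass; have [s1|s1|->//] := ltgtP s 1.
  by rewrite (H s 1).
by rewrite (H 1 s).
Qed.

Lemma rint_le_box (F : R * R -> R) c b (M : R) : 0 < b ->
  (forall x, `|F x| <= M) -> (forall x, ~ cball2 c b x -> F x = 0) ->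
  rint F <= M * (4 * b ^+ 2).
Proof.
move=> b0 FM F0; have M0 : 0 <= M by apply: le_trans (FM 0).
pose B : set (measurableTypeR R * measurableTypeR R) := `[c.1 - b, c.1 + b] `*` `[c.2 - b, c.2 + b].
have mB : measurable B by apply: measurableX; exact: measurable_itv.
have leb : leb2 B = (4 * b ^+ 2)%:E.
  rewrite /B leb2_itv; [|lra|lra]; congr EFin.
  by rewrite expr2; ring.
have I1 : (\int[leb2]_x ((cst M \_ B) x)%:E = (M * (4 * b ^+ 2))%:E)%E.
  rewrite -[RHS]/(M%:E * (4 * b ^+ 2)%:E)%E -leb -integral_cst//.
  rewrite [RHS]integral_mkcond; apply: eq_integral => x _.
  by rewrite /patch; case: ifP.
rewrite (le_trans (ler_norm _))// /rint.
have h := @norm_Rintegral_le _ _ _ (lebesgue_measure \x lebesgue_measure)%E F (cst M \_ B).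
apply: le_trans (h _ _) _.
- move=> x; rewrite /patch; case: ifPn => [_|]; first exact: FM.
  move=> /negP; rewrite inE => xB; rewrite F0 ?normr0// => /(cball2_coord (ltW b0))[].
  rewrite !ler_norml => /andP[h1 h2] /andP[h3 h4]; apply: xB.
  by split; rewrite /= in_itv/=; apply/andP; split; lra.
- by rewrite I1 ltry.
- by rewrite /Rintegral I1.
Qed.

(** A lower bound uniform in [c] stands in for the translation invariance of the mass. *)
Lemma mass_lower : exists2 m, 0 < m & forall c, m <= mass c.
Proof.
exists (expR (-8) ^+ 2 * (1 / 400)); first by apply: mulr_gt0; [exact: exprn_gt0 (expR_gt0 _)|lra].
move=> c; set M := expR (-8) ^+ 2.
(* On this square of side [1/20] the squared distance to [c] lies between 0.605 and 0.72, within the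
   interval [[1/2, 3/4]] of [cutoff_lower]. *)
pose B : set (measurableTypeR R * measurableTypeR R) :=
  `[c.1 + 11/20, c.1 + 12/20] `*` `[c.2 + 11/20, c.2 + 12/20].
have mB : measurable B by apply: measurableX; exact: measurable_itv.
have leb : leb2 B = (1 / 400)%:E.
  by rewrite /B leb2_itv; [|lra|lra]; congr EFin; field.
have I1 : (\int[leb2]_x ((cst M \_ B) x)%:E = (M * (1 / 400))%:E)%E.
  rewrite -[RHS]/(M%:E * (1 / 400)%:E)%E -leb -integral_cst//.
  rewrite [RHS]integral_mkcond; apply: eq_integral => x _.
  by rewrite /patch; case: ifP.
have -> : M * (1 / 400) = \int[leb2]_x ((cst M \_ B) x) by rewrite /Rintegral I1.
have h := @norm_Rintegral_le _ _ _ (lebesgue_measure \x lebesgue_measure)%E (cst M \_ B) (kern c 1).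
apply: le_trans (ler_norm _) (h _ _).
- move=> x; rewrite /patch; case: ifPn => [|_]; last by rewrite normr0 kern_ge0.
  rewrite inE => -[] /=; rewrite !in_itv/= => /andP[h1 h2] /andP[h3 h4].
  rewrite ger0_norm ?exprn_ge0 ?expR_ge0// /kern expr1n !divr1.
  rewrite ler_pXn2r ?nnegrE ?expR_ge0//; last by have /andP[] := cutoff_bounds (sqdist c x).
  apply: cutoff_lower; rewrite /sqdist !expr2.
  have e1 : 11/20 <= x.1 - c.1 <= 12/20 by apply/andP; split; lra.
  have e2 : 11/20 <= x.2 - c.2 <= 12/20 by apply/andP; split; lra.
  move: e1 e2; set y := x.1 - c.1; set z := x.2 - c.2 => /andP[y1 y2] /andP[z1 z2].
  by apply/andP; split; nra.
have /integrableP[_] := compact_supp_integrable (kern_compact_supp c (ltr01 : 0 < 1 :> R)).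
apply: le_lt_trans; apply: ge0_le_integral_nomeas => x.
  by rewrite lee_fin kern_ge0.
by rewrite lee_fin ler_norm.
Qed.

Lemma mass_ge0 c : 0 <= mass c.
Proof. by apply: rint_ge0 => x; exact: kern_ge0. Qed.

Section OnOmega.
Variables (Omega : set (R * R)) (c : R * R) (b : R).
Hypotheses (oO : open Omega) (b0 : 0 < b) (bO : cball2 c b `<=` Omega).

Lemma cball2_sub a : 0 < a -> a <= b -> cball2 c a `<=` cball2 c b.
Proof.
move=> a0 ab x; rewrite /cball2/= => h; apply: le_trans h _.
by rewrite ler_pXn2r ?nnegrE// ltW.
Qed.

Lemma ext_kern_supp h a : 0 < a -> a <= b -> (forall x, Omega x -> {for x, continuous h}) ->
  compact_supp (ext Omega h (kern c a)).
Proof.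
move=> a0 ab ch; apply: (@ext_compact_supp _ Omega c a h (kern c a) oO (ltW a0) _ ch).
- exact: subset_trans (cball2_sub a0 ab) bO.
- exact: kern_continuous.
- by move=> x; exact: kern_out.
Qed.

Lemma rint_ext_kern_le h1 h2 a : 0 < a -> a <= b ->
  (forall x, Omega x -> {for x, continuous h1}) ->
  (forall x, Omega x -> {for x, continuous h2}) ->
  (forall x, cball2 c a x -> h1 x <= h2 x) ->
  rint (ext Omega h1 (kern c a)) <= rint (ext Omega h2 (kern c a)).
Proof.
move=> a0 ab ch1 ch2 h12; apply: rint_le => [||x]; try exact: ext_kern_supp.
have aO := subset_trans (cball2_sub a0 ab) bO.
have [xa|xa] := pselect (cball2 c a x); last first.
  by rewrite !(ext_outside _ aO)// => y; exact: kern_out.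
by rewrite !extE; [rewrite ler_wpM2r ?kern_ge0// h12|exact: aO|exact: aO].
Qed.

Lemma rint_ext_cst (k : R) a : 0 < a -> a <= b ->
  rint (ext Omega (cst k) (kern c a)) = k * mass c.
Proof.
move=> a0 ab; rewrite -(rint_kern c a0) -rintZ; last exact: kern_compact_supp.
apply: rint_ext_eq => x; rewrite /ext /patch; case: ifPn => // /negP.
by rewrite inE => xO; rewrite (kern_out a0) ?mulr0// => /(cball2_sub a0 ab)/bO.
Qed.

Lemma ext_kern_near h (eta : R) : 0 < eta -> (forall x, Omega x -> {for x, continuous h}) ->
  exists a, [/\ 0 < a, a < b & `|rint (ext Omega h (kern c a)) - h c * mass c| <= eta * mass c].
Proof.
move=> e0 ch.
have Oc : Omega c by apply: bO; rewrite /cball2/= /sqdist !subrr expr0n addr0 sqr_ge0.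
have /cvgrPdist_le/(_ _ e0) n1 := ch c Oc.
have [r /= r0 H] := (nbhs_ballP _ _).1 n1.
pose a := Num.min (b / 2) (r / 2).
have a0 : 0 < a by rewrite lt_min !divr_gt0.
have ab : a < b by rewrite gt_min ltr_pdivrMr// ltr_pMr// ltr1n.
have ar : a < r by rewrite gt_min orbC ltr_pdivrMr// ltr_pMr// ltr1n.
exists a; split=> //.
have hb x : cball2 c a x -> h c - eta <= h x <= h c + eta.
  move=> /(cball2_coord (ltW a0))[h1 h2].
  have : `|h c - h x| <= eta.
    by apply: H; split; rewrite /ball/= distrC; apply: le_lt_trans ar.
  by rewrite ler_norml => /andP[? ?]; apply/andP; split; lra.
have cc (k : R) : forall x, Omega x -> {for x, continuous (cst k : R * R -> R)}.
  by move=> x _; exact: cst_continuous.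
have := rint_ext_kern_le a0 (ltW ab) (cc (h c - eta)) ch (fun x xa => proj1 (andP (hb x xa))).
have := rint_ext_kern_le a0 (ltW ab) ch (cc (h c + eta)) (fun x xa => proj2 (andP (hb x xa))).
rewrite (rint_ext_cst (h c + eta) a0 (ltW ab)) (rint_ext_cst (h c - eta) a0 (ltW ab)).
rewrite mulrBl mulrDl => h1 h2.
by rewrite ler_norml; apply/andP; split; lra.
Qed.

Lemma ext_kernB h a : 0 < a -> a <= b -> (forall x, Omega x -> {for x, continuous h}) ->
  rint (ext Omega h (fun x => 4 * (kern c b x - kern c a x))) =
  4 * (rint (ext Omega h (kern c b)) - rint (ext Omega h (kern c a))).
Proof.
move=> a0 ab ch; rewrite -rintB; try exact: ext_kern_supp.
rewrite -rintZ; last by apply: compact_suppB; exact: ext_kern_supp.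
apply: rint_ext_eq => x; rewrite /ext /patch; case: ifP => _; last by rewrite subrr mulr0.
by rewrite mulrBr !mulrBr; ring.
Qed.

Variables (u g1 g2 : R * R -> R) (N : R).
Hypotheses (cu : forall x, Omega x -> {for x, continuous u})
  (cg1 : forall x, Omega x -> {for x, continuous g1})
  (cg2 : forall x, Omega x -> {for x, continuous g2})
  (d1 : forall x, Omega x -> is_derive x ((1, 0) : R * R) u (g1 x))
  (d2 : forall x, Omega x -> is_derive x ((0, 1) : R * R) u (g2 x)).

(** The kernels of radius [a] are an approximate identity up to the factor [mass c]; this is the
    passage to the limit [a -> 0]. *)
Lemma mean_value_limit h (B : R) : (forall x, Omega x -> {for x, continuous h}) ->
  (forall a, 0 < a -> a < b ->
     4 * `|rint (ext Omega h (kern c b)) - rint (ext Omega h (kern c a))| <= B) ->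
  4 * `|rint (ext Omega h (kern c b)) - h c * mass c| <= B.
Proof.
move=> ch H; apply/ler_addgt0Pr => e e0.
have m1 : 0 < 4 * (mass c + 1) by rewrite mulr_gt0// ltr_wpDl// mass_ge0.
have [a [a0 ab ha]] := ext_kern_near (divr_gt0 e0 m1) ch.
have h1 := H a a0 ab.
have := ler_distD (rint (ext Omega h (kern c a))) (rint (ext Omega h (kern c b))) (h c * mass c).
have : 4 * (e / (4 * (mass c + 1)) * mass c) <= e.
  have M0 := mass_ge0 c; set M := mass c in M0 *.
  have -> : 4 * (e / (4 * (M + 1)) * M) = e * (M / (M + 1)) by field; lra.
  by rewrite ler_piMr ?(ltW e0)// ler_pdivrMr; lra.
lra.
Qed.

Hypothesis (N0 : 0 <= N) (wL : weakLap Omega u c b N).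

(** The test function is the potential itself, whose integral is at most [b ^+ 2] times the mass. *)
Lemma mean_value :
  4 * `|rint (ext Omega u (kern c b)) - u c * mass c| <= N * b ^+ 2 * mass c.
Proof.
apply: mean_value_limit => // a a0 ab.
have [phi [p1 [p2 [p11 [p12 [p21 [p22 [p111 [p112 [p121 [p122 [p211 [p212 [p221 [p222
  [[b1 b2 b3] _ [E _ _] _ [I0 _ _]]]]]]]]]]]]]]]]] := kernel_estimates c a0 ab.
have := wL b1 b2 b3; rewrite (_ : (fun x => p11 x + p22 x) = (fun x => 4 * (kern c b x - kern c a x))); last exact/funext.
rewrite ext_kernB ?(ltW ab)// normrM ger0_norm// => /le_trans; apply.
rewrite -mulrA ler_wpM2l// -(rint_kern c b0).
by move: I0; rewrite ler_pM2l.
Qed.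

(** The test functions are the first derivatives of the potential. The Laplacian of [p1] is the
    first partial derivative of the kernel difference, and one integration by parts moves that
    derivative onto [u]. *)
Lemma mean_value_grad :
  4 * `|rint (ext Omega g1 (kern c b)) - g1 c * mass c| <= N * (10 * b * mass c) /\
  4 * `|rint (ext Omega g2 (kern c b)) - g2 c * mass c| <= N * (10 * b * mass c).
Proof.
split; apply: mean_value_limit => // a a0 ab;
have [phi [p1 [p2 [p11 [p12 [p21 [p22 [p111 [p112 [p121 [p122 [p211 [p212 [p221 [p222
  [[b1 b2 b3] [b11 b12 b21 b22] [E E1 E2] _ [_ I1 I2]]]]]]]]]]]]]]]]] := kernel_estimates c a0 ab.
all: have [[c11 c111 c112] _] := ball_test_continuous b0 b11.
all: have [[c22 c221 c222] _] := ball_test_continuous b0 b22.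
all: have := @rint_by_parts _ Omega c b u g1 g2 (fun x => p11 x + p22 x)
  (fun x => p111 x + p221 x) (fun x => p112 x + p222 x) oO (ltW b0) bO cu cg1 cg2 d1 d2
  (contD c11 c22) (contD c111 c221) (contD c112 c222)
  (fun x => derD (bt_d1 b11 x) (bt_d1 b22 x)) (fun x => derD (bt_d2 b11 x) (bt_d2 b22 x)).
all: have o x : ~ cball2 c b x -> p11 x + p22 x = 0
  by move=> xb; rewrite (bt_out b11 xb) (bt_out b22 xb) addr0.
all: move=> /(_ o)[P1 P2].
- have := wL b2 b11 b12; rewrite (_ : (fun x => p111 x + p122 x) = (fun x => p111 x + p221 x)); last exact/funext.
  rewrite P1 normrN (_ : (fun x => p11 x + p22 x) = (fun x => 4 * (kern c b x - kern c a x))); last exact/funext.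
  rewrite ext_kernB ?(ltW ab)// normrM ger0_norm// => /le_trans; apply.
  by rewrite ler_wpM2l// -(rint_kern c b0).
- have := wL b3 b21 b22; rewrite (_ : (fun x => p211 x + p222 x) = (fun x => p112 x + p222 x)); last exact/funext.
  rewrite P2 normrN (_ : (fun x => p11 x + p22 x) = (fun x => 4 * (kern c b x - kern c a x))); last exact/funext.
  rewrite ext_kernB ?(ltW ab)// normrM ger0_norm// => /le_trans; apply.
  by rewrite ler_wpM2l// -(rint_kern c b0).
Qed.

End OnOmega.

Lemma cutoff_derivative : exists (dc : R -> R) (D : R), [/\ 0 < D,
  forall t : R, is_derive t 1 cutoff (dc t), continuous dc,
  forall t, 0 <= t <= 1 -> `|dc t| <= D & forall t, 1 < t -> dc t = 0].
Proof.
have [dc [dck dd]] := @Ck1_cutoff R 1.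
have cdc : continuous dc := dck.
have /compact_bounded [M [_ hM]] : compact (dc @` `[0, 1]).
  apply: continuous_compact; last exact: segment_compact.
  exact: continuous_subspaceT.
exists dc, (`|M| + 1); split=> //.
  move=> t t01; apply: hM; first by rewrite (le_lt_trans (ler_norm _))// ltrDl.
  by exists t => //=; rewrite in_itv.
move=> t t1; have hc : is_derive t 1 (cst 0 : R -> R) 0 by exact: is_derive_cst.
have h : is_derive t 1 (@cutoff R) 0.
  apply: near_is_derive hc; near=> y; rewrite cutoff0r//.
  by apply/ltW; near: y; exact: lt_nbhsr.
by have [_ <-] := dd t; have [_ ->] := h.
Unshelve. all: by end_near. Qed.

(* AM-GM applies after one integration by parts because the kernel is a square. *)
Lemma kernel_AMGM : exists2 C : R, 0 < C &
  forall Omega c b (u g1 g2 : R * R -> R) (A e1 e2 Lam : R),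
  open Omega -> 0 < b -> cball2 c b `<=` Omega ->
  (forall x, Omega x -> {for x, continuous u}) ->
  (forall x, Omega x -> {for x, continuous g1}) ->
  (forall x, Omega x -> {for x, continuous g2}) ->
  (forall x, Omega x -> is_derive x ((1, 0) : R * R) u (g1 x)) ->
  (forall x, Omega x -> is_derive x ((0, 1) : R * R) u (g2 x)) ->
  e1 ^+ 2 + e2 ^+ 2 <= 1 -> 0 < Lam ->
  e1 * rint (ext Omega g1 (kern c b)) + e2 * rint (ext Omega g2 (kern c b)) <=
  Lam * rint (ext Omega (fun x => (u x - A) ^+ 2) (kern c b)) + C / (Lam * b ^+ 2).
Proof.
have [dc [D [D0 dcut cdc dcD dc0]]] := cutoff_derivative.
(* The remainder [G] below is at most [4 * D ^+ 2 / (Lam * b ^+ 4)] and is integrated over a ball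
   inside a square of area [4 * b ^+ 2]. *)
exists (16 * D ^+ 2); first by rewrite mulr_gt0// exprn_gt0.
move=> Omega c b u g1 g2 A e1 e2 Lam oO b0 bO cu cg1 cg2 d1 d2 e12 L0.
have b20 : 0 < b ^+ 2 by rewrite exprn_gt0.
pose K' t := (2 * cutoff (t / b ^+ 2) * dc (t / b ^+ 2)) / b ^+ 2 / b ^+ 2.
have dK (t : R) : is_derive t 1 (kern_profile b) (K' t).
  have hs : is_derive t 1 (fun t => cutoff (t / b ^+ 2)) (dc (t / b ^+ 2) / b ^+ 2).
    exact: is_derive_scale.
  have h := is_deriveM (is_deriveM hs hs) (is_derive_cst (b ^+ 2)^-1 t (1 : R)).
  apply: (is_derive_eq h); rewrite scaler0 add0r /K' /GRing.scale/=.
  by field; rewrite gt_eqF.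
pose z1 x : R := x.1 - c.1; pose z2 x : R := x.2 - c.2.
pose k1 x := K' (sqdist c x) * (2 * z1 x); pose k2 x := K' (sqdist c x) * (2 * z2 x).
have bt : ball_test c b (kern c b) k1 k2.
  split.
  - by move=> k; exact: kern_smooth.
  - by move=> x; have [] := is_derive_radial c x dK.
  - by move=> x; have [] := is_derive_radial c x dK.
  by move=> x; exact: kern_out.
have [[ck ck1 ck2] [kk kk1 kk2]] := ball_test_continuous b0 bt.
pose v x := u x - A.
have cv x : Omega x -> {for x, continuous v}.
  by move=> Ox; apply: continuousB; [exact: cu|exact: cst_continuous].
have dv1 x : Omega x -> is_derive x ((1, 0) : R * R) v (g1 x).
  move=> Ox; have h := is_deriveB (d1 x Ox) (is_derive_cst A x ((1, 0) : R * R)).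
  by apply: (is_derive_eq h); rewrite subr0.
have dv2 x : Omega x -> is_derive x ((0, 1) : R * R) v (g2 x).
  move=> Ox; have h := is_deriveB (d2 x Ox) (is_derive_cst A x ((0, 1) : R * R)).
  by apply: (is_derive_eq h); rewrite subr0.
have [E1 E2] := rint_by_parts oO (ltW b0) bO cv cg1 cg2 dv1 dv2 ck ck1 ck2
  (bt_d1 bt) (bt_d2 bt) (bt_out bt).
have o1 x : ~ cball2 c b x -> k1 x = 0.
  by move=> xb; exact: (derive_outside xb (bt_out bt) (bt_d1 bt x)).
have o2 x : ~ cball2 c b x -> k2 x = 0.
  by move=> xb; exact: (derive_outside xb (bt_out bt) (bt_d2 bt x)).
have kv1 := ext_compact_supp oO (ltW b0) bO cv ck1 o1.
have kv2 := ext_compact_supp oO (ltW b0) bO cv ck2 o2.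
have cv2 x : Omega x -> {for x, continuous (fun x => v x ^+ 2)}.
  by move=> Ox; exact: (continuousM (cv x Ox) (cv x Ox)).
have kvv := ext_compact_supp oO (ltW b0) bO cv2 ck (bt_out bt).
pose w x := e1 * z1 x + e2 * z2 x.
have wle x : w x ^+ 2 <= sqdist c x.
  rewrite /w /sqdist -/(z1 x) -/(z2 x); set y := z1 x; set z := z2 x.
  have : (e1 * y + e2 * z) ^+ 2 + (e1 * z - e2 * y) ^+ 2 = (e1 ^+ 2 + e2 ^+ 2) * (y ^+ 2 + z ^+ 2) by ring.
  have := sqr_ge0 (e1 * z - e2 * y).
  have : (e1 ^+ 2 + e2 ^+ 2) * (y ^+ 2 + z ^+ 2) <= y ^+ 2 + z ^+ 2.
    by rewrite ler_piMl// addr_ge0 ?sqr_ge0.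
  lra.
pose d x := dc (sqdist c x / b ^+ 2).
pose G x := 4 / (Lam * (b ^+ 2) ^+ 3) * (d x * w x) ^+ 2.
have Lb : 0 < Lam * (b ^+ 2) ^+ 3 by rewrite mulr_gt0// exprn_gt0.
have cd : continuous d.
  move=> x; apply: (@continuous_comp _ _ _ (fun x => sqdist c x / b ^+ 2) dc); last exact: cdc.
  have h : continuous (fun x => sqdist c x * (cst (b ^+ 2)^-1) x).
    by apply: contM; [exact: sqdist_continuous|exact: cst_continuous].
  exact: h.
have cw : continuous w.
  apply: contD; apply: contM; try exact: cst_continuous.
    exact: (CkT_continuous (CkT_fst 0 c.1)).
  exact: (CkT_continuous (CkT_snd 0 c.2)).
have cG : continuous G.
  apply: contM; first exact: cst_continuous.
  by rewrite (_ : (fun x => _) = (fun x => (d x * w x) * (d x * w x))) //; apply: contM; exact: contM.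
have G0 x : ~ cball2 c b x -> G x = 0.
  move=> /negP; rewrite -ltNge => xb; rewrite /G /d dc0 ?mul0r ?expr0n ?mulr0//.
  by rewrite ltr_pdivlMr// mul1r.
have GM x : `|G x| <= 4 * D ^+ 2 / (Lam * (b ^+ 2) ^+ 2).
  have P0 : 0 <= 4 / (Lam * (b ^+ 2) ^+ 3) by rewrite divr_ge0// ltW.
  have [xb|xb] := pselect (cball2 c b x); last first.
    rewrite G0// normr0; apply: divr_ge0; first by rewrite mulr_ge0 ?sqr_ge0.
    by apply: mulr_ge0; [exact: ltW|exact: sqr_ge0].
  rewrite ger0_norm; last by rewrite mulr_ge0 ?sqr_ge0.
  rewrite (_ : 4 * D ^+ 2 / _ = 4 / (Lam * (b ^+ 2) ^+ 3) * (D ^+ 2 * b ^+ 2)); last first.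
    by field; rewrite !gt_eqF.
  rewrite ler_wpM2l// exprMn ler_pM ?sqr_ge0//; last exact: le_trans (wle x) xb.
  rewrite -(real_normK (num_real (d x))) ler_pXn2r ?nnegrE ?(ltW D0)//.
  by apply: dcD; rewrite divr_ge0 ?sqdist_ge0 ?(ltW b20)//= ler_pdivrMr// mul1r.
have kG := test_compact_supp (ltW b0) cG G0.
have IG := rint_le_box b0 GM G0.
have -> : e1 * rint (ext Omega g1 (kern c b)) + e2 * rint (ext Omega g2 (kern c b)) =
    rint (fun x => (- e1) * ext Omega v k1 x + (- e2) * ext Omega v k2 x).
  rewrite rintD; try exact: compact_suppZ.
  by rewrite !rintZ// E1 E2 !mulrNN.
apply: (@le_trans _ _ (Lam * rint (ext Omega (fun x => v x ^+ 2) (kern c b)) + rint G)); last first.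
  rewrite lerD2l (le_trans IG)//.
  rewrite le_eqVlt; apply/orP; left; apply/eqP; field.
  by rewrite !gt_eqF.
rewrite -rintZ// -rintD//; last exact: compact_suppZ.
apply: rint_le => [||x].
- by apply: compact_suppD; exact: compact_suppZ.
- by apply: compact_suppD => //; exact: compact_suppZ.
have [xb|xb] := pselect (cball2 c b x); last first.
  by rewrite !(ext_outside _ bO)// ?mulr0 ?addr0 ?add0r ?G0// => y; exact: kern_out.
have Ox := bO x xb.
rewrite !extE// /G /k1 /k2 /K' /kern -/(d x).
set j := cutoff _; set y := v x; set dd := d x; rewrite -subr_ge0.
(* The derivative of the squared bump keeps one factor [j], which pairs with [y] to complete the
   square. *)
rewrite (_ : _ - _ = (Lam * y * j * b ^+ 2 + 2 * dd * w x) ^+ 2 / (Lam * (b ^+ 2) ^+ 3)).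
  by rewrite divr_ge0 ?sqr_ge0// ltW.
by rewrite /w; field; rewrite !gt_eqF.
Qed.

End MeanValue.

(** * From the mean value identities to the gradient bound *)

Section GradientEstimate.
Context {R : realType}.
Implicit Types (c x y z : R * R) (Omega : set (R * R)) (u : R * R -> R).

(** Quantitative strict concavity of the square root: the term [x ^+ 2 / 16] is the only source of
    gain in the whole argument. *)
Lemma sqrt_tangent (x : R) : -1 <= x <= 1 -> 1 + x <= (1 + x / 2 - x ^+ 2 / 16) ^+ 2.
Proof.
move=> /andP[a b]; rewrite -subr_ge0.
have -> : (1 + x / 2 - x ^+ 2 / 16) ^+ 2 - (1 + x) =
   x ^+ 2 * (1 / 8 - x / 16 + x ^+ 2 / 256) by field.
rewrite mulr_ge0 ?sqr_ge0//; have := sqr_ge0 x; lra.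
Qed.

Lemma C1_directional Omega u (g1 g2 : R * R -> R) x z : open Omega ->
  (forall x, Omega x -> {for x, continuous g1}) ->
  (forall x, Omega x -> {for x, continuous g2}) ->
  (forall x, Omega x -> is_derive x ((1, 0) : R * R) u (g1 x)) ->
  (forall x, Omega x -> is_derive x ((0, 1) : R * R) u (g2 x)) ->
  Omega x -> is_derive x z u (g1 x * z.1 + g2 x * z.2).
Proof.
move=> oO c1 c2 d1 d2 Ox; have nO : nbhs x Omega by exact: open_nbhs_nbhs.
by apply: is_derive_partials; [exact: filterS nO|exact: filterS nO|exact: c1|exact: c2].
Qed.

Lemma dot2_le (a b c d : R) : (a * c + b * d) ^+ 2 <= (a ^+ 2 + b ^+ 2) * (c ^+ 2 + d ^+ 2).
Proof.
rewrite -subr_ge0 (_ : _ - _ = (a * d - b * c) ^+ 2); first exact: sqr_ge0.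
ring.
Qed.

Lemma sqdist_segment c x (t : R) : sqdist c (c + t *: (x - c)) = t ^+ 2 * sqdist c x.
Proof. by rewrite /sqdist /= /GRing.scale/=; ring. Qed.

Lemma norm_le_sqr (a b : R) : 0 <= b -> a ^+ 2 <= b ^+ 2 -> a <= b.
Proof.
move=> b0 h; have [a0|/ltW a0] := leP 0 a; last exact: le_trans b0.
by rewrite -(@ler_pXn2r _ 2%N).
Qed.

(** * The estimate for an abstract concave function [Z] with slopes [Z1] *)

Section Abstract.
Variables (Z Z1 : R -> R) (c0 C1 : R).
Hypotheses (Zpos : forall t, 0 < t -> 0 < Z t)
  (Ztan : forall s t, 0 < s -> 0 < t -> Z t <= Z s + Z1 s * (t - s))
  (Z1_decr : forall s t, 0 < s -> s <= t -> Z1 t <= Z1 s)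
  (Z1_ge1 : forall t, 0 < t -> 1 <= Z1 t)
  (Z1_le : forall t, 0 < t -> t * Z1 t <= Z t)
  (Z1_ge : forall t, 0 < t -> c0 * Z t <= t * Z1 t)
  (c00 : 0 < c0) (C10 : 0 <= C1).

Lemma Z_ndecr s t : 0 < s -> s <= t -> Z s <= Z t.
Proof.
move=> s0 st; have t0 := lt_le_trans s0 st; have := Ztan t0 s0.
have := Z1_ge1 t0 => h1 h2; apply: (le_trans h2).
by rewrite gerDl mulr_ge0_le0 ?subr_le0// (le_trans ler01).
Qed.

(** For [v <= 1] monotonicity suffices; for [v > 1] the tangent at [s] has slope at most [Z s / s].
    This singles out [sqrt (1 + u / s)] as the quantity with bounded derivative. *)
Lemma Z_affine s v : 0 < s -> 0 < v -> Z (s * v) <= Z s * (1 + v).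
Proof.
move=> s0 v0; have sv : 0 < s * v by rewrite mulr_gt0.
apply: le_trans (Ztan s0 sv) _.
have [v1|v1] := leP v 1.
  have : Z1 s * (s * v - s) <= 0.
    rewrite mulr_ge0_le0 ?(le_trans ler01 (Z1_ge1 s0))// subr_le0.
    by rewrite -[leRHS]mulr1 ler_pM2l.
  have := mulr_ge0 (ltW (Zpos s0)) (ltW v0); lra.
have : s * Z1 s * (v - 1) <= Z s * (v - 1).
  by rewrite ler_wpM2r ?Z1_le// subr_ge0 ltW.
have := Zpos s0; lra.
Qed.

(** Expresses [|Delta u| <= C1 * Z1 u], localised to balls, where a constant bound is all that the
    mean value identities use. *)
Definition weakLap_family Omega u := forall c s (N : R), 0 < s -> 0 <= N ->
  cball2 c s `<=` Omega -> (forall x, cball2 c s x -> C1 * Z1 (u x) <= N) ->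
  weakLap Omega u c s N.

Section Local.
Variables (Omega : set (R * R)) (u g1 g2 : R * R -> R).
Hypotheses (oO : open Omega)
  (cu : forall x, Omega x -> {for x, continuous u})
  (cg1 : forall x, Omega x -> {for x, continuous g1})
  (cg2 : forall x, Omega x -> {for x, continuous g2})
  (d1 : forall x, Omega x -> is_derive x ((1, 0) : R * R) u (g1 x))
  (d2 : forall x, Omega x -> is_derive x ((0, 1) : R * R) u (g2 x))
  (upos : forall x, Omega x -> 0 < u x)
  (wL : weakLap_family Omega u).

Variables (c : R * R) (Q gam h : R).
Let s := u c.
(** A function of slope about [gam] varies by a fixed fraction of [s] on this radius. Below, [gam]
    is the length of the gradient at [c], [Q] its square over [Z s], and [h] the slack by which the
    gradient bound may grow on the ball. *)
Let sig := s / (8 * gam).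
Hypotheses (Q0 : 0 < Q) (gam0 : 0 < gam) (h12 : 1 <= h <= 2)
  (Oc : Omega c) (bO : cball2 c sig `<=` Omega)
  (gamE : gam ^+ 2 = g1 c ^+ 2 + g2 c ^+ 2) (gamQ : gam ^+ 2 = Q * Z s)
  (GQ : forall x, cball2 c sig x -> g1 x ^+ 2 + g2 x ^+ 2 <= h ^+ 2 * Q * Z (u x)).

Let s0 : 0 < s. Proof. exact: upos. Qed.
Let sig0 : 0 < sig. Proof. by rewrite divr_gt0// mulr_gt0. Qed.
Let Zs0 : 0 < Z s. Proof. exact: Zpos. Qed.

(** By [GQ] and [Z_affine] the gradient is at most [2 * gam * sqrt (1 + u / s)]. Along a radius of
    length at most [sig] the function [sqrt (1 + u / s)] therefore has derivative at most
    [1 / 8]. *)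
Lemma comparable_on_ball x : cball2 c sig x -> `|u x / s - 1| <= 1 / 2.
Proof.
move=> xb; pose z := x - c; pose p t := c + t *: z.
have pb t : 0 <= t <= 1 -> cball2 c sig (p t).
  move=> /andP[t0 t1]; rewrite /cball2/= sqdist_segment; apply: le_trans xb.
  by rewrite ler_piMl ?sqdist_ge0// expr2 mulr_ile1.
have zsig : z.1 ^+ 2 + z.2 ^+ 2 <= sig ^+ 2 by exact: xb.
pose f t := Num.sqrt (1 + u (p t) / s).
pose D t := (2 * f t)^-1 * ((g1 (p t) * z.1 + g2 (p t) * z.2) / s).
have y0 t : 0 <= t <= 1 -> 0 < 1 + u (p t) / s.
  by move=> /pb/bO/upos up; rewrite addr_gt0// divr_gt0.
have f0 t : 0 <= t <= 1 -> 0 < f t by move=> /y0 hy; rewrite sqrtr_gt0.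
have df (t : R) : 0 <= t <= 1 -> is_derive t 1 f (D t).
  move=> t01; have Op := bO (pb t t01).
  have /is_derive_line du := C1_directional z oO cg1 cg2 d1 d2 Op.
  have hq : is_derive t 1 (fun t => 1 + u (p t) / s) ((g1 (p t) * z.1 + g2 (p t) * z.2) / s).
    have hh := is_deriveD (is_derive_cst (1 : R) t (1 : R)) (is_deriveM du (is_derive_cst s^-1 t (1 : R))).
    by apply: (is_derive_eq hh); rewrite scaler0 !add0r /GRing.scale/= mulrC.
  exact: (@is_derive1_comp _ Num.sqrt (fun t => 1 + u (p t) / s) _ _ _ (is_derive1_sqrt (y0 t t01)) hq).
have Dle t : 0 <= t <= 1 -> `|D t| <= 1 / 8.
  move=> t01; have xt := pb t t01; have Op := bO xt.
  have ft := f0 t t01.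
  set G := g1 (p t) * z.1 + g2 (p t) * z.2.
  have HG : `|G| <= 2 * (f t * (s / 8)).
    apply: norm_le_sqr; first by rewrite !mulr_ge0 ?divr_ge0 ?(ltW s0) ?(ltW ft).
    rewrite real_normK ?num_real//; apply: le_trans (dot2_le _ _ _ _) _.
    have := GQ xt; have := Z_affine s0 (divr_gt0 (upos Op) s0).
    rewrite mulrCA divff ?gt_eqF// mulr1 => ZA GA.
    have f2 : f t ^+ 2 = 1 + u (p t) / s by rewrite sqr_sqrtr// ltW// y0.
    rewrite -f2 in ZA.
    have h4 : h ^+ 2 <= 4.
      have /andP[h1 h2] := h12; rewrite (_ : 4 = 2 ^+ 2); last by rewrite expr2; ring.
      by rewrite ler_pXn2r ?nnegrE// (le_trans ler01 h1).
    apply: (@le_trans _ _ ((4 * Q * (Z s * f t ^+ 2)) * sig ^+ 2)).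
      apply: ler_pM => //; rewrite ?addr_ge0 ?sqr_ge0//.
      apply: le_trans GA _; apply: ler_pM => //.
      - by rewrite mulr_ge0 ?sqr_ge0// ltW.
      - by rewrite ltW// Zpos// upos.
      - by rewrite ler_wpM2r// ltW.
    rewrite (_ : 4 * Q * (Z s * f t ^+ 2) * sig ^+ 2 = 4 * f t ^+ 2 * (Q * Z s) * sig ^+ 2); last by ring.
    rewrite -gamQ /sig le_eqVlt; apply/orP; left; apply/eqP; field.
    by rewrite gt_eqF.
  rewrite /D normrM normfV [`|2 * f t|]gtr0_norm ?mulr_gt0// ler_pdivrMl ?mulr_gt0//.
  rewrite normrM normfV (gtr0_norm s0) ler_pdivrMr//.
  by apply: le_trans HG _; rewrite le_eqVlt; apply/orP; left; apply/eqP; field.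
have := @MVT_norm _ f D 0 1 (1/8).
rewrite (min_idPl ler01) (max_idPr ler01) subr0 normr1 mulr1 => /(_ df Dle).
have e0 : f 0 ^+ 2 = 2.
  by rewrite sqr_sqrtr ?ltW ?y0 ?lexx ?ler01// /p scale0r addr0 -/s divff ?gt_eqF.
have e1 : f 1 ^+ 2 = 1 + u x / s.
  have px : p 1 = x by rewrite /p scale1r /z addrC subrK.
  by rewrite sqr_sqrtr ?ltW ?y0 ?lexx ?ler01// px.
have p0 := f0 0; have p1 := f0 1.
move: p0 p1 e0 e1; rewrite !lexx !ler01 => /(_ isT) p0 /(_ isT) p1 e0 e1.
have f32 : f 0 <= 3/2 by apply: norm_le_sqr => //; rewrite e0 expr2; lra.
rewrite ler_norml => /andP[l1 l2].
(* Here [f 0 ^+ 2 = 2]; the sum is at most [3 + 1 / 8], so the product stays below [1 / 2]. *)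
have -> : u x / s - 1 = (f 1 - f 0) * (f 1 + f 0) by rewrite -subr_sqr e0 e1; lra.
rewrite normrM; apply: (@le_trans _ _ (1 / 8 * (f 1 + f 0))); last by lra.
rewrite [`|f 1 + f 0|]ger0_norm ?addr_ge0 ?(ltW p0) ?(ltW p1)//.
by rewrite ler_wpM2r ?addr_ge0 ?(ltW p0) ?(ltW p1)// ler_norml; apply/andP; split.
Qed.

Variables (m0 C : R).
Hypotheses (m00 : 0 < m0) (mass_m0 : m0 <= mass c) (C0 : 0 < C)
  (AMGM : forall (A e1 e2 Lam : R), e1 ^+ 2 + e2 ^+ 2 <= 1 -> 0 < Lam ->
     e1 * rint (ext Omega g1 (kern c sig)) + e2 * rint (ext Omega g2 (kern c sig)) <=
     Lam * rint (ext Omega (fun x => (u x - A) ^+ 2) (kern c sig)) + C / (Lam * sig ^+ 2)).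

Let kap := mass c.
Let kap0 : 0 < kap. Proof. exact: lt_le_trans mass_m0. Qed.
Let N := 2 * C1 * Z s / s.
Let N0 : 0 <= N. Proof. by rewrite divr_ge0 ?(ltW s0)// mulr_ge0 ?(ltW Zs0)// mulr_ge0. Qed.

(** On the ball [u >= s / 2], hence [Z1 u <= Z1 (s / 2) <= Z (s / 2) / (s / 2) <= 2 * Z s / s]. *)
Lemma weakLap_local : weakLap Omega u c sig N.
Proof.
apply: (wL sig0 N0 bO) => x xb.
have := comparable_on_ball xb; rewrite ler_norml => /andP[v1 v2].
have us : s / 2 <= u x.
  have : 1 / 2 <= u x / s by lra.
  by rewrite ler_pdivlMr//; lra.
have s20 : 0 < s / 2 by rewrite divr_gt0.
have h1 := Z1_decr s20 us.
have h2 := Z1_le s20.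
have h3 : Z (s / 2) <= Z s by apply: Z_ndecr => //; rewrite ler_pdivrMr//; lra.
rewrite /N (_ : 2 * C1 * Z s / s = C1 * (Z s / (s / 2))); last by field; rewrite gt_eqF.
rewrite ler_wpM2l// (le_trans h1)// ler_pdivlMr// mulrC.
exact: le_trans h3.
Qed.

Let ZE : Z s = gam ^+ 2 / Q.
Proof. by rewrite gamQ mulrAC divff ?mul1r// gt_eqF. Qed.

Let A := rint (ext Omega u (kern c sig)).
Let G1 := rint (ext Omega g1 (kern c sig)).
Let G2 := rint (ext Omega g2 (kern c sig)).
Let I2 := rint (ext Omega (fun x => (u x - s) ^+ 2) (kern c sig)).

Lemma average_bound : `|A / s - kap| <= C1 / (128 * Q) * kap.
Proof.
have := mean_value oO sig0 bO cu N0 weakLap_local; rewrite -/A -/kap -/s.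
rewrite (_ : N * sig ^+ 2 = C1 * s / (32 * Q)); last first.
  by rewrite /N /sig ZE; field; rewrite !gt_eqF.
rewrite (_ : A / s - kap = (A - s * kap) / s); last by field; rewrite gt_eqF.
rewrite normrM normfV (gtr0_norm s0) ler_pdivrMr// => h4.
apply: (@le_trans _ _ ((C1 * s / (32 * Q) * kap) / 4)); first by rewrite ler_pdivlMr//; lra.
by rewrite le_eqVlt; apply/orP; left; apply/eqP; field; rewrite gt_eqF.
Qed.

Let e1 := g1 c / gam.
Let e2 := g2 c / gam.
Let e12 : e1 ^+ 2 + e2 ^+ 2 = 1.
Proof.
by rewrite /e1 /e2 !expr_div_n -mulrDl -gamE divff// expf_neq0// gt_eqF.
Qed.

(** Each component of the average misses its value at [c] by at most [10 / 16] of [B], rounded up to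
    [B]; the unit vector [(e1, e2)] recovers [gam] from the two values. *)
Lemma gradient_average_lower : gam * kap * (1 - 2 * C1 / Q) <= e1 * G1 + e2 * G2.
Proof.
have [] := mean_value_grad oO sig0 bO cu cg1 cg2 d1 d2 N0 weakLap_local.
rewrite -/kap -/G1 -/G2 (_ : N * (10 * sig * kap) = 10 / 4 * (C1 * gam / Q * kap)); last first.
  by rewrite /N /sig ZE; field; rewrite !gt_eqF.
set B := C1 * gam / Q * kap => h1 h2.
have B0 : 0 <= B by rewrite mulr_ge0 ?divr_ge0 ?mulr_ge0 ?(ltW kap0) ?(ltW Q0) ?(ltW gam0).
have e1le : `|e1| <= 1.
  by apply: norm_le_sqr => //; rewrite real_normK ?num_real// expr1n -e12 lerDl sqr_ge0.
have e2le : `|e2| <= 1.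
  by apply: norm_le_sqr => //; rewrite real_normK ?num_real// expr1n -e12 lerDr sqr_ge0.
have E : e1 * (g1 c * kap) + e2 * (g2 c * kap) = gam * kap.
  have -> : g1 c = e1 * gam by rewrite /e1 divfK// gt_eqF.
  have -> : g2 c = e2 * gam by rewrite /e2 divfK// gt_eqF.
  by rewrite -[RHS]mul1r -e12; ring.
have l1 : `|e1 * (G1 - g1 c * kap)| <= B.
  by rewrite normrM (le_trans (ler_wpM2r _ e1le))//; lra.
have l2 : `|e2 * (G2 - g2 c * kap)| <= B.
  by rewrite normrM (le_trans (ler_wpM2r _ e2le))//; lra.
have -> : gam * kap * (1 - 2 * C1 / Q) = gam * kap - 2 * B.
  by rewrite /B; field; rewrite gt_eqF.
rewrite -E; move: l1 l2; rewrite !ler_norml !mulrBr => /andP[? _] /andP[? _]; lra.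
Qed.

(** The logarithmic slope of [Z] at [s], for which the tangent inequality reads
    [Z u <= Z s * (1 + m * (u / s - 1))]. Its lower bound [c0] keeps the quadratic loss from
    degenerating. *)
Let m := s * Z1 s / Z s.
Let mc0 : c0 <= m. Proof. by rewrite ler_pdivlMr//; exact: Z1_ge. Qed.
Let m1 : m <= 1. Proof. by rewrite ler_pdivrMr// mul1r; exact: Z1_le. Qed.
Let h0 : 0 < h. Proof. by have /andP[h1 _] := h12; exact: lt_le_trans h1. Qed.

(** The directional derivative is at most the length of the gradient, hence at most
    [h * gam * sqrt (1 + y)] with [y = m * (u / s - 1)], and [sqrt_tangent] applies because
    [|y| <= 1 / 2]. *)
Lemma gradient_pointwise_upper x : cball2 c sig x ->
  e1 * g1 x + e2 * g2 x <=
  h * gam * (1 + m / 2 * (u x / s - 1) - c0 ^+ 2 / 16 * (u x / s - 1) ^+ 2).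
Proof.
move=> xb; have := comparable_on_ball xb; set v := u x / s - 1 => hv.
have Ox := bO xb; have ux := upos Ox.
have mgt0 : 0 < m := lt_le_trans c00 mc0.
pose y := m * v.
have hy : `|y| <= 1 / 2.
  by rewrite /y normrM (gtr0_norm mgt0) (le_trans _ hv)// ler_piMl.
have /andP[y1 y2] : - (1 / 2) <= y <= 1 / 2 by rewrite -ler_norml.
have Zu : Z (u x) <= Z s * (1 + y).
  apply: le_trans (Ztan s0 ux) _.
  rewrite le_eqVlt; apply/orP; left; apply/eqP; rewrite /y /m /v; field.
  by rewrite !gt_eqF.
have yy : y ^+ 2 <= 1 / 4.
  rewrite -(real_normK (num_real y)) (_ : 1 / 4 = (1 / 2) ^+ 2); last by rewrite expr2; field.
  by rewrite ler_pXn2r ?nnegrE.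
have T0 : 0 <= 1 + y / 2 - y ^+ 2 / 16 by lra.
apply: (@le_trans _ _ (h * gam * (1 + y / 2 - y ^+ 2 / 16))).
  apply: norm_le_sqr; first by rewrite !mulr_ge0// ltW.
  apply: le_trans (dot2_le _ _ _ _) _; rewrite e12 mul1r.
  apply: le_trans (GQ xb) _; set P := 1 + y / 2 - y ^+ 2 / 16.
  have -> : (h * gam * P) ^+ 2 = h ^+ 2 * Q * (Z s * P ^+ 2).
    by rewrite !exprMn gamQ; ring.
  apply: ler_wpM2l; first by rewrite mulr_ge0 ?sqr_ge0// ltW.
  apply: le_trans Zu _; apply: ler_wpM2l; first exact: ltW.
  by apply: sqrt_tangent; apply/andP; split; lra.
rewrite ler_wpM2l ?mulr_ge0 ?(ltW h0) ?(ltW gam0)//.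
have : c0 ^+ 2 * v ^+ 2 <= y ^+ 2.
  rewrite /y exprMn ler_wpM2r ?sqr_ge0// ler_pXn2r ?nnegrE// ltW//.
by rewrite /y; lra.
Qed.

Lemma gradient_average_upper : e1 * G1 + e2 * G2 <=
  h * gam * (kap + m / 2 * (A / s - kap) - c0 ^+ 2 / 16 * (I2 / s ^+ 2)).
Proof.
have ce : forall x, Omega x -> {for x, continuous (fun x => e1 * g1 x + e2 * g2 x)}.
  move=> x Ox; apply: continuousD; apply: continuousM; try exact: cst_continuous.
    exact: cg1.
  exact: cg2.
have cv : forall x, Omega x -> {for x, continuous (fun x => u x - s)}.
  by move=> x Ox; apply: continuousB; [exact: cu|exact: cst_continuous].
have cv2 : forall x, Omega x -> {for x, continuous (fun x => (u x - s) ^+ 2)}.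
  by move=> x Ox; exact: (continuousM (cv x Ox) (cv x Ox)).
pose a1 := h * gam * (m / 2 / s); pose a2 := h * gam * (c0 ^+ 2 / 16 / s ^+ 2).
pose B x := h * gam * (1 + m / 2 * (u x / s - 1) - c0 ^+ 2 / 16 * (u x / s - 1) ^+ 2).
have BE x : B x = h * gam + a1 * (u x - s) - a2 * (u x - s) ^+ 2.
  by rewrite /B /a1 /a2; field; rewrite gt_eqF.
have k1 : compact_supp (ext Omega g1 (kern c sig)) by apply: (ext_kern_supp (b := sig)).
have k2 : compact_supp (ext Omega g2 (kern c sig)) by apply: (ext_kern_supp (b := sig)).
have ku : compact_supp (ext Omega u (kern c sig)) by apply: (ext_kern_supp (b := sig)).
have kv2 : compact_supp (ext Omega (fun x => (u x - s) ^+ 2) (kern c sig)) by apply: (ext_kern_supp (b := sig)).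
have kk := kern_compact_supp c sig0.
have -> : e1 * G1 + e2 * G2 = rint (fun x => e1 * ext Omega g1 (kern c sig) x + e2 * ext Omega g2 (kern c sig) x).
  by rewrite rintD; [rewrite !rintZ|exact: compact_suppZ|exact: compact_suppZ].
have -> : h * gam * (kap + m / 2 * (A / s - kap) - c0 ^+ 2 / 16 * (I2 / s ^+ 2)) =
    rint (fun x => ((h * gam - a1 * s) * kern c sig x + a1 * ext Omega u (kern c sig) x)
       - a2 * ext Omega (fun x => (u x - s) ^+ 2) (kern c sig) x).
  rewrite rintB; last 2 first.
    by apply: compact_suppD; exact: compact_suppZ.
    exact: compact_suppZ.
  rewrite rintD; [|exact: compact_suppZ|exact: compact_suppZ].
  rewrite !rintZ// rint_kern// -/A -/I2 -/kap /a1 /a2; field.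
  by rewrite gt_eqF.
apply: rint_le => [||x].
- by apply: compact_suppD; exact: compact_suppZ.
- by apply: compact_suppB; [apply: compact_suppD; exact: compact_suppZ|exact: compact_suppZ].
have [xb|xb] := pselect (cball2 c sig x); last first.
  rewrite !(ext_outside _ bO)//; try by move=> y; exact: kern_out.
  by rewrite (kern_out sig0 xb) !mulr0 addr0 subr0.
have Ox := bO xb; rewrite !extE//.
have := ler_wpM2r (kern_ge0 c sig x) (gradient_pointwise_upper xb).
rewrite -/(B x) BE; lra.
Qed.

(* The average over the ball of the derivative of [u] in the direction of its gradient
   at [c] is bounded below by the mean value formula.  It is bounded above by [GQ], and
   since the square root is strictly concave that bound gains a multiple of the variance
   [I2] of [u]; AM-GM shows that the variance cannot be small. *)
Lemma local_inequality : 2 * C1 / Q <= 1 / 4 ->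
  1 - 2 * C1 / Q <= h * (1 + C1 / (256 * Q) - c0 ^+ 2 * m0 / (8192 * C)).
Proof.
move=> hQ; pose X := I2 / s ^+ 2.
have gk : 0 < gam * kap by rewrite mulr_gt0.
have s20 : 0 < s ^+ 2 by rewrite exprn_gt0.
have sig20 : 0 < sig ^+ 2 by rewrite exprn_gt0.
(* Chosen so that the second AM-GM term equals [gam * kap / 4]. The lower bound being at least
   [3 / 4 * gam * kap], half of [gam * kap] is left for the variance term. *)
pose Lam := 4 * C / (gam * kap * sig ^+ 2).
have Lam0 : 0 < Lam by apply: divr_gt0; exact: mulr_gt0.
have e12' : e1 ^+ 2 + e2 ^+ 2 <= 1 by rewrite e12.
have amgm : e1 * G1 + e2 * G2 <= Lam * I2 + C / (Lam * sig ^+ 2) by exact: AMGM.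
have E1 : C / (Lam * sig ^+ 2) = gam * kap / 4.
  rewrite /Lam; move: sig20; set S := sig ^+ 2 => S0; field.
  by rewrite !gt_eqF.
have E2 : Lam * I2 = 256 * C * gam / kap * X.
  rewrite /Lam /X /sig; field.
  by rewrite !gt_eqF.
rewrite E1 E2 in amgm.
have lower := gradient_average_lower; have upper := gradient_average_upper.
have avg := average_bound.
rewrite -/X in upper; clearbody X.
(* The variance is bounded below; weighted by [c0 ^+ 2 / 16] it gives the constant [8192 = 16 * 512]
   of the conclusion. *)
have X1 : kap * (m0 / (512 * C)) <= X.
  have h1 : gam * kap / 2 <= 256 * C * gam / kap * X.
    have : gam * kap * (1 / 4) >= gam * kap * (2 * C1 / Q) by rewrite ler_wpM2l// ltW.
    lra.
  have h2 : kap ^+ 2 <= 512 * C * X.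
    have : gam * kap / 2 * (2 * kap / gam) <= 256 * C * gam / kap * X * (2 * kap / gam).
      by rewrite ler_wpM2r// divr_ge0 ?mulr_ge0 ?(ltW kap0) ?(ltW gam0).
    rewrite (_ : gam * kap / 2 * _ = kap ^+ 2); last by field; rewrite gt_eqF.
    by rewrite (_ : 256 * C * gam / kap * X * _ = 512 * C * X)//; field; rewrite !gt_eqF.
  have -> : kap * (m0 / (512 * C)) = kap * m0 / (512 * C) by field; rewrite gt_eqF.
  have C5 : 0 < 512 * C by rewrite (pmulr_lgt0 _ C0) ltr0n.
  rewrite (ler_pdivrMr _ _ C5).
  rewrite [X * _]mulrC; apply: le_trans h2.
  by rewrite expr2 ler_wpM2l// ltW.
have b1 : m / 2 * (A / s - kap) <= C1 / (256 * Q) * kap.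
  have mgt0 : 0 < m := lt_le_trans c00 mc0.
  apply: le_trans (ler_norm _) _; rewrite normrM ger0_norm; last by rewrite divr_ge0// ltW.
  apply: (@le_trans _ _ (1 / 2 * (C1 / (128 * Q) * kap))).
    by apply: ler_pM => //; [rewrite divr_ge0// ltW|rewrite ler_wpM2r].
  by rewrite le_eqVlt; apply/orP; left; apply/eqP; field; rewrite gt_eqF.
have b2 : c0 ^+ 2 / 16 * (kap * (m0 / (512 * C))) <= c0 ^+ 2 / 16 * X.
  by rewrite ler_wpM2l// divr_ge0// sqr_ge0.
have fin : gam * kap * (1 - 2 * C1 / Q) <=
    gam * kap * (h * (1 + C1 / (256 * Q) - c0 ^+ 2 * m0 / (8192 * C))).
  apply: le_trans lower (le_trans upper _).
  rewrite (_ : gam * kap * (h * _) = h * gam * (kap + C1 / (256 * Q) * kap -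
    c0 ^+ 2 / 16 * (kap * (m0 / (512 * C))))); last by field; rewrite !gt_eqF.
  by rewrite ler_wpM2l ?mulr_ge0 ?(ltW h0) ?(ltW gam0)//; lra.
by rewrite -(ler_pM2l gk).
Qed.

End Local.

Lemma dist_triangle x y z : Num.sqrt (sqdist x z) <= Num.sqrt (sqdist x y) + Num.sqrt (sqdist y z).
Proof.
apply: norm_le_sqr; first by rewrite addr_ge0 ?sqrtr_ge0.
rewrite sqrrD !sqr_sqrtr ?sqdist_ge0//.
set p := Num.sqrt _; set q := Num.sqrt _.
have : (y.1 - x.1) * (z.1 - y.1) + (y.2 - x.2) * (z.2 - y.2) <= p * q.
  apply: norm_le_sqr; first by rewrite mulr_ge0 ?sqrtr_ge0.
  by rewrite exprMn !sqr_sqrtr ?sqdist_ge0//; exact: dot2_le.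
rewrite -mulr_natl /sqdist; lra.
Qed.

Lemma cball2E c (r : R) x : 0 <= r -> cball2 c r x <-> Num.sqrt (sqdist c x) <= r.
Proof.
move=> r0; rewrite /cball2/= -{1}[sqdist c x]sqr_sqrtr ?sqdist_ge0//.
by rewrite ler_pXn2r// nnegrE sqrtr_ge0.
Qed.

(** [D] is the gain from concavity, [w = C1 / Q] the error of the averages, [h] the slack. The
    right-hand side is at most [(1 + th / 4) * (1 - th / 2)], which is less than [1 - th / 4], while
    the left-hand side is at least [1 - th / 8]. *)
Lemma contradiction_numerics (th w D h : R) : 0 < th <= 1 -> 0 <= w <= th / 16 -> th <= D ->
  1 <= h <= 1 + th / 4 -> 1 - 2 * w <= h * (1 + w / 256 - D) -> False.
Proof.
move=> /andP[t0 t1] /andP[w0 wt] tD /andP[h1 ht]; apply/negP; rewrite -ltNge.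
apply: (@le_lt_trans _ _ ((1 + th / 4) * (1 - th / 2))).
  apply: (@le_trans _ _ (h * (1 - th / 2))).
    by rewrite ler_wpM2l//; lra.
  by rewrite ler_wpM2r//; lra.
have := mulr_gt0 t0 t0; lra.
Qed.

Lemma inverse_numerics (th : R) : 0 < th <= 1 ->
  [/\ 0 < 1 - th / 8, 1 <= (1 - th / 8)^-1 <= 1 + th / 4, 1 + th / 4 <= 2 &
    2 * (th / 16) <= 1 / 4].
Proof.
move=> /andP[t0 t1]; have p : 0 < 1 - th / 8 by lra.
split; [by []| |lra|lra]; rewrite invf_ge1// gerBl divr_ge0 ?(ltW t0)//=.
rewrite -(ler_pM2l p) mulfV ?gt_eqF//.
have : th * th <= th * 1 by rewrite ler_wpM2l// ltW.
lra.
Qed.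

Lemma quotient_numerics (c th Q S : R) : 0 < th -> 0 < Q -> 0 < S ->
  16 * c * S / th <= S * Q -> c / Q <= th / 16.
Proof.
move=> t0 Q0 S0; rewrite !ler_pdivrMr// => le; rewrite -(ler_pM2r S0); lra.
Qed.

(* Where [d x ^+ 2 * |grad u x|^2 / Z (u x)] is largest, [d x] being the distance from [x]
   to the bounding circle, the gradient cannot be much larger at neighbouring points, so
   that [local_inequality] bounds this maximum. *)
Lemma gradient_estimate (T R0 : R) : 0 < T -> 0 < R0 -> exists2 K : R, 0 < K &
  forall Omega u (g1 g2 : R * R -> R) x1 (r : R), open Omega ->
  (forall x, Omega x -> {for x, continuous u}) ->
  (forall x, Omega x -> {for x, continuous g1}) ->
  (forall x, Omega x -> {for x, continuous g2}) ->
  (forall x, Omega x -> is_derive x ((1, 0) : R * R) u (g1 x)) ->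
  (forall x, Omega x -> is_derive x ((0, 1) : R * R) u (g2 x)) ->
  (forall x, Omega x -> 0 < u x <= T) ->
  (forall x, Omega x -> {for u x, continuous Z}) ->
  weakLap_family Omega u -> 0 < r <= R0 -> cball2 x1 r `<=` Omega ->
  r ^+ 2 * (g1 x1 ^+ 2 + g2 x1 ^+ 2) <= K * Z (u x1).
Proof.
move=> T0 R00.
have [m0 m00 hm0] := @mass_lower R; have [C C0 hC] := @kernel_AMGM R.
(* The gain of [local_inequality], capped at 1; the slack and the admissible error are fixed as
   fractions of it. *)
pose th := Num.min 1 (c0 ^+ 2 * m0 / (8192 * C)).
have C8 : 0 < 8192 * C by rewrite (pmulr_lgt0 _ C0) ltr0n.
have th0 : 0 < th by rewrite lt_min ltr01/= divr_gt0// mulr_gt0// exprn_gt0.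
have th1 : th <= 1 by rewrite ge_min lexx.
have thC : th <= c0 ^+ 2 * m0 / (8192 * C) by rewrite ge_min lexx orbT.
pose tau := th / 8; have tau0 : 0 < tau by rewrite divr_gt0.
have tha : 0 < th <= 1 by rewrite th0.
have [tau1 h14 h2 th4] := inverse_numerics tha.
rewrite -/tau in tau1 h14.
(* If the maximum [dd ^+ 2 * Q] exceeds [K1], then [sig <= tau * dd], as [sig ^+ 2 <= T / (64 * Q)].
   If it exceeds [K2], then [C1 / Q <= th / 16], as [dd <= R0]. *)
pose K1 := T / (64 * tau ^+ 2); pose K2 := 16 * C1 * R0 ^+ 2 / th.
have K10 : 0 <= K1 by rewrite divr_ge0 ?(ltW T0)// mulr_ge0 ?sqr_ge0.
have K20 : 0 <= K2.
  by apply: divr_ge0 (ltW th0); apply: mulr_ge0 (sqr_ge0 _); apply: mulr_ge0 C10.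
pose K := K1 + K2 + 1.
have K0 : 0 < K by rewrite ltr_wpDl ?ltr01 ?addr_ge0.
exists K => // Omega u g1 g2 x1 r oO cu cg1 cg2 d1 d2 uT cZ wL /andP[r0 rR] bO.
have upos x : Omega x -> 0 < u x by move=> /uT/andP[].
pose G x := g1 x ^+ 2 + g2 x ^+ 2.
have G0 x : 0 <= G x by rewrite addr_ge0 ?sqr_ge0.
pose P x := G x / Z (u x).
pose d x := r - Num.sqrt (sqdist x1 x).
have Ox1 : Omega x1 by apply: bO; rewrite /cball2/= /sqdist !subrr expr0n addr0 sqr_ge0.
rewrite leNgt; apply/negP => big.
have cd x : {for x, continuous d}.
  apply: (@continuousB _ _ _ (cst r) (fun x => Num.sqrt (sqdist x1 x))); first exact: cst_continuous.
  apply: continuous_comp; first exact: sqdist_continuous.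
  exact: sqrt_continuous.
have cP x : Omega x -> {for x, continuous P}.
  move=> Ox; apply: (@continuousM _ _ G (fun x => (Z (u x))^-1)).
    by apply: (@continuousD _ _ _ (fun x => g1 x ^+ 2) (fun x => g2 x ^+ 2));
       [exact: (continuousM (cg1 _ Ox) (cg1 _ Ox))|exact: (continuousM (cg2 _ Ox) (cg2 _ Ox))].
  apply: continuousV; first by rewrite gt_eqF// Zpos// upos.
  by apply: continuous_comp; [exact: cu|exact: cZ].
have [x2 bx2 hmax] : exists2 x2, x2 \in cball2 x1 r &
    forall x, x \in cball2 x1 r -> d x ^+ 2 * P x <= d x2 ^+ 2 * P x2.
  apply: compact_EVT_max; first by exists x1; rewrite /cball2/= /sqdist !subrr expr0n addr0 sqr_ge0.
    exact: compact_cball2 (ltW r0).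
  apply: continuous_in_subspaceT => x /set_mem xb.
  by apply: (@continuousM _ _ (fun x => d x ^+ 2) P); [exact: (continuousM (cd x) (cd x))|exact: cP (bO _ xb)].
have {}bx2 := set_mem bx2; have Ox2 := bO _ bx2.
have r00 := ltW r0.
have dd0 : 0 <= d x2 by rewrite subr_ge0 -cball2E.
have ddr : d x2 <= r by rewrite /d gerBl sqrtr_ge0.
set s := u x2; set dd := d x2 in dd0 ddr hmax; set Q := P x2 in hmax.
have s0 : 0 < s := upos _ Ox2; have Zs0 : 0 < Z s := Zpos s0.
have KM : K < dd ^+ 2 * Q.
  have x1b : x1 \in cball2 x1 r by apply/mem_set; rewrite /cball2/= /sqdist !subrr expr0n addr0 sqr_ge0.
  apply: lt_le_trans (hmax _ x1b).
  rewrite /d /sqdist !subrr expr0n addr0 sqrtr0 subr0 /P mulrA ltr_pdivlMr//.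
  exact: Zpos (upos _ Ox1).
have Q0 : 0 < Q.
  have := lt_trans K0 KM; rewrite lt_neqAle => /andP[+ _].
  rewrite lt_def /Q /P divr_ge0 ?(ltW Zs0)// andbT; apply: contraNneq => ->.
  by rewrite mulr0.
have ddp : 0 < dd.
  rewrite lt_def dd0 andbT; apply/eqP => dE.
  by have := lt_trans K0 KM; rewrite dE expr0n mul0r ltxx.
pose gam := Num.sqrt (G x2).
have gamE : gam ^+ 2 = G x2 by rewrite sqr_sqrtr.
have gamQ : gam ^+ 2 = Q * Z s by rewrite gamE /Q /P divfK// gt_eqF.
have gam0 : 0 < gam.
  by rewrite sqrtr_gt0 -gamE gamQ; exact: mulr_gt0.
pose sig := s / (8 * gam).
have sig0 : 0 < sig by apply: divr_gt0 => //; rewrite (pmulr_lgt0 _ gam0) ltr0n.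
have sT : s ^+ 2 <= T * Z s.
  have /andP[_ sT] := uT _ Ox2; rewrite expr2.
  apply: ler_pM => //; [exact: ltW|exact: ltW|apply: le_trans (Z1_le s0)].
  by rewrite ler_peMr ?(ltW s0)// Z1_ge1.
have KK1 : K1 <= K by rewrite /K -addrA lerDl addr_ge0.
have KK2 : K2 <= K by rewrite /K addrAC lerDr addr_ge0.
have TQ : T <= 64 * tau ^+ 2 * (dd ^+ 2 * Q).
  have tp : 0 < 64 * tau ^+ 2 by rewrite (pmulr_lgt0 _ (exprn_gt0 2 tau0)) ltr0n.
  by rewrite [leRHS]mulrC -(ler_pdivrMr _ _ tp); apply: le_trans KK1 (ltW KM).
have sigd : sig <= tau * dd.
  apply: norm_le_sqr; first by rewrite mulr_ge0// ltW.
  have -> : sig ^+ 2 = s ^+ 2 / (64 * gam ^+ 2) by rewrite /sig; field; rewrite gt_eqF.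
  have qp : 0 < 64 * gam ^+ 2 by rewrite (pmulr_lgt0 _ (exprn_gt0 2 gam0)) ltr0n.
  rewrite (ler_pdivrMr _ _ qp) gamQ; apply: le_trans sT _.
  apply: le_trans (ler_wpM2r (ltW Zs0) TQ) _; rewrite le_eqVlt; apply/orP; left.
  by apply/eqP; move: (tau) (dd) => t1 t2; ring.
have CQ : 0 <= C1 / Q <= th / 16.
  rewrite divr_ge0 ?(ltW Q0)//=.
  apply: (@quotient_numerics _ _ _ (R0 ^+ 2)) => //; first exact: exprn_gt0.
  apply: le_trans KK2 (le_trans (ltW KM) _); rewrite ler_wpM2r ?(ltW Q0)//.
  by rewrite ler_pXn2r// ?nnegrE ?(ltW R00)//; exact: le_trans rR.
(* On the small ball the weight drops by at most the factor [1 - tau], so maximality bounds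
   [|grad u|^2 / Z u] there by [Q / (1 - tau) ^+ 2], which is [h ^+ 2 * Q]. *)
have d_near x : cball2 x2 sig x -> (1 - tau) * dd <= d x.
  rewrite cball2E ?(ltW sig0)// => xs.
  rewrite mulrBl mul1r {1}/dd /d -addrA -opprD lerD2l lerN2.
  apply: le_trans (dist_triangle x1 x2 x) _; rewrite lerD2l.
  exact: le_trans xs sigd.
have sub1 x : cball2 x2 sig x -> cball2 x1 r x.
  move=> xs; have := d_near x xs; rewrite cball2E// /d => hx.
  rewrite -subr_ge0; apply: le_trans hx; by rewrite mulr_ge0// ltW.
pose h := (1 - tau)^-1.
have GQ x : cball2 x2 sig x -> g1 x ^+ 2 + g2 x ^+ 2 <= h ^+ 2 * Q * Z (u x).
  move=> xs; have Ox := bO _ (sub1 _ xs); rewrite -/(G x) -ler_pdivrMr ?Zpos ?upos//.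
  rewrite -/(P x); have dx := d_near _ xs.
  have dt2 : 0 < ((1 - tau) * dd) ^+ 2 by rewrite exprn_gt0// mulr_gt0.
  rewrite -(ler_pM2l dt2); apply: (@le_trans _ _ (d x ^+ 2 * P x)).
    rewrite ler_wpM2r ?divr_ge0 ?(ltW (Zpos (upos _ Ox)))// ler_pXn2r// nnegrE.
      by rewrite mulr_ge0// ltW.
    by apply: le_trans dx; rewrite mulr_ge0// ltW.
  apply: le_trans (hmax _ (mem_set (sub1 _ xs))) _.
  rewrite le_eqVlt; apply/orP; left; apply/eqP; rewrite /h; field; rewrite gt_eqF//.
have bs : cball2 x2 sig `<=` Omega by move=> x xs; apply: bO; exact: sub1.
apply: (contradiction_numerics tha CQ thC h14).
have /andP[h1 h3] := h14; have /andP[w0 w1] := CQ.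
have hh : 1 <= h <= 2 by rewrite h1; exact: le_trans h3 h2.
have w4 : 2 * C1 / Q <= 1 / 4.
  rewrite -mulrA; exact: le_trans (ler_wpM2l (ler0n _ 2) w1) th4.
have := @local_inequality Omega u g1 g2 oO cu cg1 cg2 d1 d2 upos wL x2 Q gam h Q0 gam0 hh
  Ox2 bs gamE gamQ GQ m0 C m00 (hm0 x2) C0 _ w4.
have -> : C1 / Q / 256 = C1 / (256 * Q) by field; rewrite gt_eqF.
have -> : 2 * (C1 / Q) = 2 * C1 / Q by rewrite mulrA.
apply=> A e1 e2 Lam e12 L0; exact: hC.
Qed.

End Abstract.
End GradientEstimate.

(** * Concavity and growth of [Z], and the regularized singular term *)

Section LogarithmicEnergy.
Context {R : realType}.
Variable beta : R.
Hypothesis beta01 : 0 < beta < 1.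
Implicit Types s t : R.

Let b0 : 0 < beta. Proof. by have /andP[] := beta01. Qed.
Let a := 1 - beta.
Let a0 : 0 < a. Proof. by have /andP[_ b1] := beta01; rewrite /a; lra. Qed.
Let a1 : a < 1. Proof. by rewrite gtrBl. Qed.

(* the derivative of [Z beta] on the positive half-line *)
Definition dZ t : R := if t <= 1 then t - t `^ (- beta) * ln t else 1.

Lemma ln_le_sub1 t : 0 < t -> ln t <= t - 1.
Proof. by move=> t0; rewrite -{1}[t](subrKC 1) le_ln1Dx// ltrBrDl subrr. Qed.

Lemma powRN_ge1 t : 0 < t -> t <= 1 -> 1 <= t `^ (- beta).
Proof.
move=> t0 t1; rewrite powRN invf_ge1 ?powR_gt0//.
by rewrite -[leRHS](powRr0 t) ger_powR ?t0// ltW.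
Qed.

(** Below 1 the increase of the summand [t] is outweighed: [y - x <= ln y - ln x], and the logarithm
    carries the weight [y ^ (- beta) >= 1]. *)
Lemma dZ_decr s t : 0 < s -> s <= t -> dZ t <= dZ s.
Proof.
move=> s0 st; have t0 := lt_le_trans s0 st; rewrite /dZ.
have below x y : 0 < x -> x <= y -> y <= 1 ->
    y - y `^ (- beta) * ln y <= x - x `^ (- beta) * ln x.
  move=> x0 xy y1; have y0 := lt_le_trans x0 xy; have x1 := le_trans xy y1.
  have h1 : y `^ (- beta) <= x `^ (- beta).
    by rewrite !powRN lef_pV2 ?posrE ?powR_gt0// ge0_ler_powR ?nnegrE ?(ltW b0) ?(ltW x0) ?(ltW y0).
  have h2 : y `^ (- beta) * - ln x <= x `^ (- beta) * - ln x.
    by rewrite ler_wpM2r// oppr_ge0 ln_le0.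
  have h3 : y - x <= ln y - ln x.
    have h4 : ln (x / y) <= x / y - 1 by apply: ln_le_sub1; rewrite divr_gt0.
    rewrite ln_div ?posrE// in h4.
    have h5 : (y - x) <= 1 - x / y.
      rewrite -(ler_pM2r y0) [leRHS]mulrBl mul1r divfK ?gt_eqF//.
      by rewrite ler_piMr// subr_ge0.
    lra.
  have h6 : 1 * (ln y - ln x) <= y `^ (- beta) * (ln y - ln x).
    by rewrite ler_wpM2r ?powRN_ge1// subr_ge0 ler_ln.
  lra.
case: ifPn => [t1|]; first by rewrite (le_trans st t1); exact: below.
rewrite -ltNge => t1; case: ifPn => // s1.
by have := below _ _ s0 s1 (lexx 1); rewrite ln1 mulr0 subr0.
Qed.

Lemma dZ_ge1 t : 0 < t -> 1 <= dZ t.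
Proof.
move=> t0; have [t1|t1] := leP t 1.
  by have := dZ_decr t0 t1; rewrite {1}/dZ lexx ln1 mulr0 subr0.
by rewrite /dZ ifF// leNgt t1.
Qed.

Let Zin t := t ^+ 2 / 2 + t `^ a / a ^+ 2 - t `^ a * ln t / a.

Lemma is_derive_Z_formula t : 0 < t -> is_derive t 1 Zin (t - t `^ (- beta) * ln t).
Proof.
move=> t0.
have dp : is_derive t 1 (fun x => x `^ a) (a * t `^ (a - 1)) by exact: is_derive1_powR.
have dl : is_derive t 1 (@ln R) t^-1 := is_derive1_ln t0.
have d1 := is_deriveM (is_deriveX 2 (is_derive_id t (1 : R))) (is_derive_cst (2^-1 : R) t (1 : R)).
have d2 := is_deriveM dp (is_derive_cst ((a ^+ 2)^-1 : R) t (1 : R)).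
have d3 := is_deriveM (is_deriveM dp dl) (is_derive_cst (a^-1 : R) t (1 : R)).
apply: (is_derive_eq (is_deriveB (is_deriveD d1 d2) d3)).
have tb : t `^ (- beta) = t `^ a / t.
  by rewrite -powR_inv1 ?(ltW t0)// -powRD ?(gt_eqF t0) ?implybT// /a addrAC subrr add0r.
rewrite (_ : a - 1 = - beta) ?tb; last by rewrite /a addrAC subrr add0r.
rewrite !scaler0 !add0r /GRing.scale/= expr1; move: (t `^ a) (ln t) => p l.
field; rewrite (gt_eqF t0) gt_eqF//.
Qed.

(** Concavity from the decreasing derivative. The two formulas for [Z] agree at 1 together with
    their slopes, so mixed cases pass through the point 1. *)
Lemma Z_tangent s t : 0 < s -> 0 < t -> Z beta t <= Z beta s + dZ s * (t - s).
Proof.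
have below x y : 0 < x -> 0 < y -> x <= 1 -> y <= 1 -> Zin y <= Zin x + dZ x * (y - x).
  move=> x0 y0 x1 y1.
  have dF (z : R) : 0 < z -> z <= 1 -> is_derive z 1 Zin (dZ z).
    by move=> z0 z1; rewrite /dZ z1; exact: is_derive_Z_formula.
  have [xy|/ltW yx] := leP x y.
    have h1 z : x <= z <= y -> is_derive z 1 Zin (dZ z).
      by move=> /andP[xz zy]; apply: dF; [exact: lt_le_trans xz|exact: le_trans zy y1].
    have h2 z : x < z < y -> dZ y <= dZ z <= dZ x.
      by move=> /andP[xz zy]; rewrite !dZ_decr ?(ltW xz) ?(ltW zy)//; exact: lt_trans xz.
    have /andP[_] := MVT_ineq xy h1 h2; lra.
  have h1 z : y <= z <= x -> is_derive z 1 Zin (dZ z).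
    by move=> /andP[yz zx]; apply: dF; [exact: lt_le_trans yz|exact: le_trans zx x1].
  have h2 z : y < z < x -> dZ x <= dZ z <= dZ y.
    by move=> /andP[yz zx]; rewrite !dZ_decr ?(ltW yz) ?(ltW zx)//; exact: lt_trans yz.
  have /andP[+ _] := MVT_ineq yx h1 h2; lra.
have out x : 1 <= x -> Z beta x = Zin 1 + (x - 1).
  rewrite le_eqVlt => /predU1P[<-|x1].
    by rewrite /Z lexx subrr addr0.
  rewrite /Z leNgt x1/= /Zin expr1n powR1 ln1 -/a; field; by rewrite gt_eqF.
have inn x : x <= 1 -> Z beta x = Zin x by rewrite /Z => ->.
move=> s0 t0; have [s1|s1] := leP s 1; have [t1|t1] := leP t 1.
- by rewrite !inn//; exact: below.
- rewrite (inn s s1) (out t (ltW t1)).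
  have := below s 1 s0 ltr01 s1 (lexx 1).
  have h1 := dZ_ge1 s0; have h2 : 0 <= t - 1 by lra.
  have := ler_wpM2r h2 h1; lra.
- rewrite (inn t t1) (out s (ltW s1)).
  have := below 1 t ltr01 t0 (lexx 1) t1.
  rewrite {1}/dZ lexx ln1 /dZ (leNgt s) s1/=; lra.
- rewrite (out t (ltW t1)) (out s (ltW s1)) /dZ (leNgt s) s1/=; lra.
Qed.

Lemma powR1B_ge t : 0 < t -> t <= 1 -> t <= t `^ a <= 1.
Proof.
move=> t0 t1; rewrite -{1}(powRr1 (ltW t0)) -[X in _ && (_ <= X)](powRr0 t).
by rewrite !ger_powR ?t0 ?(ltW a0) ?(ltW a1).
Qed.

Lemma mul_powRN t : 0 < t -> t * t `^ (- beta) = t `^ a.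
Proof. by move=> t0; rewrite -{1}(powRr1 (ltW t0)) -powRD// (gt_eqF t0) implybT. Qed.

Lemma mul_dZ_le t : 0 < t -> t * dZ t <= Z beta t.
Proof.
move=> t0; rewrite /dZ /Z -/a.
have aa : a <= 1 := ltW a1.
have ia : 1 <= 1 / a by rewrite div1r invf_ge1.
have ia2 : 1 <= 1 / a ^+ 2.
  by rewrite div1r invf_ge1 ?exprn_gt0// exprn_ile1// ltW.
case: ifPn => t1; last by lra.
rewrite mulrBr mulrA mul_powRN//.
have /andP[p1 p2] := powR1B_ge t0 t1; set p := t `^ a in p1 p2 *.
have p0 : 0 < p := lt_le_trans t0 p1.
have l0 : 0 <= p * - ln t by rewrite mulr_ge0 ?(ltW p0)// oppr_ge0 ln_le0.
have := ler_wpM2l l0 ia; have := ler_wpM2l (ltW p0) ia2.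
have : t * t <= t * 1 by rewrite ler_wpM2l// ltW.
lra.
Qed.

Lemma mul_dZ_ge t : 0 < t -> a ^+ 2 / 8 * Z beta t <= t * dZ t.
Proof.
move=> t0; rewrite /dZ /Z -/a.
have aa : a <= 1 := ltW a1.
have sa : a ^+ 2 <= 1 by rewrite exprn_ile1// ltW.
case: ifPn => t1.
  rewrite [leRHS]mulrBr [t * (_ * _)]mulrA mul_powRN//.
  have /andP[p1 p2] := powR1B_ge t0 t1; set p := t `^ a in p1 p2 *.
  have p0 : 0 < p := lt_le_trans t0 p1.
  have -> : a ^+ 2 / 8 * (t ^+ 2 / 2 + p / a ^+ 2 - p * ln t / a) =
      a ^+ 2 * t ^+ 2 / 16 + p / 8 + a * (p * - ln t) / 8 by field; rewrite gt_eqF.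
  have l0 : 0 <= p * - ln t by rewrite mulr_ge0 ?(ltW p0)// oppr_ge0 ln_le0.
  have h1 := ler_wpM2r (sqr_ge0 t) sa.
  have h2 := ler_wpM2r l0 aa.
  (* The term [p / 8] is to be absorbed. Either the logarithm is large enough to do it, or
     [t >= 3 / 4] and [t ^+ 2] does. *)
  have [L|L] := leP (1 / 4) (- ln t).
    have := ler_wpM2l (ltW p0) L; have := sqr_ge0 t; lra.
  have h3 := ln_le_sub1 t0.
  have h4 : 3 / 4 <= t.
    rewrite -[t]lnK ?posrE//; have := expR_ge1Dx (ln t); lra.
  have : 3 / 4 * (3 / 4) <= t * t by rewrite ler_pM//.
  lra.
rewrite -ltNge in t1.
have -> : a ^+ 2 / 8 * (t - 1 / 2 + 1 / a ^+ 2) = a ^+ 2 * (t - 1 / 2) / 8 + 1 / 8 by field; rewrite gt_eqF.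
have h : 0 <= t - 1 / 2 by lra.
have := ler_wpM2r h sa; lra.
Qed.

Lemma Z_gt0 t : 0 < t -> 0 < Z beta t.
Proof.
move=> t0; apply: lt_le_trans (t0) (le_trans _ (mul_dZ_le t0)).
by rewrite ler_peMr ?(ltW t0)// dZ_ge1.
Qed.

(** The tangent inequalities at both points give a Lipschitz bound with the slope at [t / 2]. *)
Lemma Z_continuous t : 0 < t -> {for t, continuous (Z beta)}.
Proof.
move=> t0; have t2 : 0 < t / 2 by rewrite divr_gt0.
have ln2 : \forall x \near t, t / 2 < x by apply: lt_nbhsr; lra.
apply/cvgrPdist_lt => e e0.
pose L := dZ (t / 2); have L1 : 1 <= L by exact: dZ_ge1.
have L0 : 0 < L := lt_le_trans ltr01 L1.
have eL : 0 < e / L by rewrite divr_gt0.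
near=> x.
have x2 : t / 2 < x by near: x.
have xe : `|t - x| < e / L by near: x; exact: cvgr_dist_lt.
rewrite ltr_pdivlMr// mulrC in xe; apply: le_lt_trans xe.
have x0 := lt_trans t2 x2.
have tt : t / 2 <= t by lra.
have hx := Z_tangent t0 x0; have ht := Z_tangent x0 t0.
have bound y z : t / 2 <= y -> dZ y * (z - y) <= L * `|z - y|.
  move=> yt; apply: le_trans (ler_norm _) _; rewrite normrM ler_wpM2r//.
  have y0 := lt_le_trans t2 yt.
  by rewrite ger0_norm ?dZ_decr// (le_trans ler01)// dZ_ge1.
have b1 := bound _ x tt; have b2 := bound _ t (ltW x2).
rewrite distrC in b1; rewrite ler_norml; apply/andP; split; lra.
Unshelve. all: by end_near.
Qed.

(** Put [w = t + eps]. The power factor is at most [w ^ (- beta)]. If [w < 1], the argument of the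
    logarithm lies between [w] and 1, so the term is at most [dZ w], hence at most [dZ (t + d)]. If
    [w >= 1], the argument lies between 1 and [M + 1], and [dZ >= 1] suffices. *)
Lemma l_eps_bound (q eps d M t : R) : 0 < q -> 0 < d <= eps -> eps < 1 / 2 -> 0 <= t <= M ->
  `|l_eps beta q eps t| <= (1 + ln (M + 1)) * dZ (t + d).
Proof.
move=> q0 /andP[d0 de] e2 /andP[t0 tM]; rewrite /l_eps ltNge t0/=.
have lM : 0 <= ln (M + 1) by rewrite ln_ge0//; lra.
have td : 0 < t + d by lra.
have Z1 := dZ_ge1 td.
have [tE|tn] := eqVneq t 0.
  have -> : t `^ q = 0 by rewrite tE powR0 ?gt_eqF.
  by rewrite mul0r oppr0 mul0r normr0 mulr_ge0 ?addr_ge0// (le_trans ler01).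
have {}tn : 0 < t by rewrite lt_def tn.
set w := t + eps; have w0 : 0 < w by rewrite /w; lra.
have co : 0 <= t `^ q / w `^ (beta + q) <= w `^ (- beta).
  rewrite divr_ge0 ?powR_ge0//= ler_pdivrMr ?powR_gt0// -powRD ?(gt_eqF w0) ?implybT//.
  rewrite (_ : - beta + _ = q); last by ring.
  by rewrite ge0_ler_powR ?nnegrE ?(ltW q0) ?(ltW w0)// /w; lra.
have [c0 c1] := andP co.
rewrite mulNr normrN normrM ger0_norm//.
have [w1|w1] := leP 1 w.
  have y1 : 1 <= t + eps / w <= M + 1.
    have : 0 < eps / w <= 1.
      by rewrite divr_gt0 ?ler_pdivrMr ?mul1r /w//; lra.
    move=> /andP[r0 r1]; apply/andP; split; last by lra.
    rewrite -(ler_pM2r w0) mul1r mulrDl divfK ?gt_eqF//.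
    have : 0 <= t * (w - 1) by rewrite mulr_ge0// ?subr_ge0 // ltW.
    rewrite /w; lra.
  have /andP[y11 y12] := y1.
  have w1' : w `^ (- beta) <= 1.
    by rewrite -[leRHS](powRr0 w) ler_powR// oppr_le0 ltW.
  rewrite ger0_norm ?ln_ge0//.
  have ly : ln (t + eps / w) <= ln (M + 1) by rewrite ler_ln// posrE; lra.
  have ly0 : 0 <= ln (t + eps / w) by rewrite ln_ge0.
  apply: (@le_trans _ _ (1 * ln (M + 1))).
    by apply: ler_pM => //; exact: le_trans w1'.
  rewrite mulrC; apply: ler_pM => //; lra.
have y1 : w <= t + eps / w <= 1.
  have : eps <= eps / w by rewrite ler_pdivlMr// ler_piMr//; lra.
  have : 0 <= t * (1 - w) by rewrite mulr_ge0// subr_ge0 ltW.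
  move=> h1 h2; apply/andP; split; first by rewrite /w in h2 *; lra.
  rewrite -(ler_pM2r w0) mul1r mulrDl divfK ?gt_eqF//.
  rewrite /w in h1 *; lra.
have /andP[y11 y12] := y1.
rewrite ler0_norm ?ln_le0//.
apply: (@le_trans _ _ (w `^ (- beta) * - ln w)).
  apply: ler_pM => //; first by rewrite oppr_ge0 ln_le0.
  by rewrite lerN2 ler_ln ?posrE//; exact: lt_le_trans y11.
have : dZ w <= dZ (t + d) by apply: dZ_decr => //; rewrite /w; lra.
rewrite {1}/dZ (ltW w1) => h; have := mulr_ge0 lM (le_trans ler01 Z1); lra.
Qed.

End LogarithmicEnergy.

(** * Boundedness of the nonlocal term *)

Section RieszPotential.
Context {R : realType}.
Implicit Types (x y : R * R) (D : R).

Definition sqbox x D : set (measurableTypeR R * measurableTypeR R) :=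
  `[x.1 - D, x.1 + D] `*` `[x.2 - D, x.2 + D].

Lemma measurable_sqbox x D : measurable (sqbox x D).
Proof. by apply: measurableX; exact: measurable_itv. Qed.

Lemma leb2_sqbox x D : 0 < D -> leb2 (sqbox x D) = (4 * D ^+ 2)%:E.
Proof.
move=> D0; rewrite /sqbox leb2_itv; [|lra|lra]; congr EFin.
by rewrite expr2; ring.
Qed.

Lemma sqboxE x D y : sqbox x D y <-> `|y.1 - x.1| <= D /\ `|y.2 - x.2| <= D.
Proof.
rewrite /sqbox/= !in_itv/= !ler_distl; split=> -[/andP[h1 h2] /andP[h3 h4]]; lra.
Qed.

Lemma norm_fst_le_enorm x : `|x.1| <= enorm x.
Proof.
rewrite /enorm -sqrtr_sqr ler_wsqrtr// /dot -!expr2 lerDl sqr_ge0//.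
Qed.

Lemma norm_snd_le_enorm x : `|x.2| <= enorm x.
Proof.
rewrite /enorm -sqrtr_sqr ler_wsqrtr// /dot -!expr2 lerDr sqr_ge0//.
Qed.

Lemma enorm_le_add x : enorm x <= `|x.1| + `|x.2|.
Proof.
rewrite -[leRHS]ger0_norm ?addr_ge0// -sqrtr_sqr /enorm ler_wsqrtr// /dot -!expr2.
rewrite sqrrD !real_normK ?num_real// -addrA lerD2l lerDr.
by rewrite mulrn_wge0// mulr_ge0.
Qed.

Lemma dyadic_scale D (rho : R) : 0 < rho <= D ->
  exists n, D / 2 ^+ n.+1 < rho <= D / 2 ^+ n.
Proof.
move=> /andP[r0 rD]; have D0 := lt_le_trans r0 rD.
have ex : exists n, D / 2 ^+ n.+1 < rho.
  have [n hn] : exists n : nat, D / rho < n%:R.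
    exists (Num.bound (D / rho)); apply: archi_boundP; exact: divr_ge0 (ltW D0) (ltW r0).
  exists n; rewrite ltr_pdivrMr ?exprn_gt0// -ltr_pdivrMl// mulrC.
  apply: lt_trans hn _; rewrite -natrX ltr_nat.
  exact: leq_trans (ltn_expl n (ltnSn 1)) (leq_pexp2l _ (leqnSn n)).
exists (ex_minn ex); case: ex_minnP => n hn hmin; rewrite hn/=.
case: n hn hmin => [|n] hn hmin; first by rewrite expr0 divr1.
rewrite leNgt; apply/negP => /hmin; by rewrite ltnn.
Qed.

(* The integrand is at most a sum of multiples of the indicators of dyadic squares about [x]. *)
Lemma inverse_distance_integral x D (k : R) : 0 < D -> 0 <= k ->
  (\int[leb2]_y ((fun y => (k / enorm (x - y))%R) \_ (sqbox x D) y)%:E <= (k * (16 * D))%:E)%E.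
Proof.
(* Between the squares [B n.+1] and [B n] the distance exceeds [D / 2 ^+ n.+1]. The n-th term
   integrates to [k * 8 * D / 2 ^+ n], and these sum to [16 * k * D]. *)
move=> D0 k0; pose c (n : nat) : R := k * (2 ^+ n.+1 / D); pose B n := sqbox x (D / 2 ^+ n).
have c0 n : 0 <= c n by rewrite mulr_ge0// divr_ge0 ?exprn_ge0// ltW.
pose t n (y : measurableTypeR R * measurableTypeR R) : \bar R := ((c n)%:E * (\1_(B n) y)%:E)%E.
have mB n : measurable (B n) by exact: measurable_sqbox.
have t0 n y : (0 <= t n y)%E by rewrite mule_ge0// lee_fin.
have mI n : measurable_fun setT (\1_(B n) : measurableTypeR R * measurableTypeR R -> R).
  exact/measurable_realfun.measurable_indicP.
have It n : (\int[leb2]_y t n y = (k * (8 * D) / 2 ^+ n)%:E)%E.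
  rewrite (@ge0_integralZl_EFin _ _ _ (lebesgue_measure \x lebesgue_measure)%E)//; last exact/measurable_realfun.measurable_EFinP.
  rewrite (@integral_indic _ _ _ (lebesgue_measure \x lebesgue_measure)%E)// setIT.
  have lB : leb2 (B n) = (4 * (D / 2 ^+ n) ^+ 2)%:E by rewrite leb2_sqbox ?divr_gt0 ?exprn_gt0.
  transitivity ((c n)%:E * (4 * (D / 2 ^+ n) ^+ 2)%:E)%E; first by congr (_ * _)%E.
  rewrite -EFinM; congr EFin.
  rewrite /c exprS; have : (2 : R) ^+ n != 0 by rewrite expf_neq0.
  by move: (2 ^+ n) => p p0; field; rewrite p0 gt_eqF.
apply: (@le_trans _ _ (\int[leb2]_y (\sum_(0 <= n <oo) t n y))%E).
  apply: (@ge0_le_integral_nomeas _ _ _ (lebesgue_measure \x lebesgue_measure)%E) => y.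
    by rewrite lee_fin /patch; case: ifP => // _; rewrite divr_ge0// sqrtr_ge0.
  rewrite /patch; case: ifPn => [/set_mem/sqboxE[y1 y2]|_]; last first.
    by apply: nneseries_ge0 => n _ _; exact: t0.
  have [->|yx] := eqVneq (enorm (x - y)) 0.
    by rewrite invr0 mulr0; apply: nneseries_ge0 => n _ _; exact: t0.
  pose rho := Num.max `|y.1 - x.1| `|y.2 - x.2|.
  have rle : rho <= enorm (x - y).
    rewrite /rho ge_max (distrC y.1) (distrC y.2).
    by rewrite (norm_fst_le_enorm (x - y)) (norm_snd_le_enorm (x - y)).
  have r0 : 0 < rho.
    rewrite lt_max !normr_gt0 -negb_and; apply: contraNN yx => /andP[/eqP e1 /eqP e2].
    have -> : enorm (x - y) = Num.sqrt ((y.1 - x.1) ^+ 2 + (y.2 - x.2) ^+ 2).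
      by rewrite /enorm /dot /=; congr Num.sqrt; ring.
    by rewrite e1 e2 expr0n addr0 sqrtr0.
  have rD : rho <= D by rewrite ge_max y1.
  have [|n /andP[n1 n2]] := @dyadic_scale D rho; first by rewrite r0.
  apply: (@le_trans _ _ (t n y)); last first.
    apply: le_trans (nneseries_lim_ge n.+1 (fun k _ _ => t0 k y)).
    by rewrite big_nat_recr//= leeDr// sume_ge0.
  have -> : t n y = (c n)%:E.
    rewrite /t indicE mem_set ?mule1//; apply/sqboxE.
    by move: n2; rewrite ge_max => /andP[].
  rewrite lee_fin /c ler_wpM2l// -[leRHS]invrK invf_div lef_pV2 ?posrE ?divr_gt0 ?exprn_gt0//.
    exact: le_trans (ltW n1) rle.
  exact: lt_le_trans rle.
rewrite (@integral_nneseries _ _ _ (lebesgue_measure \x lebesgue_measure)%E)//; last first.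
  by move=> n; apply: measurable_funeM; exact/measurable_realfun.measurable_EFinP.
under eq_eseriesr do rewrite It.
have S n : \sum_(0 <= i < n) k * (8 * D) / 2 ^+ i = k * (16 * D) - k * (16 * D) / 2 ^+ n.
  elim: n => [|n IH]; first by rewrite big_nil expr0 divr1 subrr.
  rewrite big_nat_recr//= IH exprS; have : (2 : R) ^+ n != 0 by rewrite expf_neq0.
  by move: (2 ^+ n) => p p0; field.
apply: lime_le.
  by apply: is_cvg_nneseries => n _ _; rewrite lee_fin divr_ge0 ?exprn_ge0// !mulr_ge0// ltW.
near=> n; rewrite sumEFin lee_fin S.
by rewrite gerBl divr_ge0 ?exprn_ge0// !mulr_ge0// ltW.
Unshelve. all: by end_near.
Qed.

Lemma bounded_coord (Omega : set (R * R)) : bounded_set Omega -> exists2 m, 0 < m &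
  forall x, Omega x -> `|x.1| <= m /\ `|x.2| <= m.
Proof.
move=> /pinfty_ex_gt0[m m0 hm]; exists m => // x /hm /=.
by rewrite prod_normE ge_max => /andP.
Qed.

(** On a bounded set [e ^ (- mu) <= (1 + 2 * D) / e] because [mu < 1], and the inverse distance is
    integrable in the plane. *)
Lemma choquard_bound (Omega : set (R * R)) (mu : R) : open Omega -> bounded_set Omega -> 0 < mu < 1 ->
  exists2 C : R, 0 <= C & forall f u A, 0 <= A ->
    (forall y, Omega y -> `|prim f (u y)| <= A) ->
    forall x, Omega x -> `|choquard Omega mu f u x| <= A * C.
Proof.
move=> oO /bounded_coord[m m0 hm] /andP[mu0 mu1].
pose D := 2 * m; have D0 : 0 < D by rewrite mulr_gt0.
have D2 : 0 <= 1 + 2 * D by rewrite addr_ge0// mulr_ge0// ltW.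
exists ((1 + 2 * D) * (16 * D)); first by apply: (mulr_ge0 D2); apply: mulr_ge0 (ltW D0); rewrite ler0n.
move=> f u A A0 hA x Ox; rewrite /choquard Rintegral_mkcond.
have k0 : 0 <= A * (1 + 2 * D) by rewrite mulr_ge0.
pose g := (fun y => A * (1 + 2 * D) / enorm (x - y)) \_ (sqbox x D).
have I2 := inverse_distance_integral x D0 k0; rewrite -/g in I2.
have g0 y : 0 <= g y.
  by rewrite /g /patch; case: ifP => // _; rewrite divr_ge0// sqrtr_ge0.
have h := @norm_Rintegral_le _ _ _ (lebesgue_measure \x lebesgue_measure)%E _ g.
apply: le_trans (h _ _ _) _.
- move=> y; rewrite /patch; case: ifPn => [/set_mem Oy|_]; last first.
    by rewrite normr0.
  have [x1 x2] := hm _ Ox; have [y1 y2] := hm _ Oy.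
  have yb : sqbox x D y.
    by apply/sqboxE; split; apply: le_trans (ler_normB _ _) _; rewrite /D; lra.
  rewrite /g /patch mem_set// normrM normfV.
  rewrite [`|_ `^ mu|]ger0_norm ?powR_ge0// -[leRHS]mulrA.
  apply: ler_pM => //; [by rewrite invr_ge0 powR_ge0|exact: hA|].
  have [->|e0] := eqVneq (enorm (x - y)) 0.
    by rewrite powR0 ?gt_eqF// invr0 mulr0.
  have {}e0 : 0 < enorm (x - y) by rewrite lt_def e0 sqrtr_ge0.
  have eD : enorm (x - y) <= 2 * D.
    move/sqboxE: yb => [b1 b2]; apply: le_trans (enorm_le_add _) _ => /=.
    rewrite (distrC x.1) (distrC x.2); lra.
  move: (enorm (x - y)) e0 eD => e e0 eD.
  rewrite ler_pdivlMr// mulrC ler_pdivrMr ?powR_gt0//.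
  have [e1|e1] := leP e 1.
    have : e <= e `^ mu by rewrite -{1}(powRr1 (ltW e0)) ger_powR ?e0 ?(ltW mu1).
    have : 0 <= 2 * D * e `^ mu by exact: mulr_ge0 (mulr_ge0 (ler0n _ 2) (ltW D0)) (powR_ge0 _ _).
    lra.
  have : 1 <= e `^ mu by rewrite -[leLHS](powRr0 e); apply: ler_powR; exact: ltW.
  move=> h2; have := ler_wpM2l D2 h2; lra.
- exact: le_lt_trans I2 (ltry _).
- have I0 : (0 <= \int[leb2]_y (g y)%:E)%E by apply: integral_ge0 => y _; rewrite lee_fin.
  rewrite /Rintegral mulrA -lee_fin fineK//.
  by rewrite ge0_fin_numE//; exact: le_lt_trans I2 (ltry _).
Qed.

End RieszPotential.

(** * Pointwise information on the solution, and room inside the domain *)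

Section SolutionBounds.
Context {R : realType}.
Implicit Types (Omega : set (R * R)) (u v : R * R -> R) (x : R * R).

Lemma sqbox_nbhs x (A : set (R * R)) : nbhs x A -> exists2 D : R, 0 < D & sqbox x D `<=` A.
Proof.
move=> /nbhs_ballP[e /= e0 eA]; exists (e / 2); first exact: divr_gt0.
move=> y /sqboxE[y1 y2]; apply: eA; split; rewrite /ball/= distrC.
  by apply: le_lt_trans y1 _; rewrite ltr_pdivrMr// ltr_pMr// ltr1n.
by apply: le_lt_trans y2 _; rewrite ltr_pdivrMr// ltr_pMr// ltr1n.
Qed.

Lemma not_negligible_nbhs x (A : set (measurableTypeR R * measurableTypeR R)) :
  nbhs (x : R * R) (A : set (R * R)) ->
  ~ (lebesgue_measure \x lebesgue_measure)%E.-negligible A.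
Proof.
move=> /sqbox_nbhs[D D0 DA] [N [mN N0 AN]].
have : (leb2 (sqbox x D) <= (lebesgue_measure \x lebesgue_measure)%E N)%E.
  apply: le_measure; rewrite ?inE//; first exact: measurable_sqbox.
  by move=> y /DA/AN.
by rewrite N0 leb2_sqbox// lee_fin leNgt mulr_gt0// exprn_gt0.
Qed.

(** A negative value would persist on a neighbourhood, which contains a square of positive
    measure. *)
Lemma ae_ge0_open Omega v : open Omega -> (forall x, Omega x -> {for x, continuous v}) ->
  {ae leb2, forall x, Omega x -> 0 <= v x} -> forall x, Omega x -> 0 <= v x.
Proof.
move=> oO cv av x Ox; rewrite leNgt; apply/negP => vx.
apply: (@not_negligible_nbhs x _ _ av).
have nO : nbhs x Omega by exact: open_nbhs_nbhs.
have nv : \forall y \near x, v y < 0 by apply: (cvgr_lt _ (cv _ Ox)).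
near=> y => /= hy.
have Oy : Omega y by near: y.
have vy : v y < 0 by near: y.
by have := hy Oy; rewrite leNgt vy.
Unshelve. all: by end_near.
Qed.

Lemma Linfty_le_open Omega u (M1 : R) : open Omega -> (forall x, Omega x -> {for x, continuous u}) ->
  (Linfty_norm Omega u < M1%:E)%E -> forall x, Omega x -> u x <= M1.
Proof.
move=> oO cu; rewrite /Linfty_norm unlock.
(* The norm for exponent infinity is an essential supremum only when the total measure is
   positive. *)
have -> : (0 < leb2 [set: R * R])%E.
  apply: (@lt_le_trans _ _ (leb2 (sqbox (0 : R * R) 1))).
    by rewrite leb2_sqbox// lte_fin mulr_gt0.
  by apply: le_measure; rewrite ?inE//; exact: measurable_sqbox.
move=> /ltW/ess_sup_inf.ess_supP h x Ox; rewrite -subr_ge0.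
apply: (@ae_ge0_open Omega (fun x => M1 - u x)) => //.
  by move=> y Oy; apply: (@continuousB _ _ _ (cst M1) u); [exact: cst_continuous|exact: cu].
apply: filterS h => y /= + Oy; rewrite /patch mem_set// lee_fin => h.
by rewrite subr_ge0 (le_trans (ler_norm _)).
Qed.

Lemma Ck1_closure_open Omega u : open Omega -> Ck_closure 1 Omega u ->
  exists g1 g2 : R * R -> R, [/\ forall x, Omega x -> {for x, continuous u},
    forall x, Omega x -> {for x, continuous g1}, forall x, Omega x -> {for x, continuous g2},
    forall x, Omega x -> is_derive x ((1, 0) : R * R) u (g1 x) &
    forall x, Omega x -> is_derive x ((0, 1) : R * R) u (g2 x)].
Proof.
move=> oO [cu [g1 [g2 [[c1 _] [c2 _] d]]]].
have cO (h : R * R -> R) : {within closure Omega, continuous h} -> forall x, Omega x -> {for x, continuous h}.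
  move=> ch x Ox; have := continuous_subspaceW (@subset_closure _ Omega) ch.
  by rewrite continuous_open_subspace// => /(_ x (mem_set Ox)).
exists g1, g2; split; try exact: cO; by move=> x /d[].
Qed.

Lemma grad_enorm u x (a b : R) : is_derive x ((1, 0) : R * R) u a ->
  is_derive x ((0, 1) : R * R) u b -> enorm (grad u x) ^+ 2 = a ^+ 2 + b ^+ 2.
Proof.
move=> da db; rewrite /enorm /grad (derive_val (is_derive := da)) (derive_val (is_derive := db)).
by rewrite sqr_sqrtr /dot -!expr2// addr_ge0 ?sqr_ge0.
Qed.

Lemma nonlinearity_bounded (f : R -> R) (M1 : R) : 0 < M1 -> {within `[0, +oo[, continuous f} ->
  exists2 B : R, 0 <= B & forall t, 0 <= t <= M1 -> `|f t| <= B /\ `|prim f t| <= B * M1.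
Proof.
move=> M0 cf.
have cf1 : {within `[0, M1], continuous f}.
  by apply: continuous_subspaceW cf => t /=; rewrite !in_itv/= => /andP[->].
have [c1 _ hc1] := EVT_max (ltW M0) cf1.
have [c2 _ hc2] := EVT_min (ltW M0) cf1.
pose B := Num.max `|f c1| `|f c2|.
have fB t : 0 <= t <= M1 -> `|f t| <= B.
  move=> tM; have := hc1 t; have := hc2 t; rewrite in_itv/= => /(_ tM) h2 /(_ tM) h1.
  rewrite ler_norml /B le_max lerNl; apply/andP; split.
    by rewrite le_max; apply/orP; right; rewrite -normrN (le_trans _ (ler_norm _))// lerN2.
  by rewrite (le_trans h1)// ler_norm.
have B0 : 0 <= B by rewrite le_max normr_ge0.
exists B => // t tM; split; first exact: fB.
rewrite /prim Rintegral_mkcond.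
have I1 : (\int[lebesgue_measure]_y ((cst B \_ `[0%R, M1]) y)%:E = (B * M1)%:E)%E.
  have E : lebesgue_measure (`[0, M1]%classic : set R) = M1%:E.
    by rewrite lebesgue_measure_itv/= lte_fin M0 -EFinB subr0.
  rewrite -[RHS]/(B%:E * M1%:E)%E -E -integral_cst//.
  by rewrite [RHS]integral_mkcond; apply: eq_integral => x _; rewrite /patch; case: ifP.
have h := @norm_Rintegral_le _ _ _ (@lebesgue_measure R) (f \_ `[0, t]) (cst B \_ `[0, M1]).
apply: le_trans (h _ _) _.
- move=> y; rewrite /patch; case: ifPn => [/set_mem|_]; last first.
    by rewrite normr0; case: ifP.
  rewrite /= in_itv/= => /andP[y0 yt]; have yM : 0 <= y <= M1.
    by rewrite y0 (le_trans yt)//; case/andP: tM.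
  by rewrite mem_set ?fB//= in_itv.
- by rewrite I1 ltry.
- by rewrite /Rintegral I1.
Qed.

(** The Laplacian of a compactly supported test function integrates to zero against a constant. *)
Lemma weakLap_shift Omega u c s (N d : R) : open Omega -> 0 < s -> cball2 c s `<=` Omega ->
  (forall x, Omega x -> {for x, continuous u}) ->
  weakLap Omega u c s N -> weakLap Omega (fun x => u x + d) c s N.
Proof.
move=> oO s0 sO cu wL phi p1 p2 p11 p12 p21 p22 b b1 b2.
suff -> : rint (ext Omega (fun x => u x + d) (fun x => p11 x + p22 x)) =
    rint (ext Omega u (fun x => p11 x + p22 x)) by exact: wL b b1 b2.
have [[_ c11 _] [_ k11 _]] := ball_test_continuous s0 b1.
have [[_ _ c22] [_ _ k22]] := ball_test_continuous s0 b2.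
have kp : compact_supp p1 by have [_ []] := ball_test_continuous s0 b1.
have kq : compact_supp p2 by have [_ []] := ball_test_continuous s0 b2.
have out11 x : ~ cball2 c s x -> p11 x = 0.
  by move=> xb; apply: (derive_outside xb (bt_out b1)); exact: bt_d1 b1 x.
have out22 x : ~ cball2 c s x -> p22 x = 0.
  by move=> xb; apply: (derive_outside xb (bt_out b2)); exact: bt_d2 b2 x.
have -> : ext Omega (fun x => u x + d) (fun x => p11 x + p22 x) =
    (ext Omega u (fun x => p11 x + p22 x) \+ (fun x => d * (p11 x + p22 x))).
  apply/funext => x /=; have [xb|xb] := pselect (cball2 c s x).
    by have Ox := sO _ xb; rewrite !extE// mulrDl.
  have out y : ~ cball2 c s y -> p11 y + p22 y = 0 by move=> yb; rewrite out11// out22// addr0.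
  by rewrite !(ext_outside _ sO out xb) out// mulr0 addr0.
have ks : compact_supp (fun x => p11 x + p22 x) by exact: (compact_suppD k11 k22).
rewrite rintD; last exact: compact_suppZ.
  rewrite rintZ// [X in d * X](rintD k11 k22).
  by rewrite (rint_derive_fst kp k11 (bt_d1 b1)) (rint_derive_snd kq k22 (bt_d2 b2)) addr0 mulr0 addr0.
apply: (ext_compact_supp oO (ltW s0) sO cu); first by case: ks.
by move=> y yb; rewrite out11// out22// addr0.
Qed.

Lemma interior_minimum Omega u (g1 g2 : R * R -> R) x : open Omega ->
  (forall x, Omega x -> is_derive x ((1, 0) : R * R) u (g1 x)) ->
  (forall x, Omega x -> is_derive x ((0, 1) : R * R) u (g2 x)) ->
  (forall y, Omega y -> u x <= u y) -> Omega x -> g1 x = 0 /\ g2 x = 0.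
Proof.
move=> oO d1 d2 umin Ox; have [D D0 DO] := sqbox_nbhs (open_nbhs_nbhs (conj oO Ox)).
have line1 t : t \in `]x.1 - D, x.1 + D[ -> Omega (t, x.2).
  rewrite in_itv/= => /andP[t1 t2]; apply: DO; apply/sqboxE => /=.
  by rewrite subrr normr0 ler_distl (ltW t1) (ltW t2) ltW.
have line2 t : t \in `]x.2 - D, x.2 + D[ -> Omega (x.1, t).
  rewrite in_itv/= => /andP[t1 t2]; apply: DO; apply/sqboxE => /=.
  by rewrite subrr normr0 ler_distl (ltW t1) (ltW t2) ltW.
have cen (c : R) : c \in `]c - D, c + D[ by rewrite in_itv/= ltrBlDr ltrDl D0.
have le (c : R) : c - D <= c + D by lra.
have e1 := derive1_at_min (le x.1) (f := fun s => u (s, x.2)) _ (cen x.1).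
have e2 := derive1_at_min (le x.2) (f := fun s => u (x.1, s)) _ (cen x.2).
split.
  have /is_derive_fst[_ <-] := d1 _ Ox.
  have [||_ //] := e1.
    by move=> t /line1/d1/is_derive_fst[].
  by move=> t /line1; rewrite -surjective_pairing; exact: umin.
have /is_derive_snd[_ <-] := d2 _ Ox.
have [||_ //] := e2.
  by move=> t /line2/d2/is_derive_snd[].
by move=> t /line2; rewrite -surjective_pairing; exact: umin.
Qed.

(* The square root of [psi] is Lipschitz along segments and vanishes on the boundary,
   so the boundary is no closer than a multiple of that root. *)
Lemma sqrt_ball_in_domain Omega psi (C : R) : open Omega -> Ck_closure 1 Omega psi ->
  (forall x, Omega x -> 0 < psi x) -> (forall x, boundary Omega x -> psi x = 0) ->
  0 < C -> (forall x, Omega x -> enorm (grad psi x) ^+ 2 / psi x <= C) ->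
  forall x, Omega x -> cball2 x (Num.sqrt (psi x / C)) `<=` Omega.
Proof.
move=> oO kpsi pos bd C0 hC x Ox y yb; apply: contrapT => nOy.
have [g1 [g2 [cpsi c1 c2 d1 d2]]] := Ck1_closure_open oO kpsi.
pose z := y - x; pose p (t : R) := x + t *: z.
have px0 := pos _ Ox; set m := Num.sqrt (psi x).
have m0 : 0 < m by rewrite sqrtr_gt0.
have cp : continuous p.
  by move=> t; apply: cvgD; [exact: cvg_cst|exact: scalel_continuous].
(* The first time at which the segment from [x] to [y] leaves [Omega], attained since the complement
   is closed. *)
have [T /set_mem[/= T01 nT] Tmin] : exists2 T, T \in `[0, 1] `&` p @^-1` (~` Omega) &
    forall t, t \in `[0, 1] `&` p @^-1` (~` Omega) -> T <= t.
  apply: (@compact_EVT_min _ _ id).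
  - exists 1; split; first by rewrite /= in_itv/= ler01 lexx.
    by rewrite /= /p scale1r /z addrC subrK.
  - apply: compact_closedI; first exact: segment_compact.
    by apply: preimage_closed; [move=> t _; exact: cp|exact: open_closedC].
  - by apply: continuous_subspaceT => t; exact: cvg_id.
move: T01; rewrite in_itv/= => /andP[T0 T1].
have Op t : 0 <= t < T -> Omega (p t).
  move=> /andP[t0 tT]; apply: contrapT => nt; have := lt_geF tT.
  by rewrite Tmin//; apply/mem_set; split=> //; rewrite /= in_itv/= t0 (le_trans (ltW tT)).
have {}T0 : 0 < T.
  rewrite lt_def T0 andbT; apply: contra_notN nT => /eqP ->.
  by rewrite /p scale0r addr0.
pose f t := Num.sqrt (psi (p t)).
have df (t : R) : 0 <= t < T -> is_derive t 1 f ((2 * f t)^-1 * (g1 (p t) * z.1 + g2 (p t) * z.2)).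
  move=> tT; have Opt := Op t tT.
  have /is_derive_line du := C1_directional z oO c1 c2 d1 d2 Opt.
  exact: (@is_derive1_comp _ Num.sqrt (fun t => psi (p t)) _ _ _ (is_derive1_sqrt (pos _ Opt)) du).
(* [|grad psi| <= sqrt (C * psi)] and [|z| <= m / sqrt C]. Before the exit time the root of [psi]
   thus loses at most half of its initial value [m]. *)
have Dle t : 0 <= t < T -> `|(2 * f t)^-1 * (g1 (p t) * z.1 + g2 (p t) * z.2)| <= m / 2.
  move=> tT; have Opt := Op t tT; have ft : 0 < f t by rewrite sqrtr_gt0 pos.
  have := hC _ Opt; rewrite (grad_enorm (d1 _ Opt) (d2 _ Opt)) ler_pdivrMr ?pos// => hG.
  rewrite normrM normfV [`|2 * f t|]ger0_norm ?mulr_ge0 ?(ltW ft)// [leLHS]mulrC ler_pdivrMr ?mulr_gt0//.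
  have -> : m / 2 * (2 * f t) = m * f t by field.
  apply: norm_le_sqr; first by rewrite mulr_ge0// ltW.
  rewrite real_normK ?num_real// exprMn !sqr_sqrtr ?(ltW px0) ?(ltW (pos _ Opt))//.
  apply: le_trans (dot2_le _ _ _ _) _.
  have zC : z.1 ^+ 2 + z.2 ^+ 2 <= psi x / C.
    by move: yb; rewrite /cball2/= sqr_sqrtr// divr_ge0// ltW.
  have z0 : 0 <= z.1 ^+ 2 + z.2 ^+ 2 by rewrite addr_ge0 ?sqr_ge0.
  apply: (@le_trans _ _ (C * psi (p t) * (psi x / C))).
    by apply: ler_pM => //; rewrite addr_ge0 ?sqr_ge0.
  rewrite le_eqVlt; apply/orP; left; apply/eqP; field; exact: lt0r_neq0.
have low t : 0 <= t < T -> m / 2 <= f t.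
  move=> /andP[t0 tT].
  have h1 (r : R) : 0 <= r <= t -> is_derive r 1 f ((2 * f r)^-1 * (g1 (p r) * z.1 + g2 (p r) * z.2)).
    by move=> /andP[r0 rt]; apply: df; rewrite r0 (le_lt_trans rt).
  have h2 (r : R) : 0 < r < t -> - (m / 2) <= (2 * f r)^-1 * (g1 (p r) * z.1 + g2 (p r) * z.2) <= m / 2.
    by move=> /andP[r0 rt]; rewrite -ler_norml Dle// (ltW r0) (lt_trans rt).
  have /andP[+ _] := MVT_ineq t0 h1 h2.
  have -> : f 0 = m by rewrite /f /p scale0r addr0.
  have : m * t <= m * 1 by rewrite ler_wpM2l ?(ltW m0)// (le_trans (ltW tT)).
  rewrite subr0; lra.
have left_near (P : set R) : nbhs T P -> exists2 t, 0 <= t < T & P t.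
  move=> TP.
  have : \forall t \near T^'-, [/\ P t, 0 < t & t < T].
    near=> t; split; near: t.
    - exact: cvg_within TP.
    - exact: nbhs_left_gt.
    - exact: nbhs_left_lt.
  by move=> h; have [t [Pt t0 tT]] := @filter_ex _ _ (at_left_proper_filter T) _ h; exists t => //; rewrite (ltW t0).
have clT : closure Omega (p T).
  by move=> B /cp/left_near[t tT Bt]; exists (p t); split => //; exact: Op.
(* The exit point is on the boundary. Continuity of [psi] on the closure contradicts the lower bound
   [m / 2] kept by its root just before the exit. *)
have psiT : psi (p T) = 0 by apply: bd; split=> // /interior_subset.
have /subspace_continuousP/(_ _ clT) cT := kpsi.1.
have m2 : 0 < m ^+ 2 / 4 by rewrite divr_gt0// exprn_gt0.
have nT' : \forall y \near within (closure Omega) (nbhs (p T)), psi y < m ^+ 2 / 4.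
  have cT0 : psi y @[y --> within (closure Omega) (nbhs (p T))] --> (0 : R).
    by rewrite -[X in _ --> X]psiT; exact: cT.
  exact: (cvgr_lt _ cT0 _ m2).
have [t tT] := left_near _ (cp T _ nT').
move=> /= /(_ (subset_closure (Op t tT))).
have ft := low t tT; have : (m / 2) ^+ 2 <= f t ^+ 2.
  by rewrite ler_pXn2r// nnegrE ?sqrtr_ge0// divr_ge0// ltW.
rewrite /f sqr_sqrtr ?(ltW (pos _ (Op t tT)))// => h1 h2.
have := le_lt_trans h1 h2; lra.
Unshelve. all: by end_near.
Qed.

End SolutionBounds.

(** * The estimate for the regularized problem, uniform in [eps] *)

Section Regularized.
Context {R : realType}.
Implicit Types (Omega : set (R * R)) (u : R * R -> R) (x : R * R).

Lemma solution_gradient_estimate Omega (mu beta q lambda : R) (f : R -> R) (M1 R0 : R) :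
  open Omega -> bounded_set Omega -> 0 < mu < 1 -> 0 < beta < 1 -> 0 < q ->
  {within `[0, +oo[, continuous f} -> 0 < M1 -> 0 < R0 ->
  exists2 K : R, 0 < K & forall m1 m2 M eps u x r, 0 < eps < 1 / 2 ->
    bounded_solution Omega mu beta q lambda f m1 m2 M M1 eps u ->
    0 < r <= R0 -> cball2 x r `<=` Omega ->
    r ^+ 2 * enorm (grad u x) ^+ 2 <= K * Z beta (u x).
Proof.
move=> oO bO hmu hbeta q0 cf M10 R00.
have [B B0 hB] := nonlinearity_bounded M10 cf.
have [C C0 hC] := choquard_bound oO bO hmu.
have BM0 : 0 <= B * M1 by rewrite mulr_ge0// ltW.
pose N2 := B * M1 * C * B; have N20 : 0 <= N2 by rewrite !mulr_ge0// ltW.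
have l0 : 0 <= 1 + ln (M1 + 1) by rewrite addr_ge0// ln_ge0// lerDr ltW.
have lN0 : 0 <= `|lambda| * N2 by rewrite mulr_ge0.
(* The first two summands come from [l_eps_bound]. The last bounds the nonlocal term, which fits
   under a multiple of [dZ] because [dZ >= 1]. *)
pose C1 := 1 + ln (M1 + 1) + `|lambda| * N2.
have C10 : 0 <= C1 by rewrite addr_ge0.
have c00 : 0 < (1 - beta) ^+ 2 / 8.
  by rewrite divr_gt0// exprn_gt0// subr_gt0; case/andP: hbeta.
(* [K] is fixed before [eps] and the shift [d]; the bound [M1 + 1] holds for every [u + d] with
   [d <= eps < 1 / 2]. *)
have [K K0 hK] := gradient_estimate (Z_gt0 hbeta) (Z_tangent hbeta) (dZ_decr hbeta)
  (dZ_ge1 hbeta) (mul_dZ_le hbeta) (mul_dZ_ge hbeta) c00 C10 (addr_gt0 M10 ltr01) R00.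
exists K => // m1 m2 M eps u x r /andP[eps0 eps2] [kC1 [du [ws _ _ uinf]]] r0R xr.
have [g1 [g2 [cu c1 c2 d1 d2]]] := Ck1_closure_open oO kC1.
have [_ uae _] := ws.
have u0 := ae_ge0_open oO cu uae; have u1 := Linfty_le_open oO cu uinf.
have Ox : Omega x.
  by apply: xr; rewrite /cball2/= /sqdist !subrr expr0n addr0 sqr_ge0.
rewrite (grad_enorm (d1 _ Ox) (d2 _ Ox)).
have step d : 0 < d <= eps ->
    r ^+ 2 * (g1 x ^+ 2 + g2 x ^+ 2) <= K * Z beta (u x + d).
  move=> /andP[d0 de].
  have ud0 y : Omega y -> 0 < u y + d by move=> Oy; rewrite ltr_wpDl// u0.
  apply: (hK Omega (fun y => u y + d) g1 g2 x r) => //.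
  - by move=> y Oy; apply: (@continuousD _ _ _ u (cst d)); [exact: cu|exact: cst_continuous].
  - by move=> y Oy; rewrite -[g1 y]addr0; apply: is_deriveD; exact: d1.
  - by move=> y Oy; rewrite -[g2 y]addr0; apply: is_deriveD; exact: d2.
  - move=> y Oy; rewrite ud0// lerD ?u1// (le_trans de)// (le_trans (ltW eps2))//.
    by rewrite ler_pdivrMr// mul1r ler1n.
  - by move=> y Oy; apply: Z_continuous => //; exact: ud0.
  move=> c s N s0 N0 cO hN; apply: weakLap_shift => //.
  have Nb y : cball2 c s y -> (1 + ln (M1 + 1)) * dZ beta (u y + d) + `|lambda| * N2 <= N.
    move=> yb; apply: le_trans (hN _ yb); rewrite [leRHS]mulrDl lerD2l.
    by rewrite ler_peMr// dZ_ge1// ud0//; exact: cO.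
  have Oc : cball2 c s c by rewrite /cball2/= /sqdist !subrr expr0n addr0 sqr_ge0.
  have N10 : 0 <= N - `|lambda| * N2.
    rewrite subr_ge0; apply: le_trans (Nb _ Oc); rewrite lerDr mulr_ge0//.
    by rewrite (le_trans ler01)// dZ_ge1// ud0//; exact: cO.
  move=> phi p1 p2 p11 p12 p21 p22 b b1 b2.
  have := weak_laplacian_bound oO (ltW s0) cO ws cu b b1 b2 N10 N20.
  rewrite subrK; apply.
    move=> y yb; have Oy := cO _ yb; rewrite lerBrDr; apply: le_trans (Nb _ yb).
    by rewrite lerD2r l_eps_bound ?d0 ?u0 ?u1.
  move=> y yb; have Oy := cO _ yb; rewrite normrM; apply: ler_pM => //.
    by apply: hC => // y' Oy'; have [] := hB (u y'); rewrite ?u0 ?u1.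
  by have [] := hB (u y); rewrite ?u0 ?u1.
(* A zero of [u] is an interior minimum, where the gradient vanishes. Elsewhere [dZ (u x)] is finite
   and the tangent inequality lets [d] tend to 0. *)
have := u0 _ Ox; rewrite le_eqVlt => /predU1P[ux|ux].
  have [|-> ->] := @interior_minimum _ Omega u g1 g2 x oO d1 d2 _ Ox.
    by move=> y Oy; rewrite -ux u0.
  rewrite expr0n addr0 mulr0 -ux /Z ler01 powR0 ?expr0n ?mul0r ?addr0 ?subr0 ?mulr0//.
  by rewrite subr_eq0 eq_sym lt_eqF//; case/andP: hbeta.
apply/ler_addgt0Pr => e e0.
have D1 := dZ_ge1 hbeta ux; have D0 := lt_le_trans ltr01 D1.
pose d := Num.min eps (e / (K * dZ beta (u x))).
have KD : 0 < K * dZ beta (u x) by rewrite mulr_gt0.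
have d0 : 0 < d by rewrite lt_min eps0 divr_gt0.
have dle : d * (K * dZ beta (u x)) <= e by rewrite -ler_pdivlMr// ge_min lexx orbT.
apply: le_trans (step d _) _; first by rewrite d0 ge_min lexx.
have := Z_tangent hbeta ux (addr_gt0 ux d0).
rewrite addrAC subrr add0r => /(ler_wpM2l (ltW K0)) h; apply: le_trans h _.
by rewrite mulrDr lerD2l mulrA mulrC.
Qed.

End Regularized.

Theorem lemma4p1 (R : realType) (Omega : set (R * R))
  (mu beta r0 q lambda : R) (f : R -> R) (psi : R * R -> R) (M1 : R)
  (hOmega : smooth_bounded_domain Omega)
  (hmu : 0 < mu < 1) (hbeta : 0 < beta < 1)
  (hf0 : forall t : R, t < 0 -> f t = 0)
  (hf1 : hyp_f1 beta f) (hf2 : hyp_f2 f)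
  (hr0 : 1 < r0 < 2) (hf3 : hyp_f3 r0 f)
  (hf4 : hyp_f4 f) (hf5 : hyp_f5 f) (hf6 : hyp_f6 f)
  (hq : 0 < q < 1) (hqr0 : q < r0 - 1)
  (hlambda : 0 < lambda)
  (hpsi_C2 : Ck_closure 2 Omega psi)
  (hpsi_pos : forall x, Omega x -> 0 < psi x)
  (hpsi_bd : forall x : R * R, boundary Omega x -> psi x = 0)
  (hpsi_grad : exists C : R, forall x, Omega x ->
     enorm (grad psi x) ^+ 2 / psi x <= C)
  (hM1 : 0 < M1) :
  exists K : R, 0 < K /\
    forall (eps0 delta0 : R), 0 < eps0 -> 0 < delta0 ->
    (forall t eps : R, 0 <= t < delta0 -> 0 < eps < eps0 ->
       t <= - ln (t + eps / (t + eps))) ->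
    forall (m1 m2 M : R) (u : R -> R * R -> R), 0 < m1 -> 0 < m2 -> 0 < M ->
    (forall eps : R, 0 < eps < Num.min eps0 (1 / 2) ->
       bounded_solution Omega mu beta q lambda f m1 m2 M M1 eps (u eps)) ->
    forall eps : R, 0 < eps < Num.min eps0 (1 / 2) ->
    forall x : R * R, Omega x ->
      psi x * enorm (grad (u eps) x) ^+ 2 <= K * Z beta (u eps x).
Proof.
have [_ oO _ bO _] := hOmega; have [_ _ cf] := hf1; have /andP[q0 _] := hq.
have [m m0 hm] := bounded_coord bO; have [C hC] := hpsi_grad.
(* The bound on [|grad psi|^2 / psi] is made positive so that it can be divided by. *)
pose L := Num.max C 1; have L0 : 0 < L by rewrite lt_max ltr01 orbT.
have hL x : Omega x -> enorm (grad psi x) ^+ 2 / psi x <= L.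
  by move=> Ox; rewrite le_max hC.
have kpsi : Ck_closure 1 Omega psi.
  move: hpsi_C2 => [cpsi [g1 [g2 [[c1 _] [c2 _] d]]]].
  by split=> //; exists g1, g2.
have m20 : 0 < 2 * m by rewrite mulr_gt0.
have [K K0 hK] := solution_gradient_estimate lambda oO bO hmu hbeta q0 cf hM1 m20.
(* The ball about [x] has squared radius [psi x / L], whence the factor [L]. *)
exists (L * K); split; first exact: mulr_gt0.
move=> eps0 delta0 _ _ _ m1 m2 M u _ _ _ sol eps heps x Ox.
pose r := Num.sqrt (psi x / L).
have xr := sqrt_ball_in_domain oO kpsi hpsi_pos hpsi_bd L0 hL Ox.
have px : 0 < psi x / L by rewrite divr_gt0// hpsi_pos.
have rm : 0 < r <= 2 * m.
  rewrite sqrtr_gt0 px/=.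
  (* The rightmost point of the ball lies in [Omega] as well, so [r] is at most the width [2 * m] of
     a square containing [Omega]. *)
  have /hm[/= h _] : Omega (x.1 + r, x.2).
    apply: xr; rewrite /cball2/= /sqdist/= subrr expr0n addr0 [x.1 + r]addrC addrK.
    exact: lexx.
  have [h' _] := hm _ Ox; move: h h'; rewrite !ler_norml => /andP[_ h] /andP[h' _]; lra.
have eps2 : 0 < eps < 1 / 2.
  by have /andP[e0] := heps; rewrite lt_min e0 => /andP[_].
have := hK _ _ _ _ _ x r eps2 (sol _ heps) rm xr.
rewrite sqr_sqrtr ?(ltW px)// => h.
have -> : psi x * enorm (grad (u eps) x) ^+ 2 = L * (psi x / L * enorm (grad (u eps) x) ^+ 2).
  by field; rewrite gt_eqF.
by rewrite -[leRHS]mulrA ler_pM2l.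
Qed.
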